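(* Let $(M^4,J)$ be a Hopf surface blown up at $p>0$ points. Then $M$ admits no static metrics.
   Context: A Hopf surface here is the quotient of $\mathbb{C}^2\setminus\{0\}$ by the group generated by the map $(z_1,z_2)\mapsto(\alpha_1z_1,\alpha_2z_2)$, where $0<|\alpha_1|\le|\alpha_2|<1$. For a Hermitian metric $g$ with Kähler form $\omega=\frac{\sqrt{-1}}{2}g_{i\bar j}\,dz^i\wedge d\bar z^j$, $g$ is pluriclosed if $\partial\bar\partial\omega=0$. $\partial^*,\bar\partial^*$ are the $L^2(g)$-adjoints of $\partial,\bar\partial$, normalized so that $(\partial^*\omega)_{\bar k}=\frac{\sqrt{-1}}{2}g^{p\bar q}(\partial_{\bar q}g_{p\bar k}-\partial_{\bar k}g_{p\bar q})$ and $(\bar\partial^*\omega)_j=\frac{\sqrt{-1}}{2}g^{p\bar q}(\partial_j g_{p\bar q}-\partial_p g_{j\bar q})$. A pluriclosed metric $g$ is static if $-\partial\partial^*\omega-\bar\partial\bar\partial^*\omega-\frac{\sqrt{-1}}{2}\partial\bar\partial\log\det g=\lambda\omega$ for some constant $\lambda\in\mathbb{R}$, and $\mathrm{Vol}(g)=1$. *)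

(* Defs.v *)
From HB Require Import structures.
From mathcomp Require Import all_boot all_order all_algebra.
From mathcomp Require Import complex.
From mathcomp Require Import all_classical all_reals all_analysis.
Set Implicit Arguments.
Unset Strict Implicit.
Unset Printing Implicit Defensive.
Import Order.TTheory GRing.Theory Num.Theory.
Import numFieldNormedType.Exports.
Local Open Scope classical_set_scope.
Local Open Scope ring_scope.

(* [R[i]] under a name whose head is a [numClosedFieldType], so that the
   topology of numeric fields is inferred on it and on [C2]. *)
Definition Cplx (R : realType) : numClosedFieldType := R[i].

Definition C2 (R : realType) := 'rV[Cplx R]_2.

Section Wirtinger.
Variable R : realType.
Local Notation C := (Cplx R).
Local Notation C2 := (C2 R).
Implicit Types (f : C2 -> C) (V : set C2) (z v : C2) (i j k l : 'I_2).

Definition cRe (w : C) : R := complex.Re (w : R[i]).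
Definition cIm (w : C) : R := complex.Im (w : R[i]).
Definition ofR (t : R) : C := (t%:C)%C.

Definition vec2 (a b : C) : C2 := \row_j (if j == 0 then a else b).

Definition along f z v (part : C -> R) : R -> R :=
  fun t => part (f (z + ofR t *: v)).

Definition dirD f v z : C :=
  (derive1 (along f z v cRe) 0 +i* derive1 (along f z v cIm) 0)%C.

Definition dir_derivable f v z :=
  derivable (along f z v cRe) 0 1 /\ derivable (along f z v cIm) 0 1.

Definition dx i : C2 := delta_mx 0 i.
Definition dy i : C2 := 'i *: delta_mx 0 i.

Definition dz i f z : C := 2^-1 * (dirD f (dx i) z - 'i * dirD f (dy i) z).
Definition dzb i f z : C := 2^-1 * (dirD f (dx i) z + 'i * dirD f (dy i) z).

(* [Cn n V f]: all iterated real partial derivatives of f of order at most n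
   exist and are continuous on the open set V. *)
Fixpoint Cn (n : nat) V f : Prop :=
  (forall z, V z -> {for z, continuous f}) /\
  match n with
  | 0 => True
  | n'.+1 => forall i v, v = dx i \/ v = dy i ->
      (forall z, V z -> dir_derivable f v z) /\ Cn n' V (dirD f v)
  end.

Definition smooth V f := forall n, Cn n V f.

Definition holomorphic V (F : C2 -> C2) := forall k,
  smooth V (fun z => F z 0 k) /\
  forall z, V z -> forall i, dzb i (fun z => F z 0 k) z = 0.

(* Differential forms on an open subset of C^2, by their coefficients:
   - (1,0) and (0,1): b i on dz^i, resp. b j on dzbar^j;
   - (1,1): a i j on dz^i /\ dzbar^j;
   - (1,2): b i l j on dz^i /\ dzbar^l /\ dzbar^j, skew in l, j;
   - (2,2): c k i l j on dz^k /\ dz^i /\ dzbar^l /\ dzbar^j, skew in k, i and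
     in l, j.
   The signs below come from moving dzbar past dz. *)
Definition del01 (b : 'I_2 -> C2 -> C) i j z : C := dz i (b j) z.

Definition dbar10 (b : 'I_2 -> C2 -> C) i j z : C := - dzb j (b i) z.

Definition deldbar0 f i j z : C := dz i (dzb j f) z.

Definition dbar11 (a : 'I_2 -> 'I_2 -> C2 -> C) i l j z : C :=
  - (dzb l (a i j) z - dzb j (a i l) z).

Definition del12 (b : 'I_2 -> 'I_2 -> 'I_2 -> C2 -> C) k i l j z : C :=
  dz k (b i l j) z - dz i (b k l j) z.

(* A metric in one coordinate system: [g z i j] is g_{i jbar} at z. *)
Section LocalMetric.
Variable g : C2 -> 'M[C]_2.

(* g^{p qbar}, normalized by sum_q g^{p qbar} g_{r qbar} = delta_{p r},
   whence the transposition. *)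
Definition ginv z p q : C := invmx (g z) q p.

Definition kahler i j z : C := 'i / 2 * g z i j.

Definition del_adj k z : C := 'i / 2 * \sum_p \sum_q
  ginv z p q * (dzb q (fun w => g w p k) z - dzb k (fun w => g w p q) z).

Definition dbar_adj j z : C := 'i / 2 * \sum_p \sum_q
  ginv z p q * (dz j (fun w => g w p q) z - dz p (fun w => g w j q) z).

Definition logdet z : C := ofR (ln (cRe (\det (g z)))).

Definition pluriclosed_on V := forall z, V z ->
  forall k i l j, del12 (dbar11 kahler) k i l j z = 0.

Definition static_on (lambda : R) V := forall z, V z -> forall i j,
  - del01 del_adj i j z - dbar10 dbar_adj i j z
    - 'i / 2 * deldbar0 logdet i j z = ofR lambda * kahler i j z.

End LocalMetric.

End Wirtinger.

(* The values of [coord] outside [dom] and of [param] outside [cod] are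
   irrelevant. *)
Record chart (R : realType) (T : Type) := Chart {
  dom : set T;
  cod : set (C2 R);
  coord : T -> C2 R;
  param : C2 R -> T }.

Definition is_chart (R : realType) (T : topologicalType) (c : chart R T) :=
  [/\ open (dom c), open (cod c),
      (forall x, dom c x ->
         [/\ cod c (coord c x), param c (coord c x) = x &
             {for x, continuous (coord c)}]) &
      (forall z, cod c z ->
         [/\ dom c (param c z), coord c (param c z) = z &
             {for z, continuous (param c)}])].

Definition overlap (R : realType) (T : Type) (c c' : chart R T) : set (C2 R) :=
  [set z | cod c z /\ dom c' (param c z)].

Definition transition (R : realType) (T : Type) (c c' : chart R T) :
  C2 R -> C2 R := fun z => coord c' (param c z).

Definition compatible (R : realType) (T : Type) (c c' : chart R T) :=
  holomorphic (overlap c c') (transition c c') /\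
  holomorphic (overlap c' c) (transition c' c).

(* The carrier is pointed only because the library's generated
   sigma-algebras are; the point plays no role. *)
Record complex_surface (R : realType) := ComplexSurface {
  carrier :> ptopologicalType;
  atlas : set (chart R carrier);
  surface_hausdorff : hausdorff_space carrier;
  surface_second_countable : @second_countable carrier;
  atlas_chart : forall c, atlas c -> is_chart c;
  atlas_cover : forall x : carrier, exists2 c, atlas c & dom c x;
  atlas_compatible : forall c c', atlas c -> atlas c' -> compatible c c';
  atlas_maximal : forall c, is_chart c ->
    (forall c', atlas c' -> compatible c c') -> atlas c }.

Section HermitianMetrics.
Variables (R : realType) (X : complex_surface R).

Definition metric := chart R X -> C2 R -> 'M[Cplx R]_2.

Implicit Type g : metric.

Definition hermitian_metric g :=
  [/\ (forall c, atlas c -> forall i j, smooth (cod c) (fun z => g c z i j)),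
      (forall c, atlas c -> forall z, cod c z ->
         forall i j, g c z j i = (g c z i j)^*),
      (forall c, atlas c -> forall z, cod c z -> forall v : C2 R, v != 0 ->
         0 < \sum_i \sum_j g c z i j * v 0 i * (v 0 j)^*) &
      (forall c c', atlas c -> atlas c' -> forall z, overlap c c' z ->
         forall i j, g c z i j = \sum_k \sum_l
           dz i (fun w => transition c c' w 0 k) z *
           (dz j (fun w => transition c c' w 0 l) z)^* *
           g c' (transition c c' z) k l)].

Definition pt4 (x : (R * R) * (R * R)) : C2 R :=
  vec2 (x.1.1 +i* x.1.2)%C (x.2.1 +i* x.2.2)%C.

Definition lebesgue4 :=
  ((lebesgue_measure \x lebesgue_measure) \x
   (lebesgue_measure \x lebesgue_measure) :
     set ((measurableTypeR R * measurableTypeR R) *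
          (measurableTypeR R * measurableTypeR R)) -> \bar R)%E.

Definition borel_surface := g_sigma_algebraType (@open X).

(* The Riemannian measure of g is the Borel measure with density det g in
   every chart; this is the measure of the volume form omega^2 / 2. *)
Definition riemannian_measure g (mu : set borel_surface -> \bar R) :=
  forall c, atlas c -> forall A : set borel_surface,
    measurable A -> A `<=` dom c ->
    mu A = (\int[lebesgue4]_(x in [set x | cod c (pt4 x) /\ A (param c (pt4 x))])
              (cRe (\det (g c (pt4 x))))%:E)%E.

Definition volume_eq g (v : \bar R) :=
  exists2 mu : {measure set borel_surface -> \bar R},
    riemannian_measure g mu & mu setT = v.

Definition pluriclosed g :=
  forall c, atlas c -> pluriclosed_on (g c) (cod c).

Definition static_metric g :=
  [/\ hermitian_metric g,
      pluriclosed g,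
      (exists lambda : R, forall c, atlas c ->
         static_on (g c) lambda (cod c)) &
      volume_eq g 1%E].

End HermitianMetrics.

(* X is the quotient of C^2 \ {0} by the group generated by
   (z1, z2) |-> (a1 z1, a2 z2): pi is the quotient map, and the complex
   structure is the one for which the restrictions of pi to the open sets on
   which it is injective are inverses of charts. *)
Definition is_hopf_quotient (R : realType) (a1 a2 : Cplx R)
    (X : complex_surface R) (pi : C2 R -> X) :=
  [/\ (forall x, exists2 z, z != 0 & pi z = x),
      (forall z w, z != 0 -> w != 0 -> pi z = pi w <->
         exists n : int, w = vec2 (a1 ^ n * z 0 0) (a2 ^ n * z 0 1)) &
      (forall V : set (C2 R), open V -> ~ V 0 ->
         (forall z w, V z -> V w -> pi z = pi w -> z = w) ->
         exists c : chart R X, [/\ atlas c, cod c = V, dom c = pi @` V &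
           forall z, V z -> param c z = pi z])].

Definition is_hopf_surface (R : realType) (a1 a2 : Cplx R)
    (X : complex_surface R) :=
  exists pi : C2 R -> X, is_hopf_quotient a1 a2 pi.

Definition holomorphic_map_on (R : realType) (X Y : complex_surface R)
    (A : set X) (f : X -> Y) :=
  (forall x, A x -> {for x, continuous f}) /\
  forall (c : chart R X) (c' : chart R Y), atlas c -> atlas c' ->
    holomorphic [set z | [/\ cod c z, A (param c z) & dom c' (f (param c z))]]
      (fun z => coord c' (f (param c z))).

Definition biholomorphic_on (R : realType) (X Y : complex_surface R)
    (A : set X) (B : set Y) (f : X -> Y) :=
  [/\ open A, open B, holomorphic_map_on A f &
      exists h : Y -> X,
        [/\ holomorphic_map_on B h,
            (forall x, A x -> B (f x) /\ h (f x) = x) &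
            (forall y, B y -> A (h y) /\ f (h y) = y)]].

(* pi : Z -> Y is the blow-up of the point x. Over a chart c centred at x, with
   coordinates (z1, z2), Z is the usual blow-up of the origin, covered by the
   charts (u, v) = (z1, z2 / z1) and (s, t) = (z1 / z2, z2), which are glued
   along s v = 1; away from the fibre over x, pi is biholomorphic. *)
Definition is_blowup_map (R : realType) (Y Z : complex_surface R) (x : Y)
    (pi : Z -> Y) :=
  [/\ biholomorphic_on [set y | pi y <> x] [set y | y <> x] pi &
      exists (c : chart R Y) (c1 c2 : chart R Z),
        [/\ [/\ atlas c, dom c x & coord c x = 0],
            [/\ atlas c1,
                cod c1 = [set q | cod c (vec2 (q 0 0) (q 0 0 * q 0 1))] &
                forall q, cod c1 q ->
                  dom c (pi (param c1 q)) /\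
                  coord c (pi (param c1 q)) = vec2 (q 0 0) (q 0 0 * q 0 1)],
            [/\ atlas c2,
                cod c2 = [set r | cod c (vec2 (r 0 0 * r 0 1) (r 0 1))] &
                forall r, cod c2 r ->
                  dom c (pi (param c2 r)) /\
                  coord c (pi (param c2 r)) = vec2 (r 0 0 * r 0 1) (r 0 1)],
            pi @^-1` dom c = dom c1 `|` dom c2 &
            forall q r, cod c1 q -> cod c2 r ->
              (param c1 q = param c2 r <->
               q 0 0 = r 0 0 * r 0 1 /\ r 0 0 * q 0 1 = 1)]].

Definition is_blowup (R : realType) (Y Z : complex_surface R) :=
  exists (x : Y) (pi : Z -> Y), is_blowup_map x pi.

(* Each point is taken on the surface produced so far: this covers both
   distinct points of the original surface and infinitely near points. *)
Inductive blown_up (R : realType) (X : complex_surface R) :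
    nat -> complex_surface R -> Prop :=
| blown_up0 : blown_up X 0 X
| blown_upS p Y Z : blown_up X p Y -> is_blowup Y Z -> blown_up X p.+1 Z.

(* Main.v *)
(* Restrict the static equation to a holomorphic curve z(zeta): contracted with
   the velocity V = z', its imaginary part reads
     d_x P + d_y Q = lambda |V|_g^2,
   where P and Q are linear in the values on V of the torsion 1-form del^* omega
   and of dbar log det g. Green's theorem on squares then bounds lambda times the
   area of the curve by boundary terms.

   On the Hopf surface the leaves zeta |-> (c e^(ln|a1| zeta), e^(ln|a2| zeta))
   wind in the compact hypersurfaces where ln|a2| ln|z1| - ln|a1| ln|z2| is
   constant. All but finitely many of these hypersurfaces avoid the blown-up
   points, hence lift to M, with P, Q bounded and |V|_g bounded below on them.
   A square of side N has area of order N^2 and boundary terms of order N, so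
   lambda = 0.

   On the exceptional curve of the last blow-up, with affine coordinate v, the
   torsion is O(1/|v|^2) at infinity while dbar_v log det g = - 1 / conj v +
   O(1/|v|^2), because K_M has degree -1 there. The boundary terms on large
   squares then stay away from 0, so lambda cannot be 0. *)
From mathcomp Require Import all_boot all_order all_algebra.
From mathcomp Require Import complex.
From mathcomp Require Import all_classical all_reals all_analysis.
From mathcomp Require Import ring lra.
Require Import Defs.
Set Implicit Arguments.
Unset Strict Implicit.
Unset Printing Implicit Defensive.
Import Order.TTheory GRing.Theory Num.Theory.
Import numFieldNormedType.Exports.
Local Open Scope classical_set_scope.
Local Open Scope ring_scope.

(** The vanishing of lambda holds for every number of blow-ups, zero included, so the contradiction
    has to come from an exceptional curve. A leaf need not be preserved by the deck group: the
    generator also turns the arguments of the coordinates and sends the leaf to another one in the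
    same hypersurface. The bounds therefore rest on compactness and not on periodicity along the
    leaf. They apply to dbar log det g although this is not a tensor: the deck transformations have
    constant Jacobian, so its correction term vanishes. On the exceptional curve the same correction
    is the logarithmic derivative of the Jacobian 1/v of the gluing, and it is the only term of
    order 1/|v|. In both cases the boundary terms are estimated pointwise; Green's theorem is thus
    needed only as the existence of a point (x, y) of the square whose four boundary values satisfy
    the expected inequality, and no integral occurs. *)

Lemma ord2 (k : 'I_2) : k = 0 \/ k = 1.
Proof. by case: k => [[|[|//]]] ?; [left|right]; exact/val_inj. Qed.

(** * Complex numbers in real coordinates *)

Section Coordinates.
Variable R : realType.
Local Notation C := (Cplx R).
Implicit Types (a b w : C) (s t : R).

Lemma cReD a b : cRe (a + b) = cRe a + cRe b. Proof. by case: a; case: b. Qed.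
Lemma cImD a b : cIm (a + b) = cIm a + cIm b. Proof. by case: a; case: b. Qed.
Lemma cReN a : cRe (- a) = - cRe a. Proof. by case: a. Qed.
Lemma cImN a : cIm (- a) = - cIm a. Proof. by case: a. Qed.
Lemma cReM a b : cRe (a * b) = cRe a * cRe b - cIm a * cIm b.
Proof. by case: a; case: b. Qed.
Lemma cImM a b : cIm (a * b) = cRe a * cIm b + cIm a * cRe b.
Proof. by case: a => ? ?; case: b => ? ?; rewrite /cIm /= addrC. Qed.
Lemma cRe_conj a : cRe a^* = cRe a. Proof. by case: a. Qed.
Lemma cIm_conj a : cIm a^* = - cIm a. Proof. by case: a. Qed.
Lemma cRe_ofR t : cRe (ofR t) = t. Proof. by []. Qed.
Lemma cIm_ofR t : cIm (ofR t) = 0. Proof. by []. Qed.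
Lemma cRe0 : cRe (0 : C) = 0. Proof. by []. Qed.
Lemma cIm0 : cIm (0 : C) = 0. Proof. by []. Qed.
Lemma cRei : cRe ('i : C) = 0. Proof. by rewrite -complexiE. Qed.
Lemma cImi : cIm ('i : C) = 1. Proof. by rewrite -complexiE. Qed.

Lemma ceqP a b : cRe a = cRe b -> cIm a = cIm b -> a = b.
Proof. by case: a => ? ?; case: b => ? ? /= -> ->. Qed.

Lemma ofRD s t : ofR (s + t) = ofR s + ofR t.
Proof. by apply: ceqP; rewrite ?cReD ?cImD ?cRe_ofR ?cIm_ofR ?addr0. Qed.
Lemma ofRN s : ofR (- s) = - ofR s.
Proof. by apply: ceqP; rewrite ?cReN ?cImN ?cRe_ofR ?cIm_ofR ?oppr0. Qed.
Lemma ofRM s t : ofR (s * t) = ofR s * ofR t.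
Proof.
by apply: ceqP; rewrite ?cReM ?cImM ?cRe_ofR ?cIm_ofR !(mulr0, mul0r) ?subr0 ?addr0.
Qed.
Lemma ofR0 : ofR 0 = 0 :> C. Proof. by []. Qed.
Lemma ofR1 : ofR 1 = 1 :> C. Proof. by []. Qed.
Lemma ofRn n : ofR n%:R = n%:R :> C.
Proof. by elim: n => // n IH; rewrite -addn1 !natrD ofRD IH. Qed.
Lemma ofRV s : ofR s^-1 = (ofR s)^-1.
Proof.
have [->|s0] := eqVneq s 0; first by rewrite invr0 ofR0 invr0.
have h : ofR s != 0 by apply/eqP => /(congr1 (@cRe R)) /= /eqP; rewrite (negbTE s0).
by apply: (mulfI h); rewrite -ofRM !divff // ofR1.
Qed.
Lemma conj_ofR s : (ofR s)^* = ofR s.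
Proof. by apply: ceqP; rewrite ?cRe_conj ?cIm_conj // cIm_ofR oppr0. Qed.

Lemma conji : ('i : C)^* = - 'i.
Proof.
by apply: ceqP; rewrite ?cRe_conj ?cIm_conj ?cReN ?cImN ?cRei ?cImi ?oppr0.
Qed.

Lemma cconjD a b : (a + b)^* = a^* + b^*. Proof. exact: rmorphD. Qed.
Lemma cconjN a : (- a)^* = - a^*. Proof. exact: rmorphN. Qed.
Lemma cconjB a b : (a - b)^* = a^* - b^*. Proof. exact: rmorphB. Qed.
Lemma cconjM a b : (a * b)^* = a^* * b^*. Proof. exact: rmorphM. Qed.
Lemma cconjV a : (a^-1)^* = (a^*)^-1. Proof. exact: fmorphV. Qed.
Lemma cconj_sum n (F : 'I_n -> C) : (\sum_i F i)^* = \sum_i (F i)^*.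
Proof. exact: rmorph_sum. Qed.
Lemma cconjn n : (n%:R : C)^* = n%:R. Proof. exact: rmorph_nat. Qed.

Lemma cRe_sum n (F : 'I_n -> C) : cRe (\sum_i F i) = \sum_i cRe (F i).
Proof. exact: (big_morph _ cReD cRe0). Qed.
Lemma cIm_sum n (F : 'I_n -> C) : cIm (\sum_i F i) = \sum_i cIm (F i).
Proof. exact: (big_morph _ cImD cIm0). Qed.

Lemma cE w : w = ofR (cRe w) + 'i * ofR (cIm w).
Proof.
apply: ceqP; rewrite ?cReD ?cImD ?cReM ?cImM ?cRei ?cImi !cRe_ofR !cIm_ofR;
  by rewrite !(mul0r, mulr0, subr0, addr0, mul1r, add0r).
Qed.

Lemma ii : 'i * 'i = -1 :> C. Proof. by rewrite -expr2 sqrCi. Qed.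

Lemma ofR_ge0 t : (0 <= ofR t :> C) = (0 <= t).
Proof. by rewrite (_ : 0 = ofR 0 :> C) // lecR. Qed.
Lemma ofR_gt0 t : (0 < ofR t :> C) = (0 < t).
Proof. by rewrite (_ : 0 = ofR 0 :> C) // ltcR. Qed.
Lemma ofR_le s t : (ofR s <= ofR t :> C) = (s <= t). Proof. exact: lecR. Qed.
Lemma ofR_lt s t : (ofR s < ofR t :> C) = (s < t). Proof. exact: ltcR. Qed.

Lemma gt0_ofR w : 0 < w -> exists r, w = ofR r.
Proof.
case: w => x y; rewrite ltcE /= => /andP[/eqP y0 _]; exists x.
by apply: ceqP.
Qed.

(** The norm on [Cplx R] takes its values in [Cplx R]; this is the same modulus as a real number,
    for use in real estimates and limits. *)
Definition cabs w : R := cRe `|w|.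

Lemma cabsE w : `|w| = ofR (cabs w).
Proof. by rewrite /cabs normc_def. Qed.

Lemma cabs_sqrt w : cabs w = Num.sqrt (cRe w ^+ 2 + cIm w ^+ 2).
Proof. by rewrite /cabs normc_def. Qed.

Lemma cabs_ge0 w : 0 <= cabs w. Proof. by rewrite -ofR_ge0 -cabsE. Qed.

Lemma cabs_sq w : cabs w ^+ 2 = cRe w ^+ 2 + cIm w ^+ 2.
Proof. by rewrite cabs_sqrt sqr_sqrtr // addr_ge0 // sqr_ge0. Qed.

Lemma cabsM a b : cabs (a * b) = cabs a * cabs b.
Proof. by rewrite /cabs normrM !cabsE -ofRM. Qed.

Lemma cabsD a b : cabs (a + b) <= cabs a + cabs b.
Proof. by rewrite -ofR_le ofRD -!cabsE ler_normD. Qed.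

Lemma cabsN a : cabs (- a) = cabs a. Proof. by rewrite /cabs normrN. Qed.
Lemma cabs_conj a : cabs a^* = cabs a.
Proof. by rewrite /cabs norm_conjC. Qed.
Lemma cabs_ofR t : cabs (ofR t) = `|t|.
Proof. by rewrite cabs_sqrt cRe_ofR cIm_ofR expr0n addr0 sqrtr_sqr. Qed.
Lemma cabs0 : cabs 0 = 0. Proof. by rewrite -ofR0 cabs_ofR normr0. Qed.
Lemma cabsV a : cabs a^-1 = (cabs a)^-1.
Proof. by rewrite /cabs normfV !cabsE -ofRV. Qed.
Lemma cabs_gt0 a : (0 < cabs a) = (a != 0).
Proof. by rewrite -ofR_gt0 -cabsE normr_gt0. Qed.
Lemma cabs_i : cabs 'i = 1. Proof. by rewrite /cabs normCi. Qed.

Lemma le_Re_cabs w : `|cRe w| <= cabs w.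
Proof. by rewrite -ofR_le -cabsE; exact: normc_ge_Re. Qed.
Lemma le_Im_cabs w : `|cIm w| <= cabs w.
Proof.
have := le_Re_cabs ('i * w); rewrite cabsM cabs_i mul1r cReM cRei cImi mul0r.
by rewrite mul1r sub0r normrN.
Qed.
End Coordinates.

(** * Topology of C and C^2 in terms of real radii *)

Section Continuity.
Variable R : realType.
Local Notation C := (Cplx R).
Local Notation C2 := (C2 R).

(** Balls of [Cplx R] have radii in [Cplx R]; a positive radius is real by [gt0_ofR], so real radii
    give the same neighbourhoods. *)
Lemma nbhs_cabs (w : C) (A : set C) :
  nbhs w A <-> exists2 r : R, 0 < r & forall w', cabs (w' - w) < r -> A w'.
Proof.
split=> [/nbhs_ballP[e /= e0 eA]|[r r0 rA]].
  have [r er] := gt0_ofR e0.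
  exists r; first by move: e0; rewrite /= er ofR_gt0.
  move=> w' h; apply: eA; rewrite /ball /= distrC er cabsE ofR_lt //.
apply/nbhs_ballP; exists (ofR r); first by rewrite /= ofR_gt0.
move=> w'; rewrite /ball /= distrC cabsE ofR_lt; exact: rA.
Qed.

Lemma continuous_cRe : continuous (@cRe R : C -> R).
Proof.
move=> w A /nbhs_ballP[e /= e0 eA]; apply/nbhs_cabs; exists e => // w' h.
by apply: eA; apply: le_lt_trans h; rewrite -cReN -cReD -cabsN opprB; exact: le_Re_cabs.
Qed.

Lemma continuous_cIm : continuous (@cIm R : C -> R).
Proof.
move=> w A /nbhs_ballP[e /= e0 eA]; apply/nbhs_cabs; exists e => // w' h.
by apply: eA; apply: le_lt_trans h; rewrite -cImN -cImD -cabsN opprB; exact: le_Im_cabs.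
Qed.

Lemma continuous_ofR : continuous (@ofR R : R -> C).
Proof.
move=> t A /nbhs_cabs[r r0 rA]; apply/nbhs_ballP; exists r => // s.
rewrite /ball /= distrC => h; apply: rA.
by rewrite -ofRN -ofRD cabs_ofR.
Qed.

Lemma continuous_conj : continuous (fun w : C => w^*).
Proof.
move=> w A /nbhs_cabs[r r0 rA]; apply/nbhs_cabs; exists r => // w' h.
by apply: rA; rewrite -rmorphB cabs_conj.
Qed.

Lemma nbhs_C2 (z : C2) (A : set C2) :
  nbhs z A <-> exists2 r : R, 0 < r &
    forall w : C2, (forall k, cabs (w 0 k - z 0 k) < r) -> A w.
Proof.
split=> [/nbhs_ballP[e /= e0 eA]|[r r0 rA]].
  have [r er] := gt0_ofR e0.
  exists r; first by move: e0; rewrite /= er ofR_gt0.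
  move=> w h; apply: eA; split; first exact: e0.
  by move=> i j; rewrite (ord1 i) /ball /= distrC er cabsE ofR_lt.
apply/nbhs_ballP; exists (ofR r); first by rewrite /= ofR_gt0.
move=> w [_ h]; apply: rA => k; have := h 0 k.
by rewrite /ball /= distrC cabsE ofR_lt.
Qed.

Variable T : topologicalType.

Lemma continuous_cplx (f : T -> C) x :
  {for x, continuous (fun y => cRe (f y))} ->
  {for x, continuous (fun y => cIm (f y))} -> {for x, continuous f}.
Proof.
move=> cr ci.
have -> : f = (fun y => ofR (cRe (f y)) + 'i * ofR (cIm (f y))).
  by apply/funext => y; rewrite -cE.
have k (g : T -> R) : {for x, continuous g} -> {for x, continuous (fun y => ofR (g y) : C)}.
  by move=> cg; apply: (@continuous_comp _ _ _ g (@ofR R)) => //; exact: continuous_ofR.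
apply: (@cvgD _ _ _ _ _ (fun y => ofR (cRe (f y))) (fun y => 'i * ofR (cIm (f y)))).
  exact: k.
apply: (@cvgM _ _ _ _ (cst 'i) (fun y => ofR (cIm (f y)))); first exact: cvg_cst.
exact: k.
Qed.

Lemma continuous_C2 (f : T -> C2) x :
  (forall k, {for x, continuous (fun y => f y 0 k)}) -> {for x, continuous f}.
Proof.
move=> h A /nbhs_C2[r r0 rA].
have h' k : \forall y \near x, cabs (f y 0 k - f x 0 k) < r.
  by apply: (h k [set w | cabs (w - f x 0 k) < r]); apply/nbhs_cabs; exists r.
suff : \forall y \near x, A (f y) by [].
apply: filterS (filterI (h' 0) (h' 1)) => y [h0 h1]; apply: rA => k.
by have [->|->] := ord2 k.
Qed.

Lemma continuous_coord (k : 'I_2) : continuous (fun z : C2 => z 0 k : C).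
Proof.
move=> z A /nbhs_cabs[r r0 rA]; apply/nbhs_C2; exists r => // w h.
exact: rA (h k).
Qed.

End Continuity.

Section ContinuityRules.
Variable R : realType.
Local Notation C := (Cplx R).
Local Notation C2 := (C2 R).

Lemma vec2_0 (a b : C) : (vec2 a b : C2) 0 0 = a. Proof. by rewrite mxE. Qed.
Lemma vec2_1 (a b : C) : (vec2 a b : C2) 0 1 = b. Proof. by rewrite mxE. Qed.
Lemma vec2E (z : C2) : vec2 (z 0 0) (z 0 1) = z.
Proof. by apply/rowP => k; rewrite mxE; have [->|->] := ord2 k. Qed.

Lemma near_continuous (T U : topologicalType) (f g : T -> U) x :
  (\forall y \near x, f y = g y) -> {for x, continuous f} -> {for x, continuous g}.
Proof.
move=> fg cf; have fgx : f x = g x by exact: nbhs_singleton fg.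
move=> A; rewrite -fgx => /cf; rewrite /nbhs /= => h.
by apply: filterS (filterI fg h) => y [/= <-].
Qed.

Lemma continuous_ext (T U : topologicalType) (f g : T -> U) x :
  (forall y, f y = g y) -> {for x, continuous f} -> {for x, continuous g}.
Proof. by move=> /funext ->. Qed.

Lemma continuous_at_cst (T U : topologicalType) (a : U) (x : T) : {for x, continuous (fun _ : T => a)}.
Proof. exact: cst_continuous. Qed.

Lemma continuous_cD (T : topologicalType) (f g : T -> C) x : {for x, continuous f} ->
  {for x, continuous g} -> {for x, continuous (fun y => f y + g y)}.
Proof. by move=> cf cg; exact: cvgD cf cg. Qed.

Lemma continuous_cN (T : topologicalType) (f : T -> C) x : {for x, continuous f} ->
  {for x, continuous (fun y => - f y)}.
Proof. by move=> cf; exact: cvgN cf. Qed.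

Lemma continuous_cM (T : topologicalType) (f g : T -> C) x : {for x, continuous f} ->
  {for x, continuous g} -> {for x, continuous (fun y => f y * g y)}.
Proof. by move=> cf cg; exact: cvgM cf cg. Qed.

Lemma continuous_cV (T : topologicalType) (f : T -> C) x : f x != 0 -> {for x, continuous f} ->
  {for x, continuous (fun y => (f y)^-1)}.
Proof. by move=> f0 cf; exact: cvgV f0 cf. Qed.

Lemma continuous_cconj (T : topologicalType) (f : T -> C) x : {for x, continuous f} ->
  {for x, continuous (fun y => (f y)^*)}.
Proof.
move=> cf; apply: (@continuous_comp _ _ _ f (fun w : C => w^*)); first exact: cf.
exact: continuous_conj.
Qed.

Lemma continuous_csum (T : topologicalType) n (f : 'I_n -> T -> C) x :
  (forall i : 'I_n, {for x, continuous (f i)}) -> {for x, continuous (fun y => \sum_i f i y)}.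
Proof.
elim: n f => [|n IH] f h.
  apply: (@continuous_ext _ _ (cst 0)) => [s|]; first by rewrite big_ord0.
  exact: cvg_cst.
apply: (@continuous_ext _ _ (fun y => \sum_(i < n) f (widen_ord (leqnSn n) i) y + f ord_max y)).
  by move=> s; rewrite big_ord_recr.
by apply: continuous_cD => //; apply: IH => i.
Qed.

Lemma continuous_cRe_comp (T : topologicalType) (f : T -> C) x : {for x, continuous f} ->
  {for x, continuous (fun y => cRe (f y))}.
Proof.
move=> cf; apply: (@continuous_comp _ _ _ f (@cRe R)); [exact: cf|exact: continuous_cRe].
Qed.

Lemma continuous_cIm_comp (T : topologicalType) (f : T -> C) x : {for x, continuous f} ->
  {for x, continuous (fun y => cIm (f y))}.
Proof.
move=> cf; apply: (@continuous_comp _ _ _ f (@cIm R)); [exact: cf|exact: continuous_cIm].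
Qed.

Lemma continuous_rM (T : topologicalType) (f g : T -> R) x : {for x, continuous f} ->
  {for x, continuous g} -> {for x, continuous (fun y => f y * g y)}.
Proof. by move=> cf cg; exact: cvgM cf cg. Qed.

Lemma continuous_rD (T : topologicalType) (f g : T -> R) x : {for x, continuous f} ->
  {for x, continuous g} -> {for x, continuous (fun y => f y + g y)}.
Proof. by move=> cf cg; exact: cvgD cf cg. Qed.

Lemma continuous_lincomb (T : topologicalType) (F G : T -> R) (a b : R) (t : T) :
  {for t, continuous F} -> {for t, continuous G} ->
  {for t, continuous (fun s => a * F s - b * G s)}.
Proof.
move=> cF cG; apply: (@cvgB _ _ _ _ _ (fun s => a * F s) (fun s => b * G s)).
  by apply: (@cvgM _ _ _ _ (fun _ => a) F); [exact: cst_continuous|exact: cF].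
by apply: (@cvgM _ _ _ _ (fun _ => b) G); [exact: cst_continuous|exact: cG].
Qed.

Lemma continuous_cabs_comp (T : topologicalType) (f : T -> C) x : {for x, continuous f} ->
  {for x, continuous (fun y => cabs (f y))}.
Proof.
move=> cf; have -> : (fun y => cabs (f y)) = (fun y => Num.sqrt (cRe (f y) * cRe (f y) + cIm (f y) * cIm (f y))).
  by apply/funext => y; rewrite cabs_sqrt !expr2.
have h : {for x, continuous (fun y => cRe (f y) * cRe (f y) + cIm (f y) * cIm (f y))}.
  by apply: continuous_rD; apply: continuous_rM; (exact: continuous_cRe_comp || exact: continuous_cIm_comp).
apply: (@continuous_comp _ _ _ (fun y => cRe (f y) * cRe (f y) + cIm (f y) * cIm (f y)) Num.sqrt).
  exact: h.
exact: sqrt_continuous.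
Qed.

Lemma nonzero_near (T : topologicalType) (f : T -> C) x : {for x, continuous f} -> f x != 0 ->
  \forall y \near x, f y != 0.
Proof.
move=> cf f0; apply: (cf [set w | w != 0]); apply/nbhs_cabs; exists (cabs (f x)); first by rewrite cabs_gt0.
by move=> w hw /=; apply: contraTneq hw => ->; rewrite sub0r cabsN -leNgt.
Qed.

Lemma continuous_fst_at (T U : topologicalType) (p : T * U) : {for p, continuous (fun q : T * U => q.1)}.
Proof. by move=> A hA; exact: cvg_fst hA. Qed.

Lemma continuous_snd_at (T U : topologicalType) (p : T * U) : {for p, continuous (fun q : T * U => q.2)}.
Proof. by move=> A hA; exact: cvg_snd hA. Qed.

Lemma continuous_ofR_comp (T : topologicalType) (f : T -> R) x : {for x, continuous f} ->
  {for x, continuous (fun y => ofR (f y) : C)}.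
Proof.
by move=> cf; apply: (@continuous_comp _ _ _ f (@ofR R)); [exact: cf|exact: continuous_ofR].
Qed.

Lemma continuous_expR_comp (T : topologicalType) (f : T -> R) x : {for x, continuous f} ->
  {for x, continuous (fun y => expR (f y))}.
Proof.
by move=> cf; apply: (@continuous_comp _ _ _ f (@expR R)); [exact: cf|exact: continuous_expR].
Qed.

Lemma continuous_vec2 (T : topologicalType) (f h : T -> C) x : {for x, continuous f} ->
  {for x, continuous h} -> {for x, continuous (fun y => vec2 (f y) (h y) : C2)}.
Proof.
move=> cf ch; apply: continuous_C2 => k; have [->|->] := ord2 k.
  by apply: (@continuous_ext _ _ f) => [y|]; [rewrite vec2_0|exact: cf].
by apply: (@continuous_ext _ _ h) => [y|]; [rewrite vec2_1|exact: ch].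
Qed.

End ContinuityRules.

(** * Derivatives along real curves *)

Section Cderiv.
Variable R : realType.
Local Notation C := (Cplx R).
Local Notation C2 := (C2 R).

Implicit Types t : R.

Lemma is_derive_add (f g : R -> R) t a b : is_derive t 1 f a -> is_derive t 1 g b ->
  is_derive t 1 (fun s => f s + g s) (a + b).
Proof. by move=> *; exact: is_deriveD. Qed.

Lemma is_derive_opp (f : R -> R) t a : is_derive t 1 f a ->
  is_derive t 1 (fun s => - f s) (- a).
Proof. by move=> *; exact: is_deriveN. Qed.

Lemma is_derive_sub (f g : R -> R) t a b : is_derive t 1 f a -> is_derive t 1 g b ->
  is_derive t 1 (fun s => f s - g s) (a - b).
Proof. by move=> *; apply: is_derive_add => //; exact: is_derive_opp. Qed.

Lemma is_derive_mul (f g : R -> R) t a b : is_derive t 1 f a -> is_derive t 1 g b ->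
  is_derive t 1 (fun s => f s * g s) (a * g t + f t * b).
Proof.
by move=> *; apply: is_derive_eq (is_deriveM _ _) _; rewrite addrC mulrC.
Qed.

Lemma is_derive_inv (f : R -> R) t a : f t != 0 -> is_derive t 1 f a ->
  is_derive t 1 (fun s => (f s)^-1) (- a / f t ^+ 2).
Proof.
move=> f0 df; apply: is_derive_eq (is_deriveV f0 df) _.
by rewrite /GRing.scale /= mulNr mulrC mulNr.
Qed.

Lemma is_derive_uniq (f : R -> R) t a b : is_derive t 1 f a -> is_derive t 1 f b -> a = b.
Proof. by move=> [_ <-] [_ <-]. Qed.

Lemma is_derive_continuous (f : R -> R) t a : is_derive t 1 f a -> {for t, continuous f}.
Proof. by move=> [/derivable1_diffP /differentiable_continuous]. Qed.

(** Stated with absolute values to treat both signs of [s] at once: increments along an axis come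
    with either sign. *)
Lemma mean_value (g dg : R -> R) (s : R) :
  (forall t, `|t| <= `|s| -> is_derive t 1 g (dg t)) ->
  exists2 t, `|t| <= `|s| & g s - g 0 = dg t * s.
Proof.
move=> h; have [s0|s0] := leP 0 s.
  have h1 x : 0 <= x <= s -> is_derive x 1 g (dg x).
    by move=> /andP[x0 xs]; apply: h; rewrite !ger0_norm.
  have [x||t] := @MVT_segment _ g dg _ _ s0.
  - by rewrite in_itv /= => /andP[x0 xs]; apply: h1; rewrite !ltW.
  - apply: derivable_within_continuous => x; rewrite in_itv /= => /h1[] //.
  rewrite in_itv /= => /andP[t0 ts] e; exists t; first by rewrite !ger0_norm.
  by rewrite e subr0.
have h1 x : s <= x <= 0 -> is_derive x 1 g (dg x).
  by move=> /andP[xs x0]; apply: h; rewrite !ler0_norm ?lerN2 // ltW.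
have [x||t] := @MVT_segment _ g dg _ _ (ltW s0).
- by rewrite in_itv /= => /andP[x0 xs]; apply: h1; rewrite !ltW.
- apply: derivable_within_continuous => x; rewrite in_itv /= => /h1[] //.
rewrite in_itv /= => /andP[ts t0] e; exists t; first by rewrite !ler0_norm ?lerN2 // ltW.
by rewrite -opprB e sub0r mulrN opprK.
Qed.

(** Componentwise, to match [dirD], which is built from the real and the imaginary part. *)
Definition cderiv (phi : R -> C) (t : R) (d : C) :=
  is_derive t 1 (fun s => cRe (phi s)) (cRe d) /\
  is_derive t 1 (fun s => cIm (phi s)) (cIm d).

Implicit Types (phi psi : R -> C) (a b : C).

Lemma cderiv_eq phi t a b : cderiv phi t a -> a = b -> cderiv phi t b.
Proof. by move=> ? <-. Qed.

Lemma cderiv_uniq phi t a b : cderiv phi t a -> cderiv phi t b -> a = b.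
Proof.
by move=> [h1 h2] [h3 h4]; apply: ceqP; [exact: is_derive_uniq h1 h3|exact: is_derive_uniq h2 h4].
Qed.

Lemma cderiv_near phi psi t a : (\forall s \near t, phi s = psi s) ->
  cderiv phi t a -> cderiv psi t a.
Proof.
move=> e [h1 h2]; split.
  by apply: near_eq_is_derive h1; apply: filterS e => s ->.
by apply: near_eq_is_derive h2; apply: filterS e => s ->.
Qed.

Lemma cderiv_ext phi psi t a : (forall s, phi s = psi s) ->
  cderiv phi t a -> cderiv psi t a.
Proof. by move=> /funext ->. Qed.

Lemma cderiv_cst a t : cderiv (fun=> a) t 0.
Proof. by split; exact: is_derive_cst. Qed.

Lemma cderiv_ofR (f : R -> R) t d : is_derive t 1 f d -> cderiv (fun s => ofR (f s)) t (ofR d).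
Proof. by move=> h; split => //; exact: is_derive_cst. Qed.

Lemma cderiv_cRe phi t a : cderiv phi t a -> is_derive t 1 (fun s => cRe (phi s)) (cRe a).
Proof. by case. Qed.

Lemma cderiv_cIm phi t a : cderiv phi t a -> is_derive t 1 (fun s => cIm (phi s)) (cIm a).
Proof. by case. Qed.

Lemma cderivD phi psi t a b : cderiv phi t a -> cderiv psi t b ->
  cderiv (fun s => phi s + psi s) t (a + b).
Proof.
move=> [h1 h2] [h3 h4]; split; rewrite ?cReD ?cImD.
  by under eq_fun do rewrite cReD; exact: is_derive_add.
by under eq_fun do rewrite cImD; exact: is_derive_add.
Qed.

Lemma cderivN phi t a : cderiv phi t a -> cderiv (fun s => - phi s) t (- a).
Proof.
move=> [h1 h2]; split; rewrite ?cReN ?cImN.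
  by under eq_fun do rewrite cReN; exact: is_derive_opp.
by under eq_fun do rewrite cImN; exact: is_derive_opp.
Qed.

Lemma cderivB phi psi t a b : cderiv phi t a -> cderiv psi t b ->
  cderiv (fun s => phi s - psi s) t (a - b).
Proof. by move=> *; apply: cderivD => //; exact: cderivN. Qed.

Lemma cderivM phi psi t a b : cderiv phi t a -> cderiv psi t b ->
  cderiv (fun s => phi s * psi s) t (a * psi t + phi t * b).
Proof.
move=> [h1 h2] [h3 h4]; split; rewrite ?cReD ?cImD ?cReM ?cImM.
  under eq_fun do rewrite cReM.
  apply: is_derive_eq (is_derive_sub (is_derive_mul h1 h3) (is_derive_mul h2 h4)) _.
  by ring.
under eq_fun do rewrite cImM.
apply: is_derive_eq (is_derive_add (is_derive_mul h1 h4) (is_derive_mul h2 h3)) _.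
by ring.
Qed.

Lemma cderiv_conj phi t a : cderiv phi t a -> cderiv (fun s => (phi s)^*) t a^*.
Proof.
move=> [h1 h2]; split; rewrite ?cRe_conj ?cIm_conj.
  by under eq_fun do rewrite cRe_conj.
by under eq_fun do rewrite cIm_conj; exact: is_derive_opp.
Qed.

Lemma cinvE (w : C) : w^-1 = w^* * ofR (cRe w * cRe w + cIm w * cIm w)^-1.
Proof.
have [->|w0] := eqVneq w 0; first by rewrite invr0 rmorph0 mul0r.
have cw0 : w^* != 0 by rewrite fmorph_eq0.
rewrite ofRV; have -> : ofR (cRe w * cRe w + cIm w * cIm w) = w * w^* :> C.
  by rewrite -normCK cabsE -!expr2 -cabs_sq !expr2 ofRM.
by rewrite invfM mulrCA mulfV // mulr1.
Qed.

Lemma cderivV phi t a : phi t != 0 -> cderiv phi t a ->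
  cderiv (fun s => (phi s)^-1) t (- a / phi t ^+ 2).
Proof.
move=> p0 h; have [h1 h2] := h.
have n0 : cRe (phi t) * cRe (phi t) + cIm (phi t) * cIm (phi t) != 0.
  by rewrite -!expr2 -cabs_sq expf_neq0 // gt_eqF // cabs_gt0.
pose psi s := (phi s)^* * ofR (cRe (phi s) * cRe (phi s) + cIm (phi s) * cIm (phi s))^-1.
(* Formula [cinvE] gives differentiability with some value [b]; the value is then found by
   differentiating [phi s * (phi s)^-1 = 1]. *)
have [b hb] : exists b, cderiv psi t b.
  eexists; apply: cderivM; first exact: cderiv_conj h.
  apply: cderiv_ofR; exact: (is_derive_inv n0).
have hc : cderiv (fun s => (phi s)^-1) t b.
  by apply: cderiv_ext hb => s; rewrite /psi -cinvE.
apply: (cderiv_eq hc).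
have ct : {for t, continuous phi}.
  by apply: continuous_cplx; [exact: is_derive_continuous h1|exact: is_derive_continuous h2].
have ne : \forall s \near t, phi s != 0.
  apply: (ct [set w | w != 0]); apply/nbhs_cabs; exists (cabs (phi t)); first by rewrite cabs_gt0.
  by move=> w hw /=; apply: contraTneq hw => ->; rewrite sub0r cabsN -leNgt.
have one : cderiv (fun s => phi s * (phi s)^-1) t 0.
  by apply: cderiv_near (cderiv_cst 1 t); apply: filterS ne => s s0; rewrite divff.
have /eqP := cderiv_uniq (cderivM h hc) one.
rewrite addr_eq0 => /eqP e; apply: (mulfI p0).
by rewrite -[LHS]opprK -e; field.
Qed.

Lemma cderiv_sum n (phi : 'I_n -> R -> C) t (a : 'I_n -> C) :
  (forall i, cderiv (phi i) t (a i)) -> cderiv (fun s => \sum_i phi i s) t (\sum_i a i).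
Proof.
elim: n phi a => [|n IH] phi a h.
  rewrite big_ord0; under eq_fun do rewrite big_ord0; exact: cderiv_cst.
rewrite big_ord_recr; under eq_fun do rewrite big_ord_recr.
by apply: cderivD => //; apply: IH => i.
Qed.

Lemma cderiv_comp (phi : R -> C) (g : R -> R) t a (b : R) :
  cderiv phi (g t) a -> is_derive t 1 g b -> cderiv (fun s => phi (g s)) t (a * ofR b).
Proof.
move=> [h1 h2] h; split.
  apply: is_derive_eq; first exact: (@is_derive1_comp _ (fun s => cRe (phi s)) g).
  by rewrite cReM cRe_ofR cIm_ofR mulr0 subr0.
apply: is_derive_eq; first exact: (@is_derive1_comp _ (fun s => cIm (phi s)) g).
by rewrite cImM cRe_ofR cIm_ofR mulr0 add0r.
Qed.

End Cderiv.

(** * Continuously differentiable functions on C^2 *)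

Section Directional.
Variable R : realType.
Local Notation C := (Cplx R).
Local Notation C2 := (C2 R).
Implicit Types (f g : C2 -> C) (V : set C2) (z v : C2) (i j k : 'I_2) (t : R).

Definition line z v (t : R) : C2 := z + ofR t *: v.

Lemma line0 z v : line z v 0 = z.
Proof. by rewrite /line ofR0 scale0r addr0. Qed.

Lemma lineE z v t k : line z v t 0 k = z 0 k + ofR t * v 0 k.
Proof. by rewrite /line !mxE. Qed.

Lemma line_line z v s t : line (line z v s) v t = line z v (s + t).
Proof. by rewrite /line -addrA -scalerDl ofRD. Qed.

(** A relation carries existence and value of the derivative together, whereas [dirD] is a total
    function with a default value. *)
Definition has_dir f v z d := cderiv (fun t => f (line z v t)) 0 d.

Lemma dir_derivableP f v z : dir_derivable f v z -> has_dir f v z (dirD f v z).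
Proof.
case=> h1 h2; split.
  have := derivableP h1; rewrite -derive1E; exact.
have := derivableP h2; rewrite -derive1E; exact.
Qed.

Lemma has_dir_derivable f v z d : has_dir f v z d -> dir_derivable f v z.
Proof. by move=> [h1 h2]; split; [exact: (@ex_derive _ _ _ _ _ _ _ h1)|exact: (@ex_derive _ _ _ _ _ _ _ h2)]. Qed.

Lemma has_dirE f v z d : has_dir f v z d -> dirD f v z = d.
Proof.
by move=> h; apply: cderiv_uniq (dir_derivableP (has_dir_derivable h)) h.
Qed.

Lemma continuous_line z v : continuous (line z v).
Proof.
move=> t; apply: continuous_C2 => k.
apply: (@continuous_ext _ _ (fun t => z 0 k + ofR t * v 0 k)) => [s|]; first by rewrite lineE.
apply: (@cvgD _ _ _ _ _ (cst (z 0 k)) (fun t => ofR t * v 0 k)); first exact: cvg_cst.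
apply: (@cvgM _ _ _ _ (fun t => ofR t : C) (cst (v 0 k))); last exact: cvg_cst.
exact: continuous_ofR.
Qed.

Lemma near_line z v (A : set C2) : (\forall w \near z, A w) -> \forall t \near (0:R), A (line z v t).
Proof.
move=> h; have := @continuous_line z v 0; rewrite /continuous_at line0; exact.
Qed.

Lemma has_dir_near f g v z d : (\forall w \near z, f w = g w) -> has_dir f v z d -> has_dir g v z d.
Proof. by move=> e; apply: cderiv_near; exact: (near_line v e). Qed.

Lemma has_dir_line f v z t d : has_dir f v (line z v t) d ->
  cderiv (fun s => f (line z v s)) t d.
Proof.
move=> h; have h1 : is_derive t (1:R) (fun s => s - t) 1.
  by apply: is_derive_eq (is_derive_sub _ _) _; rewrite ?subr0.
have h2 : cderiv (fun s => f (line (line z v t) v s)) (t - t) d by rewrite subrr.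
have := @cderiv_comp R _ (fun s => s - t) t d 1 h2 h1; rewrite ofR1 mulr1; apply: cderiv_ext => s.
by rewrite line_line addrCA subrr addr0.
Qed.

Definition axis v := exists i, v = dx R i \/ v = dy R i.

Lemma axis_dx i : axis (dx R i). Proof. by exists i; left. Qed.
Lemma axis_dy i : axis (dy R i). Proof. by exists i; right. Qed.

Lemma dxE i k : dx R i 0 k = (k == i)%:R. Proof. by rewrite /dx mxE eqxx. Qed.
Lemma dyE i k : dy R i 0 k = 'i * (k == i)%:R. Proof. by rewrite /dy !mxE eqxx. Qed.

Lemma cabs_axis v k : axis v -> cabs (v 0 k) <= 1.
Proof.
move=> [i [->|->]]; rewrite ?dxE ?dyE ?cabsM ?cabs_i ?mul1r; case: eqP => _ //=;
  by rewrite ?cabs0 ?ler01 // -ofR1 cabs_ofR normr1.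
Qed.

(** Existence of the axis derivatives at one point suffices for the algebraic rules of [dz] and
    [dzb]; the chain rule uses [C1]. *)
Definition pd f z := forall v, axis v -> has_dir f v z (dirD f v z).

Definition C1 V f := (forall z, V z -> {for z, continuous f}) /\
  forall v, axis v -> (forall z, V z -> has_dir f v z (dirD f v z)) /\
                      (forall z, V z -> {for z, continuous (dirD f v)}).

Lemma C1P V f : C1 V f <-> Cn 1 V f.
Proof.
split; last first.
  case=> h1 h2; split; first exact: h1.
  move=> v [i hv]; have [h3 [h4 _]] := h2 i v hv; split; last exact: h4.
  by move=> z Vz; apply: dir_derivableP; apply: h3.
case=> h1 h2; split; first exact: h1.
move=> i v hv; have [h3 h4] := h2 v (ex_intro _ i hv).
split; last by split; first exact: h4.
by move=> z Vz; apply: (@has_dir_derivable _ _ _ (dirD f v z)); apply: h3.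
Qed.

(** As [V] is open, the candidate [d] agrees with [dirD] near each point, which therefore inherits
    its continuity. *)
Lemma C1_intro V f (d : C2 -> C2 -> C) : open V ->
  (forall z, V z -> {for z, continuous f}) ->
  (forall v, axis v -> forall z, V z -> has_dir f v z (d v z)) ->
  (forall v, axis v -> forall z, V z -> {for z, continuous (d v)}) -> C1 V f.
Proof.
move=> oV h1 h2 h3; split; first exact: h1.
move=> v hv; split=> z Vz.
  have h := h2 v hv z Vz; rewrite (has_dirE h); exact: h.
apply: near_continuous (h3 v hv z Vz).
have : \forall y \near z, V y by exact: open_nbhs_nbhs.
by apply: filterS => y Vy; rewrite (has_dirE (h2 v hv y Vy)).
Qed.

Lemma C1_pd V f z : C1 V f -> V z -> pd f z.
Proof. by move=> [_ h] Vz v hv; apply: (h v hv).1. Qed.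

Lemma C1_cont V f z : C1 V f -> V z -> {for z, continuous f}.
Proof. by move=> [h _]; exact: h. Qed.

Lemma has_dirD f g v z a b : has_dir f v z a -> has_dir g v z b ->
  has_dir (fun w => f w + g w) v z (a + b).
Proof. exact: cderivD. Qed.
Lemma has_dirN f v z a : has_dir f v z a -> has_dir (fun w => - f w) v z (- a).
Proof. exact: cderivN. Qed.
Lemma has_dirM f g v z a b : has_dir f v z a -> has_dir g v z b ->
  has_dir (fun w => f w * g w) v z (a * g z + f z * b).
Proof. by move=> h1 h2; have := cderivM h1 h2; rewrite !line0. Qed.
Lemma has_dirV f v z a : f z != 0 -> has_dir f v z a ->
  has_dir (fun w => (f w)^-1) v z (- a / f z ^+ 2).
Proof. by move=> f0 h; rewrite -{2}(line0 z v); apply: cderivV => //; rewrite line0. Qed.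
Lemma has_dir_conj f v z a : has_dir f v z a -> has_dir (fun w => (f w)^*) v z a^*.
Proof. exact: cderiv_conj. Qed.
Lemma has_dir_cst a v z : has_dir (fun=> a) v z 0.
Proof. exact: cderiv_cst. Qed.
Lemma has_dir_coord k v z : has_dir (fun w => w 0 k) v z (v 0 k).
Proof.
apply: (@cderiv_ext _ (fun t => z 0 k + ofR t * v 0 k)) => [t|]; first by rewrite lineE.
apply: cderiv_eq.
  apply: cderivD (cderiv_cst _ _) (cderivM (cderiv_ofR (is_derive_id _ _)) (cderiv_cst _ _)).
by rewrite add0r mulr0 addr0 ofR1 mul1r.
Qed.
Lemma has_dir_sum n (f : 'I_n -> C2 -> C) v z (a : 'I_n -> C) :
  (forall i : 'I_n, has_dir (f i) v z (a i)) -> has_dir (fun w => \sum_i f i w) v z (\sum_i a i).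
Proof. exact: cderiv_sum. Qed.

Lemma C1_cst V (a : C) : open V -> C1 V (fun=> a).
Proof.
move=> oV; apply: (@C1_intro _ _ (fun _ _ => 0) oV) => [z _|v _ z _|v _ z _].
- exact: continuous_at_cst.
- exact: has_dir_cst.
- exact: continuous_at_cst.
Qed.

Lemma C1D V f g : open V -> C1 V f -> C1 V g -> C1 V (fun z => f z + g z).
Proof.
move=> oV [f1 f2] [g1 g2]; apply: (@C1_intro _ _ (fun v z => dirD f v z + dirD g v z) oV).
- by move=> z Vz; apply: continuous_cD; [exact: f1|exact: g1].
- by move=> v hv z Vz; apply: has_dirD; [apply: (f2 v hv).1|apply: (g2 v hv).1].
- by move=> v hv z Vz; apply: continuous_cD; [apply: (f2 v hv).2|apply: (g2 v hv).2].
Qed.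

Lemma C1N V f : open V -> C1 V f -> C1 V (fun z => - f z).
Proof.
move=> oV [f1 f2]; apply: (@C1_intro _ _ (fun v z => - dirD f v z) oV).
- by move=> z Vz; apply: continuous_cN; exact: f1.
- by move=> v hv z Vz; apply: has_dirN; apply: (f2 v hv).1.
- by move=> v hv z Vz; apply: continuous_cN; apply: (f2 v hv).2.
Qed.

Lemma C1M V f g : open V -> C1 V f -> C1 V g -> C1 V (fun z => f z * g z).
Proof.
move=> oV [f1 f2] [g1 g2].
apply: (@C1_intro _ _ (fun v z => dirD f v z * g z + f z * dirD g v z) oV).
- by move=> z Vz; apply: continuous_cM; [exact: f1|exact: g1].
- by move=> v hv z Vz; apply: has_dirM; [apply: (f2 v hv).1|apply: (g2 v hv).1].
- move=> v hv z Vz; apply: continuous_cD; apply: continuous_cM.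
  + by apply: (f2 v hv).2.
  + exact: g1.
  + exact: f1.
  + by apply: (g2 v hv).2.
Qed.

Lemma C1V V f : open V -> C1 V f -> (forall z, V z -> f z != 0) -> C1 V (fun z => (f z)^-1).
Proof.
move=> oV [f1 f2] f0.
apply: (@C1_intro _ _ (fun v z => - dirD f v z * ((f z)^-1 * (f z)^-1)) oV).
- by move=> z Vz; apply: continuous_cV; [exact: f0|exact: f1].
- move=> v hv z Vz; rewrite -invfM -expr2.
  by apply: has_dirV; [exact: f0|apply: (f2 v hv).1].
- move=> v hv z Vz; apply: continuous_cM.
    by apply: continuous_cN; apply: (f2 v hv).2.
  by apply: continuous_cM; apply: continuous_cV; rewrite ?f0 //; exact: f1.
Qed.

Lemma C1_sum V n (f : 'I_n -> C2 -> C) : open V -> (forall i : 'I_n, C1 V (f i)) ->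
  C1 V (fun z => \sum_i f i z).
Proof.
move=> oV; elim: n f => [|n IH] f h.
  by under eq_fun do rewrite big_ord0; exact: C1_cst.
under eq_fun do rewrite big_ord_recr.
by apply: (C1D oV); [apply: IH => i; exact: h|exact: h].
Qed.

Lemma C1_eq V f g : open V -> (forall z, V z -> f z = g z) -> C1 V f -> C1 V g.
Proof.
move=> oV e [f1 f2].
have ne z : V z -> \forall w \near z, f w = g w.
  move=> Vz; have : \forall y \near z, V y by exact: open_nbhs_nbhs.
  by apply: filterS.
apply: (@C1_intro _ _ (fun v z => dirD f v z) oV) => [z Vz|v hv z Vz|v hv z Vz].
- exact: near_continuous (ne z Vz) (f1 z Vz).
- by apply: has_dir_near (ne z Vz) _; apply: (f2 v hv).1.
- by apply: (f2 v hv).2.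
Qed.

End Directional.

(* Unification otherwise unfolds derivatives of distinct functions in order to
   compare them, which does not terminate in practice. *)
#[local] Opaque ofR cRe cIm.

(** * The chain rule for C^1 functions along real curves *)

Section Chain.
Variable R : realType.
Local Notation C := (Cplx R).
Local Notation C2 := (C2 R).
Implicit Types (f g : C2 -> C) (V : set C2) (z v : C2) (i j k : 'I_2) (t : R).

(* By the mean value theorem the increment is [s] times a function that is
   continuous at [t0]; [eta] need not be differentiable. *)
Lemma is_derive_increment (F D : C2 -> R) V v z0 (eta : R -> C2) (s : R -> R) t0 ds :
  open V -> V z0 -> (forall k, cabs (v 0 k) <= 1) ->
  (forall z t, V (line z v t) -> is_derive t 1 (fun t => F (line z v t)) (D (line z v t))) ->
  {for z0, continuous D} -> {for t0, continuous eta} -> eta t0 = z0 ->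
  is_derive t0 1 s ds -> s t0 = 0 ->
  is_derive t0 1 (fun t => F (line (eta t) v (s t)) - F (eta t)) (D z0 * ds).
Proof.
move=> oV Vz0 v1 hF cD ceta eta0 [hs es] s0.
pose G t := F (line (eta t) v (s t)) - F (eta t).
(* The default [D z0] is the value that makes [A] continuous at [t0]; elsewhere the mean value
   theorem shows that [A t] is a value of [D] near [z0]. *)
pose A t := if s t == 0 then D z0 else G t / s t.
have GE t : G t = A t * s t.
  rewrite /A; case: eqP => [e|/eqP e]; last by rewrite divfK.
  by rewrite /G e line0 subrr mulr0.
have At0 : A t0 = D z0 by rewrite /A s0 eqxx.
have cs : {for t0, continuous s} by exact: is_derive_continuous (DeriveDef hs es).
have cA : {for t0, continuous A}.
  move=> B; rewrite At0 => hB.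
  have : \forall z \near z0, V z /\ B (D z).
    by apply: filterI; [exact: open_nbhs_nbhs|exact: cD].
  move=> /nbhs_C2[r r0 hr].
  have r2 : 0 < r / 2 by rewrite divr_gt0.
  have n1 : \forall t \near t0, forall k, cabs (eta t 0 k - z0 0 k) < r / 2.
    by rewrite -eta0; apply: (ceta [set w : C2 | forall k, cabs (w 0 k - eta t0 0 k) < r / 2]);
      apply/nbhs_C2; exists (r / 2).
  have n2 : \forall t \near t0, `|s t| < r / 2.
    apply: (cs [set x | `|x| < r / 2]); rewrite s0; apply/nbhs_ballP; exists (r / 2) => // x.
    by rewrite /ball /= sub0r normrN.
  suff : \forall t \near t0, B (A t) by [].
  apply: filterS (filterI n1 n2) => t [h1 h2].
  have near_z0 x : `|x| <= `|s t| -> V (line (eta t) v x) /\ B (D (line (eta t) v x)).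
    move=> hx; apply: hr => k; rewrite lineE addrAC (splitr r).
    apply: le_lt_trans (cabsD _ _) _; apply: ltr_leD => //.
    rewrite cabsM cabs_ofR; apply: le_trans (ltW h2).
    by rewrite -[leRHS]mulr1 ler_pM ?cabs_ge0.
  rewrite /A; case: eqP => [_|/eqP st0]; first exact: nbhs_singleton hB.
  have [x hx e] := @mean_value _ (fun x => F (line (eta t) v x)) (fun x => D (line (eta t) v x)) (s t)
    (fun x hx => hF _ _ (near_z0 x hx).1).
  by rewrite /G -[X in _ - F X](line0 _ v) e mulfK //; exact: (near_z0 x hx).2.
have -> : (fun t => F (line (eta t) v (s t)) - F (eta t)) = (fun t => A t * s t).
  by apply/funext => t; exact: GE.
have key : h^-1 *: (((fun t => A t * s t) \o shift t0) (h *: (1 : R)) - A t0 * s t0) @[h --> 0^'] --> D z0 * ds.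
  have -> : (fun h : R => h^-1 *: (((fun t => A t * s t) \o shift t0) (h *: (1 : R)) - A t0 * s t0)) =
            (fun h => A (h + t0) * (h^-1 *: ((s \o shift t0) (h *: (1 : R)) - s t0))).
    apply/funext => h; rewrite /= /GRing.scale /= s0 mulr0 !subr0 mulr1; ring.
  apply: cvgM; last by rewrite -es; exact: hs.
  rewrite -At0; apply: (@cvg_comp _ _ _ (fun h : R => h + t0) A _ (nbhs t0)); last exact: cA.
  have : h + t0 @[h --> (0:R)] --> t0.
    rewrite -{2}(add0r t0); apply: cvgD; [exact: cvg_id|exact: cvg_cst].
  by apply: cvg_trans; apply: cvg_app; exact: cvg_within.
split; first by apply/cvg_ex; exists (D z0 * ds).
exact: cvg_lim.
Unshelve. all: by end_near. Qed.

(** Only derivatives along the four real axes are available, so a displacement is split into four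
    axis-parallel steps. *)
Lemma line_decomp (z w : C2) :
  line (line (line (line z (dx R 0) (cRe (w 0 0 - z 0 0))) (dy R 0) (cIm (w 0 0 - z 0 0)))
    (dx R 1) (cRe (w 0 1 - z 0 1))) (dy R 1) (cIm (w 0 1 - z 0 1)) = w.
Proof.
apply/rowP => k; rewrite !lineE !dxE !dyE.
have [->|->] := ord2 k; rewrite ?eqxx /=.
  rewrite !mulr0 !addr0 !mulr1 -addrA [ofR _ * 'i]mulrC -cE; ring.
rewrite !mulr0 !addr0 !mulr1 -addrA [ofR _ * 'i]mulrC -cE; ring.
Qed.

(** The real differential of [f] at [z] applied to [v], in Wirtinger form. *)
Definition grad f z v := \sum_k (dz k f z * v 0 k + dzb k f z * (v 0 k)^*).

Lemma gradE f z v : grad f z v =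
  \sum_k (dirD f (dx R k) z * ofR (cRe (v 0 k)) + dirD f (dy R k) z * ofR (cIm (v 0 k))).
Proof.
apply: eq_bigr => k _; rewrite /dz /dzb.
set X := dirD _ _ _; set Y := dirD _ _ _; set p := ofR (cRe _); set q := ofR (cIm _).
have -> : v 0 k = p + 'i * q by rewrite -cE.
rewrite cconjD cconjM conji !conj_ofR.
transitivity (X * p - ('i * 'i) * Y * q); first by field.
by rewrite ii; ring.
Qed.

(** The increment of [F] along the curve telescopes over the four steps of [line_decomp]. The base
    point of each step moves with [t], which is why [is_derive_increment] allows a base point that
    is merely continuous. *)
Lemma is_derive_chain (F : C2 -> R) (D : C2 -> C2 -> R) V (gam : R -> C2) t0 (gam' : C2) :
  open V -> V (gam t0) ->
  (forall v, axis v -> forall z t, V (line z v t) ->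
     is_derive t 1 (fun t => F (line z v t)) (D v (line z v t))) ->
  (forall v, axis v -> {for gam t0, continuous (D v)}) ->
  (forall k, cderiv (fun t => gam t 0 k) t0 (gam' 0 k)) ->
  is_derive t0 1 (fun t => F (gam t))
    (\sum_k (D (dx R k) (gam t0) * cRe (gam' 0 k) + D (dy R k) (gam t0) * cIm (gam' 0 k))).
Proof.
move=> oV V0 hD cD hg; set z0 := gam t0.
pose p k t := cRe (gam t 0 k - z0 0 k); pose q k t := cIm (gam t 0 k - z0 0 k).
have hgk k : cderiv (fun t => gam t 0 k - z0 0 k) t0 (gam' 0 k).
  by apply: cderiv_eq (cderivB (hg k) (cderiv_cst _ _)) _; rewrite subr0.
have hp k : is_derive t0 1 (p k) (cRe (gam' 0 k)) by exact: (hgk k).1.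
have hq k : is_derive t0 1 (q k) (cIm (gam' 0 k)) by exact: (hgk k).2.
have p0 k : p k t0 = 0 by rewrite /p subrr.
have q0 k : q k t0 = 0 by rewrite /q subrr.
pose e1 t := line z0 (dx R 0) (p 0 t).
pose e2 t := line (e1 t) (dy R 0) (q 0 t).
pose e3 t := line (e2 t) (dx R 1) (p 1 t).
pose e4 t := line (e3 t) (dy R 1) (q 1 t).
have e4E : e4 = gam by apply/funext => t; exact: line_decomp.
have cl (e : R -> C2) v (s : R -> R) : {for t0, continuous e} -> {for t0, continuous s} ->
    {for t0, continuous (fun t => line (e t) v (s t))}.
  move=> ce cs; apply: continuous_C2 => k.
  apply: (@continuous_ext _ _ (fun t => e t 0 k + ofR (s t) * v 0 k)) => [t|]; first by rewrite lineE.
  apply: continuous_cD.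
    by apply: (@continuous_comp _ _ _ e (fun w : C2 => w 0 k)); [exact: ce|exact: continuous_coord].
  apply: continuous_cM; last exact: continuous_at_cst.
  by apply: (@continuous_comp _ _ _ s (fun w : R => ofR w : C)); [exact: cs|exact: continuous_ofR].
have cp k := is_derive_continuous (hp k); have cq k := is_derive_continuous (hq k).
have c1 : {for t0, continuous e1} by apply: cl; [exact: continuous_at_cst|exact: cp].
have c2 : {for t0, continuous e2} by apply: cl; [exact: c1|exact: cq].
have c3 : {for t0, continuous e3} by apply: cl; [exact: c2|exact: cp].
have e10 : e1 t0 = z0 by rewrite /e1 p0 line0.
have e20 : e2 t0 = z0 by rewrite /e2 q0 line0.
have e30 : e3 t0 = z0 by rewrite /e3 p0 line0.
have inc v e s ds : axis v -> {for t0, continuous e} -> e t0 = z0 -> is_derive t0 1 s ds -> s t0 = 0 ->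
    is_derive t0 1 (fun t => F (line (e t) v (s t)) - F (e t)) (D v z0 * ds).
  move=> av ce ez hs s0; apply: (@is_derive_increment _ _ V) => //; last exact: cD.
  - by move=> k; exact: cabs_axis.
  - by move=> z t; exact: hD.
have tele (a b c d e : R) : e = a + ((b - a) + (c - b) + (d - c) + (e - d)) by ring.
have -> : (fun t => F (gam t)) =
  (fun t => F z0 + ((F (e1 t) - F z0) + (F (e2 t) - F (e1 t)) + (F (e3 t) - F (e2 t)) + (F (e4 t) - F (e3 t)))).
  by apply/funext => t; rewrite e4E; exact: tele.
have cz0 : {for t0, continuous (cst z0 : R -> C2)} by exact: continuous_at_cst.
have i1 := inc (dx R 0) (cst z0) (p 0) _ (axis_dx _ 0) cz0 erefl (hp 0) (p0 0).
have i2 := inc (dy R 0) e1 (q 0) _ (axis_dy _ 0) c1 e10 (hq 0) (q0 0).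
have i3 := inc (dx R 1) e2 (p 1) _ (axis_dx _ 1) c2 e20 (hp 1) (p0 1).
have i4 := inc (dy R 1) e3 (q 1) _ (axis_dy _ 1) c3 e30 (hq 1) (q0 1).
have i0 : is_derive t0 (1 : R) (fun=> F z0) 0 by exact: is_derive_cst.
have := is_derive_add i0 (is_derive_add (is_derive_add (is_derive_add i1 i2) i3) i4).
move/is_derive_eq; apply.
by rewrite !big_ord_recl big_ord0 /= (_ : lift ord0 ord0 = 1) ?add0r ?addr0 ?addrA //; exact/val_inj.
Qed.

Lemma cRe_sum_ofR n (F G : 'I_n -> C) (p q : 'I_n -> R) :
  cRe (\sum_k (F k * ofR (p k) + G k * ofR (q k))) = \sum_k (cRe (F k) * p k + cRe (G k) * q k).
Proof.
rewrite cRe_sum; apply: eq_bigr => k _.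
by rewrite cReD !cReM !cRe_ofR !cIm_ofR !mulr0 !subr0.
Qed.

Lemma cIm_sum_ofR n (F G : 'I_n -> C) (p q : 'I_n -> R) :
  cIm (\sum_k (F k * ofR (p k) + G k * ofR (q k))) = \sum_k (cIm (F k) * p k + cIm (G k) * q k).
Proof.
rewrite cIm_sum; apply: eq_bigr => k _.
by rewrite cImD !cImM !cRe_ofR !cIm_ofR !mulr0 !add0r.
Qed.

Lemma chain_rule f V (gam : R -> C2) t0 (gam' : C2) : open V -> C1 V f -> V (gam t0) ->
  (forall k, cderiv (fun t => gam t 0 k) t0 (gam' 0 k)) ->
  cderiv (fun t => f (gam t)) t0 (grad f (gam t0) gam').
Proof.
move=> oV [f1 f2] V0 hg; rewrite gradE.
have hl v : axis v -> forall z t, V (line z v t) ->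
    cderiv (fun t => f (line z v t)) t (dirD f v (line z v t)).
  by move=> av z t Vz; apply: has_dir_line; apply: (f2 v av).1.
split.
  have h := @is_derive_chain (fun z => cRe (f z)) (fun v z => cRe (dirD f v z)) V gam t0 gam'
    oV V0 (fun v av z t Vz => (hl v av z t Vz).1) (fun v av => @continuous_cRe_comp _ _ (dirD f v) (gam t0) ((f2 v av).2 _ V0)) hg.
  by rewrite (cRe_sum_ofR (fun k => dirD f (dx R k) (gam t0)) (fun k => dirD f (dy R k) (gam t0))).
have h := @is_derive_chain (fun z => cIm (f z)) (fun v z => cIm (dirD f v z)) V gam t0 gam'
  oV V0 (fun v av z t Vz => (hl v av z t Vz).2) (fun v av => @continuous_cIm_comp _ _ (dirD f v) (gam t0) ((f2 v av).2 _ V0)) hg.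
by rewrite (cIm_sum_ofR (fun k => dirD f (dx R k) (gam t0)) (fun k => dirD f (dy R k) (gam t0))).
Qed.

End Chain.

(** * Green's theorem *)

Section Green.
Variable R : realType.

Lemma uniform_on_square (F : R -> R -> R) (N e : R) : 0 < e ->
  (forall x y, {for (x, y), continuous (fun p : R * R => F p.1 p.2)}) ->
  exists2 d : R, 0 < d & forall x y x' y', `|x| <= N -> `|y| <= N ->
    `|x' - x| < d -> `|y' - y| < d -> `|F x' y' - F x y| < e.
Proof.
move=> e0 cF.
have cpt : compact (`[-N, N]%classic `*` `[-N, N]%classic : set (R * R)).
  by apply: compact_setX; exact: segment_compact.
move/compact_near_coveringP: cpt => cov.
pose P (d : R) (p : R * R) := forall x' y', `|x' - p.1| < d -> `|y' - p.2| < d ->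
  `|F x' y' - F p.1 p.2| < e.
have : \forall d \near (0:R)^'+, forall p, (`[-N, N]%classic `*` `[-N, N]%classic) p -> P d p.
  apply: cov => -[x y] _.
  have e2 : 0 < e / 2 by rewrite divr_gt0.
  have /cvgrPdist_lt/(_ _ e2) := cF x y.
  move=> /nbhs_ballP[r /= r0 hr].
  have r2 : 0 < r / 2 by rewrite divr_gt0.
  exists (ball ((x, y) : R * R) (r / 2), [set d | d < r / 2]).
    split; first by exact: nbhsx_ballx.
    by exists (r / 2) => // d /=; rewrite sub0r normrN => h h0; rewrite (le_lt_trans (ler_norm _) h).
  move=> [[x1 y1] d] /= [[h1 h2] hd] x' y' hx hy.
  have a1 : `|F x y - F x1 y1| < e / 2.
    apply: (hr (x1, y1)); split; rewrite /ball /= in h1 h2 *.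
      by apply: lt_le_trans h1 _; rewrite ler_pdivrMr // ler_peMr ?ler1n // ltW.
    by apply: lt_le_trans h2 _; rewrite ler_pdivrMr // ler_peMr ?ler1n // ltW.
  have a2 : `|F x y - F x' y'| < e / 2.
    apply: (hr (x', y')); split; rewrite /ball /= in h1 h2 hx hy *.
      by rewrite -(subrKA x1) (splitr r) (le_lt_trans (ler_normD _ _)) // ltrD // distrC (lt_trans hx).
    by rewrite -(subrKA y1) (splitr r) (le_lt_trans (ler_normD _ _)) // ltrD // distrC (lt_trans hy).
  rewrite -(subrKA (F x y)) (splitr e) (le_lt_trans (ler_normD _ _)) // ltrD // distrC //.
move=> [d /= d0 hd]; exists (d / 2); first by rewrite divr_gt0.
move=> x y x' y' hx hy; apply: (hd (d / 2) _ _ (x, y)) => /=.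
- by rewrite sub0r normrN ger0_norm ?ltW ?divr_gt0 // ltr_pdivrMr // ltr_pMr // ltr1n.
- by rewrite divr_gt0.
- by rewrite !in_itv /= -!ler_norml.
Qed.

(* Green's theorem on a square, without integrals: on a fine grid the increments
   of P and Q over the cells telescope to the boundary terms, which are then
   averaged over the grid. *)
Lemma green_square (P Q Px Qy : R -> R -> R) (N c e : R) : 0 < N -> 0 < e ->
  (forall x y, is_derive x (1 : R) (P^~ y) (Px x y)) ->
  (forall x y, is_derive y (1 : R) (Q x) (Qy x y)) ->
  (forall x y, {for (x, y), continuous (fun p : R * R => Px p.1 p.2)}) ->
  (forall x y, {for (x, y), continuous (fun p : R * R => Qy p.1 p.2)}) ->
  (forall x y, `|x| <= N -> `|y| <= N -> c <= Px x y + Qy x y) ->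
  exists x y, [/\ `|x| <= N, `|y| <= N &
    (c - e) * (2 * N) <= P N y - P (- N) y + (Q x N - Q x (- N))].
Proof.
move=> N0 e0 dP dQ cPx cQy hc.
have e2 : 0 < e / 2 by rewrite divr_gt0.
have [d1 d10 h1] := uniform_on_square N e2 cPx.
have [d2 d20 h2] := uniform_on_square N e2 cQy.
pose d3 := Num.min d1 d2.
have d30 : 0 < d3 by rewrite lt_min d10.
(* This many subdivisions make the mesh smaller than [d3]; the successor keeps the grid nonempty, as
   the strict inequality between sums requires. *)
have [m hm] : exists m, 2 * N / d3 < m.+1%:R.
  exists (Num.bound (2 * N / d3)).
  apply: lt_trans (archi_boundP _) _; last by rewrite ltr_nat.
  by rewrite divr_ge0 // ?mulr_ge0 // ltW.
set n := m.+1 in hm.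
have n0 : 0 < n%:R :> R by rewrite ltr0n.
pose d := 2 * N / n%:R.
have d0 : 0 < d by rewrite divr_gt0 // mulr_gt0.
have dd3 : d < d3 by move: hm; rewrite /d !ltr_pdivrMr // [d3 * _]mulrC.
pose x i : R := - N + i%:R * d.
have xS i : x i.+1 = x i + d by rewrite /x -addn1 natrD mulrDl mul1r addrA.
have xN i : (i <= n)%N -> `|x i| <= N.
  move=> hi; rewrite ler_norml; have i0 : 0 <= i%:R * d by rewrite mulr_ge0 // ltW.
  have : i%:R * d <= 2 * N.
    by rewrite /d mulrCA ger_pMr ?mulr_gt0 // ler_pdivrMr // mul1r ler_nat.
  by rewrite /x; move: i0; set t := i%:R * d => ? ?; apply/andP; split; lra.
have x0 : x 0%N = - N by rewrite /x mul0r addr0.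
have xn : x n = N by rewrite /x /d mulrCA divff ?mulr1 ?gt_eqF //; ring.
(* One lower and one left edge represent the cell: both increments start at the corner [(x i, x j)],
   where the bound on the divergence is applied. *)
pose cell i j := P (x i.+1) (x j) - P (x i) (x j) + (Q (x i) (x j.+1) - Q (x i) (x j)).
have hcell i j : (i < n)%N -> (j < n)%N -> (c - e) * d <= cell i j.
  move=> hi hj.
  have mt1 t : is_derive t (1:R) (fun t => P (x i + t) (x j)) ((fun t => Px (x i + t) (x j)) t).
    have hh : is_derive t (1:R) (fun t => x i + t) 1.
      by apply: is_derive_eq (is_derive_add (is_derive_cst _ _ _) (is_derive_id _ _)) _; rewrite add0r.
    rewrite -[X in is_derive _ _ _ X]mulr1.
    exact: (@is_derive1_comp _ (fun s => P s (x j)) (fun t => x i + t)).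
  have [t1 ht1 e1] := @mean_value R _ (fun t => Px (x i + t) (x j)) d (fun t _ => mt1 t).
  have mt2 t : is_derive t (1:R) (fun t => Q (x i) (x j + t)) ((fun t => Qy (x i) (x j + t)) t).
    have hh : is_derive t (1:R) (fun t => x j + t) 1.
      by apply: is_derive_eq (is_derive_add (is_derive_cst _ _ _) (is_derive_id _ _)) _; rewrite add0r.
    rewrite -[X in is_derive _ _ _ X]mulr1.
    exact: (@is_derive1_comp _ (Q (x i)) (fun t => x j + t)).
  have [t2 ht2 e2'] := @mean_value R _ (fun t => Qy (x i) (x j + t)) d (fun t _ => mt2 t).
  rewrite /cell !xS; rewrite addr0 in e1; rewrite addr0 in e2'.
  rewrite e1 e2' -mulrDl ler_pM2r //.
  have xi := xN i (ltnW hi); have xj := xN j (ltnW hj).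
  have := hc _ _ xi xj.
  rewrite (gtr0_norm d0) in ht1 ht2.
  have := h1 (x i) (x j) (x i + t1) (x j) xi xj.
  rewrite addrAC subrr add0r subrr normr0 => /(_ (le_lt_trans ht1 _) d10).
  have dd1 : d < d1 by apply: lt_le_trans dd3 _; rewrite ge_min lexx.
  have dd2 : d < d2 by apply: lt_le_trans dd3 _; rewrite ge_min lexx orbT.
  move=> /(_ dd1); have := h2 (x i) (x j) (x i) (x j + t2) xi xj.
  rewrite [x j + t2 - _]addrAC !subrr add0r normr0 => /(_ d20 (le_lt_trans ht2 dd2)).
  rewrite !ltr_norml => /andP[? _] /andP[? _]; lra.
apply: contrapT => hno.
have hlt i j : (i < n)%N -> (j < n)%N ->
    P N (x j) - P (- N) (x j) + (Q (x i) N - Q (x i) (- N)) < (c - e) * (2 * N).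
  move=> hi hj; rewrite ltNge; apply/negP => h; apply: hno; exists (x i), (x j).
  by split=> //; apply: xN; exact: ltnW.
have tel (F : R -> R) : \sum_(i < n) (F (x i.+1) - F (x i)) = F N - F (- N).
  rewrite -[in F N]xn -x0 -(telescope_sumr (fun i => F (x i))) // big_mkord; exact: eq_bigr.
have S1 : \sum_(i < n) \sum_(j < n) cell i j =
    \sum_(j < n) (P N (x j) - P (- N) (x j)) + \sum_(i < n) (Q (x i) N - Q (x i) (- N)).
  under eq_bigr do rewrite big_split.
  rewrite big_split /=; congr (_ + _).
    by rewrite exchange_big /=; apply: eq_bigr => j _; exact: (tel (P^~ (x j))).
  by apply: eq_bigr => i _; exact: (tel (Q (x i))).
(* After telescoping, the [P] terms depend on [j] alone and the [Q] terms on [i] alone, so each of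
   them is counted [n] times here. *)
have S2 : \sum_(i < n) \sum_(j < n) (P N (x j) - P (- N) (x j) + (Q (x i) N - Q (x i) (- N)))
    = n%:R * \sum_(i < n) \sum_(j < n) cell i j.
  rewrite S1 mulrDr; under eq_bigr do rewrite big_split /=.
  rewrite big_split /= sumr_const card_ord mulr_natl; congr (_ + _).
  by rewrite mulr_sumr; apply: eq_bigr => i _; rewrite sumr_const card_ord mulr_natl.
have nS (X : R) : n%:R * X = \sum_(i < n) X by rewrite sumr_const card_ord mulr_natl.
have L1 : n%:R * (n%:R * ((c - e) * d)) <= \sum_(i < n) \sum_(j < n) cell i j.
  rewrite nS; apply: ler_sum => i _; rewrite nS; apply: ler_sum => j _; exact: hcell.
have L2 : \sum_(i < n) \sum_(j < n) (P N (x j) - P (- N) (x j) + (Q (x i) N - Q (x i) (- N)))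
    < n%:R * (n%:R * ((c - e) * (2 * N))).
  rewrite nS; apply: ltr_sum => [|i _].
    by apply/hasP; exists ord0; rewrite ?mem_index_enum.
  rewrite nS; apply: ltr_sum => [|j _].
    by apply/hasP; exists ord0; rewrite ?mem_index_enum.
  exact: hlt.
move: L2; rewrite S2 ltr_pM2l // ltNge; apply/negP; rewrite negbK; apply: le_trans L1.
rewrite ler_pM2l //.
have -> : n%:R * ((c - e) * d) = (c - e) * (2 * N) by rewrite /d; field; rewrite gt_eqF.
by [].
Qed.

End Green.

(** * Calculus of Wirtinger derivatives *)

Section RingIdentities.
Variable K : comRingType.
Implicit Types h i a b c d e f : K.

Lemma wirtD h i a b c d : h * ((a + b) + i * (c + d)) = h * (a + i * c) + h * (b + i * d).
Proof. by ring. Qed.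
Lemma wirtN h i a b : h * (- a + i * (- b)) = - (h * (a + i * b)).
Proof. by ring. Qed.
Lemma wirtM h i a b c d e f :
  h * ((a * e + f * b) + i * (c * e + f * d)) = h * (a + i * c) * e + f * (h * (b + i * d)).
Proof. by ring. Qed.

End RingIdentities.

Section Wirtinger_rules.
Variable R : realType.
Local Notation C := (Cplx R).
Local Notation C2 := (C2 R).
Implicit Types (f g : C2 -> C) (V : set C2) (z v : C2) (i j k : 'I_2).

Lemma dirD_near f g v z : (\forall w \near z, f w = g w) -> dirD f v z = dirD g v z.
Proof.
move=> e; have e' := near_line v e.
rewrite /dirD !derive1E; congr (_ +i* _)%C; apply: near_eq_derive;
  by apply: filterS e' => t /= h; rewrite /along -/(line z v t) h.
Qed.

#[local] Opaque dirD.

Lemma dz_near f g k z : (\forall w \near z, f w = g w) -> dz k f z = dz k g z.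
Proof. by move=> e; rewrite /dz !(dirD_near _ e). Qed.

Lemma dzb_near f g k z : (\forall w \near z, f w = g w) -> dzb k f z = dzb k g z.
Proof. by move=> e; rewrite /dzb !(dirD_near _ e). Qed.

Lemma near_open V z (P : C2 -> Prop) : open V -> V z -> (forall w, V w -> P w) ->
  \forall w \near z, P w.
Proof.
move=> oV Vz h; have : \forall w \near z, V w by exact: open_nbhs_nbhs.
by apply: filterS.
Qed.

Lemma dzE f k z a b : has_dir f (dx R k) z a -> has_dir f (dy R k) z b ->
  dz k f z = 2^-1 * (a - 'i * b).
Proof. by move=> ha hb; rewrite /dz (has_dirE ha) (has_dirE hb). Qed.

Lemma dzbE f k z a b : has_dir f (dx R k) z a -> has_dir f (dy R k) z b ->
  dzb k f z = 2^-1 * (a + 'i * b).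
Proof. by move=> ha hb; rewrite /dzb (has_dirE ha) (has_dirE hb). Qed.

Lemma pd_dx f z k : pd f z -> has_dir f (dx R k) z (dirD f (dx R k) z).
Proof. by apply; exact: axis_dx. Qed.
Lemma pd_dy f z k : pd f z -> has_dir f (dy R k) z (dirD f (dy R k) z).
Proof. by apply; exact: axis_dy. Qed.

Lemma pd_intro f z (d : C2 -> C) : (forall v, axis v -> has_dir f v z (d v)) -> pd f z.
Proof. by move=> h v av; have hv := h v av; rewrite (has_dirE hv). Qed.

Lemma pdN f z : pd f z -> pd (fun w => - f w) z.
Proof. by move=> hf; apply: pd_intro => v av; apply: has_dirN; exact: hf. Qed.
Lemma pdM f g z : pd f z -> pd g z -> pd (fun w => f w * g w) z.
Proof. by move=> hf hg; apply: pd_intro => v av; apply: has_dirM; [exact: hf|exact: hg]. Qed.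
Lemma pd_conj f z : pd f z -> pd (fun w => (f w)^*) z.
Proof. by move=> hf; apply: pd_intro => v av; apply: has_dir_conj; exact: hf. Qed.
Lemma pd_sum n (f : 'I_n -> C2 -> C) z :
  (forall i : 'I_n, pd (f i) z) -> pd (fun w => \sum_i f i w) z.
Proof.
move=> h; apply: (@pd_intro _ _ (fun v => \sum_i dirD (f i) v z)) => v av.
by apply: has_dir_sum => i; exact: h.
Qed.

Lemma dzbD f g k z : pd f z -> pd g z -> dzb k (fun w => f w + g w) z = dzb k f z + dzb k g z.
Proof.
move=> hf hg; rewrite (dzbE (has_dirD (pd_dx k hf) (pd_dx k hg)) (has_dirD (pd_dy k hf) (pd_dy k hg))).
exact: wirtD.
Qed.

Lemma dzbN f k z : pd f z -> dzb k (fun w => - f w) z = - dzb k f z.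
Proof.
move=> hf; rewrite (dzbE (has_dirN (pd_dx k hf)) (has_dirN (pd_dy k hf))); exact: wirtN.
Qed.

Lemma dzbM f g k z : pd f z -> pd g z ->
  dzb k (fun w => f w * g w) z = dzb k f z * g z + f z * dzb k g z.
Proof.
move=> hf hg; rewrite (dzbE (has_dirM (pd_dx k hf) (pd_dx k hg)) (has_dirM (pd_dy k hf) (pd_dy k hg))).
exact: wirtM.
Qed.

Lemma dzb_conj f k z : pd f z -> dzb k (fun w => (f w)^*) z = (dz k f z)^*.
Proof.
move=> hf; rewrite (dzbE (has_dir_conj (pd_dx k hf)) (has_dir_conj (pd_dy k hf))) /dz.
by rewrite cconjM cconjB cconjM conji cconjV cconjn mulNr opprK.
Qed.

Lemma dz_conj f k z : pd f z -> dz k (fun w => (f w)^*) z = (dzb k f z)^*.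
Proof.
move=> hf; rewrite (dzE (has_dir_conj (pd_dx k hf)) (has_dir_conj (pd_dy k hf))) /dzb.
by rewrite cconjM cconjD cconjM conji cconjV cconjn mulNr.
Qed.

Lemma dzb_sum n (f : 'I_n -> C2 -> C) k z : (forall i : 'I_n, pd (f i) z) ->
  dzb k (fun w => \sum_i f i w) z = \sum_i dzb k (f i) z.
Proof.
move=> h.
rewrite (dzbE (has_dir_sum (fun i : 'I_n => pd_dx k (h i))) (has_dir_sum (fun i : 'I_n => pd_dy k (h i)))).
by rewrite mulr_sumr -big_split mulr_sumr; apply: eq_bigr.
Qed.

Lemma C1_dzb V f k : Cn 2 V f -> open V -> C1 V (dzb k f).
Proof.
case=> _ h oV; rewrite /dzb.
have hx : C1 V (dirD f (dx R k)) by apply/C1P; apply: (h k _ (or_introl erefl)).2.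
have hy : C1 V (dirD f (dy R k)) by apply/C1P; apply: (h k _ (or_intror erefl)).2.
apply: (C1M oV); first exact: C1_cst.
apply: (C1D oV); first exact: hx.
apply: (C1M oV); [exact: C1_cst|exact: hy].
Qed.

Lemma C2_C1 V f : Cn 2 V f -> C1 V f.
Proof.
case=> h1 h2; apply/C1P; split; first exact: h1.
move=> i v hv; have [h3 h4] := h2 i v hv; split; first exact: h3.
by split; [exact: h4.1|].
Qed.

Lemma C1_dz_cont V f k z : C1 V f -> V z -> {for z, continuous (dz k f)}.
Proof.
case=> _ h Vz; rewrite /dz; apply: continuous_cM; first exact: continuous_at_cst.
apply: continuous_cD; first exact: (h _ (axis_dx R k)).2.
apply: continuous_cN; apply: continuous_cM; first exact: continuous_at_cst.
exact: (h _ (axis_dy R k)).2.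
Qed.

Lemma C1_dzb_cont V f k z : C1 V f -> V z -> {for z, continuous (dzb k f)}.
Proof.
case=> _ h Vz; rewrite /dzb; apply: continuous_cM; first exact: continuous_at_cst.
apply: continuous_cD; first exact: (h _ (axis_dx R k)).2.
apply: continuous_cM; first exact: continuous_at_cst.
exact: (h _ (axis_dy R k)).2.
Qed.

End Wirtinger_rules.

(** * Determinant and inverse of two by two matrices *)

Section TwoByTwo.
Variable K : fieldType.
Implicit Type A : 'M[K]_2.

Lemma sum2 (V : nmodType) (F : 'I_2 -> V) : \sum_i F i = F 0 + F 1.
Proof. by rewrite !big_ord_recl big_ord0 addr0; congr (F _ + F _); exact/val_inj. Qed.

Lemma det2 A : \det A = A 0 0 * A 1 1 - A 0 1 * A 1 0.
Proof.
rewrite (expand_det_row _ 0) sum2 /cofactor !det_mx11 !mxE /= expr0 mul1r expr1.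
have -> : lift 0 0 = 1 :> 'I_2 by exact/val_inj.
have -> : lift 1 0 = 0 :> 'I_2 by exact/val_inj.
by rewrite mulN1r mulrN.
Qed.

(** In ['I_2] the map p |-> 1 - p swaps the two indices, which puts the four entries of the adjugate
    into one formula. *)
Lemma invmx2 A p q : \det A != 0 ->
  invmx A q p = (-1) ^+ (p != q) * A (1 - p) (1 - q) / \det A.
Proof.
move=> d0; have uA : A \in unitmx by rewrite unitmxE unitfE.
pose B : 'M[K]_2 := \matrix_(q, p) ((-1) ^+ (p != q) * A (1 - p) (1 - q) / \det A).
have s0 : 1 - 0 = 1 :> 'I_2 by exact/val_inj.
have s1 : 1 - 1 = 0 :> 'I_2 by exact/val_inj.
have AB : A *m B = 1%:M.
  apply/matrixP => i j; rewrite !mxE sum2 !mxE.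
  have [->|->] := ord2 i; have [->|->] := ord2 j; rewrite ?s0 ?s1 ?eqxx /= ?expr0 ?expr1.
  - by transitivity ((A 0 0 * A 1 1 - A 0 1 * A 1 0) / \det A); [field|rewrite -det2 divff].
  - by field.
  - by field.
  - by transitivity ((A 0 0 * A 1 1 - A 0 1 * A 1 0) / \det A); [field|rewrite -det2 divff].
have -> : invmx A = B by rewrite -[LHS]mulmx1 -AB mulKmx.
by rewrite mxE.
Qed.

End TwoByTwo.

(** * The static equation in a chart *)

Section LocalMetric.
Variable R : realType.
Local Notation C := (Cplx R).
Local Notation C2 := (C2 R).
Implicit Types (f : C2 -> C) (z v : C2) (i j k p q : 'I_2).

(** An open set instead of a chart, so that the local results apply both to charts of the surface
    and to the metric lifted to [Omega]. *)
Record smooth_metric (U : set C2) (g : C2 -> 'M[C]_2) : Prop := SmoothMetric {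
  sm_open : open U;
  sm_C2 : forall i j, Cn 2 U (fun z => g z i j);
  sm_herm : forall z, U z -> forall i j, g z j i = (g z i j)^*;
  sm_pos : forall z, U z -> forall v : C2, v != 0 ->
    0 < \sum_i \sum_j g z i j * v 0 i * (v 0 j)^* }.

(** The form takes the value [A 1 1] at (0, 1) and [A 1 1 * \det A] at ([A 1 1], [- A 0 1]). *)
Lemma hermitian2_det_gt0 (A : 'M[C]_2) : (forall i j, A j i = (A i j)^*) ->
  (forall v : C2, v != 0 -> 0 < \sum_i \sum_j A i j * v 0 i * (v 0 j)^*) -> 0 < \det A.
Proof.
move=> hA pA.
have q v : \sum_i \sum_j A i j * v 0 i * (v 0 j)^* =
    A 0 0 * v 0 0 * (v 0 0)^* + A 0 1 * v 0 0 * (v 0 1)^* +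
    (A 1 0 * v 0 1 * (v 0 0)^* + A 1 1 * v 0 1 * (v 0 1)^*) by rewrite !sum2.
have v2 (a b : C) : (vec2 a b : C2) 0 0 = a /\ (vec2 a b : C2) 0 1 = b by rewrite !mxE.
have v20 (a b : C) : b != 0 \/ a != 0 -> (vec2 a b : C2) != 0.
  have [ea eb] := v2 a b.
  by case=> /eqP h; apply/eqP => e; apply: h; [move: eb|move: ea]; rewrite e mxE => <-.
have A11 : 0 < A 1 1.
  have := pA (vec2 0 1) (v20 _ _ (or_introl (oner_neq0 _))); rewrite q.
  by case: (v2 0 1) => -> ->; rewrite conjC0 conjC1 !(mulr0, mul0r, add0r, mulr1).
have := pA (vec2 (A 1 1) (- A 0 1)) (v20 _ _ (or_intror (lt0r_neq0 A11))).
rewrite q; case: (v2 (A 1 1) (- A 0 1)) => -> ->.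
rewrite cconjN -!hA.
suff -> : forall a b c d : C, a * d * d + b * d * (- c) + (c * (- b) * d + d * (- b) * (- c))
    = d * (a * d - b * c).
  by rewrite -det2 pmulr_rgt0.
by move=> a b c d; ring.
Qed.

Variables (U : set C2) (g : C2 -> 'M[C]_2).
Hypothesis gU : smooth_metric U g.

Let oU : open U := sm_open gU.

Lemma det_gt0 z : U z -> 0 < \det (g z).
Proof. by move=> Uz; apply: hermitian2_det_gt0; [exact: sm_herm gU _ Uz|exact: sm_pos gU _ Uz]. Qed.

Lemma det_neq0 z : U z -> \det (g z) != 0.
Proof. by move=> /det_gt0/lt0r_neq0. Qed.

Lemma C1_g i j : C1 U (fun z => g z i j).
Proof. exact: C2_C1 (sm_C2 gU i j). Qed.

Lemma pd_g i j z : U z -> pd (fun z => g z i j) z.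
Proof. exact: C1_pd (C1_g i j). Qed.

Lemma C1_det : C1 U (fun z => \det (g z)).
Proof.
apply: (@C1_eq _ _ (fun z => g z 0 0 * g z 1 1 + - (g z 0 1 * g z 1 0)) _ oU).
  by move=> z _; rewrite det2.
apply: (C1D oU); first by apply: (C1M oU); exact: C1_g.
by apply: (C1N oU); apply: (C1M oU); exact: C1_g.
Qed.

Lemma C1_dzb_det k : C1 U (dzb k (fun z => \det (g z))).
Proof.
apply: (@C1_eq _ _ (fun z => dzb k (fun z => g z 0 0) z * g z 1 1 + g z 0 0 * dzb k (fun z => g z 1 1) z +
   - (dzb k (fun z => g z 0 1) z * g z 1 0 + g z 0 1 * dzb k (fun z => g z 1 0) z)) _ oU).
  move=> z Uz; have p i j := pd_g i j Uz.
  transitivity (dzb k (fun z => g z 0 0 * g z 1 1 + - (g z 0 1 * g z 1 0)) z); last first.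
    by congr (dzb k _ z); apply/funext => w; rewrite det2.
  rewrite dzbD; [|exact: pdM|exact: pdN (pdM _ _)].
  rewrite dzbN; last exact: pdM.
  by rewrite !dzbM.
have d i j : C1 U (dzb k (fun z => g z i j)) by exact: C1_dzb (sm_C2 gU i j) oU.
have m i j i' j' : C1 U (fun z => dzb k (fun z => g z i j) z * g z i' j').
  by apply: (C1M oU); [exact: d|exact: C1_g].
have m' i j i' j' : C1 U (fun z => g z i' j' * dzb k (fun z => g z i j) z).
  by apply: (C1M oU); [exact: C1_g|exact: d].
apply: (C1D oU); first by apply: (C1D oU); [exact: m|exact: m'].
by apply: (C1N oU); apply: (C1D oU); [exact: m|exact: m'].
Qed.

(** The form dbar log det g written as a quotient, so that its regularity and its transformation
    rule need no logarithm. *)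
Definition dlogdet k z : C := dzb k (fun w => \det (g w)) z / \det (g z).

Lemma C1_dlogdet k : C1 U (dlogdet k).
Proof.
apply: (C1M oU); first exact: C1_dzb_det.
by apply: (C1V oU C1_det) => z; exact: det_neq0.
Qed.

Lemma C1_ginv p q : C1 U (fun z => ginv g z p q).
Proof.
apply: (@C1_eq _ _ (fun z => (-1) ^+ (p != q) * g z (1 - p) (1 - q) * (\det (g z))^-1) _ oU).
  by move=> z Uz; rewrite /ginv invmx2 // det_neq0.
apply: (C1M oU); first by apply: (C1M oU); [exact: C1_cst|exact: C1_g].
by apply: (C1V oU C1_det) => z; exact: det_neq0.
Qed.

Lemma C1_del_adj k : C1 U (del_adj g k).
Proof.
rewrite /del_adj; apply: (C1M oU); first exact: C1_cst.
apply: (C1_sum oU) => p; apply: (C1_sum oU) => q; apply: (C1M oU); first exact: C1_ginv.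
have d i j k' : C1 U (dzb k' (fun z => g z i j)) by exact: C1_dzb (sm_C2 gU i j) oU.
by apply: (C1D oU); [exact: d|apply: (C1N oU); exact: d].
Qed.

(** As [g] is Hermitian, conjugation transposes [ginv] and exchanges [dzb] of g_ij with [dz] of
    g_ji; the sign of the conjugate of ['i] reverses the difference. Only one torsion form remains
    to be studied. *)
Lemma dbar_adjE k z : U z -> dbar_adj g k z = (del_adj g k z)^*.
Proof.
move=> Uz; rewrite /dbar_adj /del_adj cconjM cconjM conji cconjV cconjn.
rewrite !mulNr -[RHS]mulrN; congr (_ * _); rewrite cconj_sum; under [in RHS]eq_bigr do rewrite cconj_sum.
have flipB (a b c : C) : a * (b - c) = - (a * (c - b)) by ring.
rewrite exchange_big -sumrN; apply: eq_bigr => p _; rewrite -sumrN; apply: eq_bigr => q _.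
have cinv : (ginv g z p q)^* = ginv g z q p.
  rewrite /ginv !invmx2 ?det_neq0 // !cconjM cconjV (eq_sym q p).
  rewrite -(sm_herm gU Uz); congr (_ * _ / _).
    by case: eqP; rewrite ?expr0 ?expr1 ?cconjN conjC1.
  by rewrite conj_Creal // gtr0_real // det_gt0.
have cdz i j k' : (dzb k' (fun w => g w i j) z)^* = dz k' (fun w => g w j i) z.
  rewrite -dz_conj; last exact: pd_g.
  by apply: dz_near; apply: (near_open oU Uz) => w Uw; rewrite -(sm_herm gU Uw).
rewrite cconjM cinv cconjB cdz cdz; exact: flipB.
Qed.

Lemma dzb_logdet k z : U z -> dzb k (logdet g) z = dlogdet k z.
Proof.
move=> Uz.
have h v : axis v -> has_dir (logdet g) v z (dirD (fun w => \det (g w)) v z / \det (g z)).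
  move=> av; have hd := C1_pd C1_det Uz av; set a := dirD _ _ _ in hd *.
  have nU : \forall t \near (0:R), U (line z v t) by apply: near_line; exact: open_nbhs_nbhs.
  have rdet w : U w -> \det (g w) = ofR (cRe (\det (g w))).
    by move=> Uw; have [r ->] := gt0_ofR (det_gt0 Uw); rewrite cRe_ofR.
  have pdet w : U w -> 0 < cRe (\det (g w)).
    by move=> Uw; rewrite -ofR_gt0 -rdet // det_gt0.
  (* [logdet] sees only the real part of the determinant; nothing is lost because the determinant is
     real on [U], hence so is its directional derivative. *)
  have ima : cIm a = 0.
    have h0 : is_derive (0 : R) (1 : R) (fun _ : R => 0 : R) 0 by exact: is_derive_cst.
    apply: is_derive_uniq (cderiv_cIm hd) _; apply: near_eq_is_derive h0.
    by apply: filterS nU => t Ut; rewrite rdet // cIm_ofR.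
  have hln : is_derive (0:R) (1:R) (fun t => ln (cRe (\det (g (line z v t))))) ((cRe (\det (g z)))^-1 * cRe a).
    apply: (@is_derive1_comp _ (@ln R) (fun t => cRe (\det (g (line z v t))))); last exact: cderiv_cRe hd.
    by rewrite line0; apply: is_derive1_ln; exact: pdet.
  apply: cderiv_eq (cderiv_ofR hln) _.
  rewrite ofRM ofRV -rdet // mulrC; congr (_ / _).
  by apply: ceqP; rewrite ?cRe_ofR ?cIm_ofR.
rewrite (dzbE (h _ (axis_dx R k)) (h _ (axis_dy R k))) /dlogdet /dzb.
by rewrite mulrA -mulrDl mulrA.
Qed.

(** The minus signs in [static_on] and in [dbar10] cancel, so the second torsion term is plus the
    conjugate transpose of the coefficient matrix in the first. *)
Lemma static_dlogdet lambda z i j : static_on g lambda U -> U z ->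
  - dz i (del_adj g j) z + (dz j (del_adj g i) z)^* - 'i / 2 * dz i (dlogdet j) z =
  ofR lambda * ('i / 2 * g z i j).
Proof.
move=> st Uz; rewrite -[RHS](st z Uz i j) /del01 /dbar10 /deldbar0 opprK; congr (_ + _ - _ * _).
  rewrite -dzb_conj; last exact: C1_pd (C1_del_adj i) Uz.
  by apply: dzb_near; apply: (near_open oU Uz) => w Uw; rewrite dbar_adjE.
by apply: dz_near; apply: (near_open oU Uz) => w Uw; rewrite dzb_logdet.
Qed.

End LocalMetric.

(** * The static equation on a holomorphic curve *)

Section Leaf.
Variable R : realType.
Local Notation C := (Cplx R).
Local Notation C2 := (C2 R).
Implicit Types (f : C2 -> C) (i j k : 'I_2) (x y : R) (b : 'I_2 -> C2 -> C).

(* [z] is the holomorphic curve x + iy |-> z x y, with first and second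
   complex derivatives [V] and [W]. *)
Record leaf (U : set C2) (z V W : R -> R -> C2) : Prop := Leaf {
  leaf_in : forall x y, U (z x y);
  leaf_zx : forall x y k, cderiv (fun s => z s y 0 k) x (V x y 0 k);
  leaf_zy : forall x y k, cderiv (fun s => z x s 0 k) y (('i *: V x y) 0 k);
  leaf_Vx : forall x y k, cderiv (fun s => V s y 0 k) x (W x y 0 k);
  leaf_Vy : forall x y k, cderiv (fun s => V x s 0 k) y (('i *: W x y) 0 k);
  leaf_z_cont : forall x y, {for (x, y), continuous (fun p : R * R => z p.1 p.2)};
  leaf_V_cont : forall x y, {for (x, y), continuous (fun p : R * R => V p.1 p.2)};
  leaf_W_cont : forall x y, {for (x, y), continuous (fun p : R * R => W p.1 p.2)} }.

Variables (U : set C2) (z V W : R -> R -> C2).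
Hypothesis oU : open U.
Hypothesis zl : leaf U z V W.

(* A (0,1)-form evaluated on the conjugate of the velocity of the leaf. *)
Definition along_leaf b x y : C := \sum_j b j (z x y) * (V x y 0 j)^*.

Definition along_leaf_dx b x y : C := \sum_j
  (grad (b j) (z x y) (V x y) * (V x y 0 j)^* + b j (z x y) * (W x y 0 j)^*).

Definition along_leaf_dy b x y : C := \sum_j
  (grad (b j) (z x y) ('i *: V x y) * (V x y 0 j)^* + b j (z x y) * (('i *: W x y) 0 j)^*).

Lemma cderiv_along_leaf_x b x y : (forall j, C1 U (b j)) ->
  cderiv (fun s => along_leaf b s y) x (along_leaf_dx b x y).
Proof.
move=> hb; apply: cderiv_sum => j; apply: cderivM.
  by apply: (chain_rule oU (hb j) (leaf_in zl x y)); exact: leaf_zx zl x y.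
by apply: cderiv_conj; exact: leaf_Vx zl x y j.
Qed.

Lemma cderiv_along_leaf_y b x y : (forall j, C1 U (b j)) ->
  cderiv (fun s => along_leaf b x s) y (along_leaf_dy b x y).
Proof.
move=> hb; apply: cderiv_sum => j; apply: cderivM.
  by apply: (chain_rule oU (hb j) (leaf_in zl x y)); exact: leaf_zy zl x y.
by apply: cderiv_conj; exact: leaf_Vy zl x y j.
Qed.

(** The operator d_x - i d_y is twice the holomorphic derivative along the leaf. The conjugate of
    the velocity is antiholomorphic, so the terms in [W] cancel, as do those in [dzb]. *)
Lemma along_leaf_dz b x y : along_leaf_dx b x y - 'i * along_leaf_dy b x y =
  2 * \sum_i \sum_j dz i (b j) (z x y) * V x y 0 i * (V x y 0 j)^*.
Proof.
have e (a c d h v w u b' w' : C) : (a * v + c * v^* + (d * w + h * w^*)) * u + b' * w'^* -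
    'i * ((a * ('i * v) + c * ('i * v)^* + (d * ('i * w) + h * ('i * w)^*)) * u + b' * ('i * w')^*) =
    2 * (a * v * u + d * w * u).
  rewrite !cconjM conji.
  have -> : forall I : C, (a * v + c * v^* + (d * w + h * w^*)) * u + b' * w'^* -
     I * ((a * (I * v) + c * (- I * v^*) + (d * (I * w) + h * (- I * w^*))) * u + b' * (- I * w'^*)) =
     (1 - I * I) * (a * v * u + d * w * u) + (1 + I * I) * (c * v^* * u + h * w^* * u + b' * w'^*).
    by move=> I; ring.
  by rewrite ii subrr mul0r addr0 opprK.
rewrite /along_leaf_dx /along_leaf_dy exchange_big mulr_sumr mulr_sumr -sumrB; apply: eq_bigr => j _.
rewrite /grad !sum2 !mxE.
exact: e.
Qed.

Let zc := leaf_z_cont zl.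

Lemma continuous_on_leaf f x y : {for z x y, continuous f} ->
  {for (x, y), continuous (fun p : R * R => f (z p.1 p.2))}.
Proof.
move=> cf; apply: (@continuous_comp _ _ _ (fun p : R * R => z p.1 p.2) f); first exact: zc.
exact: cf.
Qed.

Lemma continuous_coord_at (v : R -> R -> C2) k x y :
  {for (x, y), continuous (fun p : R * R => v p.1 p.2)} ->
  {for (x, y), continuous (fun p : R * R => v p.1 p.2 0 k)}.
Proof.
move=> cv; apply: (@continuous_comp _ _ _ (fun p : R * R => v p.1 p.2) (fun w : C2 => w 0 k)).
  exact: cv.
exact: continuous_coord.
Qed.

Lemma continuous_grad f (c : C) x y : C1 U f ->
  {for (x, y), continuous (fun p : R * R => grad f (z p.1 p.2) (c *: V p.1 p.2))}.
Proof.
move=> hf; rewrite /grad; apply: continuous_csum => k.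
have cV : {for (x, y), continuous (fun p : R * R => (c *: V p.1 p.2) 0 k)}.
  apply: (@continuous_ext _ _ (fun p : R * R => c * V p.1 p.2 0 k)) => [p|]; first by rewrite mxE.
  apply: continuous_cM; first exact: continuous_at_cst.
  by apply: continuous_coord_at; exact: leaf_V_cont zl x y.
apply: continuous_cD; apply: continuous_cM.
- exact: (@continuous_on_leaf (dz k f) x y (C1_dz_cont (k := k) hf (leaf_in zl x y))).
- exact: cV.
- exact: (@continuous_on_leaf (dzb k f) x y (C1_dzb_cont (k := k) hf (leaf_in zl x y))).
- by apply: continuous_cconj; exact: cV.
Qed.

Lemma continuous_along_leaf_term b j (c : C) x y : C1 U (b j) ->
  {for (x, y), continuous (fun p : R * R => grad (b j) (z p.1 p.2) (c *: V p.1 p.2) * (V p.1 p.2 0 j)^* +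
     b j (z p.1 p.2) * ((c *: W p.1 p.2) 0 j)^*)}.
Proof.
move=> hb; apply: continuous_cD; apply: continuous_cM.
- exact: continuous_grad.
- by apply: continuous_cconj; apply: continuous_coord_at; exact: leaf_V_cont zl x y.
- exact: (@continuous_on_leaf (b j) x y (C1_cont hb (leaf_in zl x y))).
- apply: continuous_cconj.
  apply: (@continuous_ext _ _ (fun p : R * R => c * W p.1 p.2 0 j)) => [p|]; first by rewrite mxE.
  apply: continuous_cM; first exact: continuous_at_cst.
  by apply: continuous_coord_at; exact: leaf_W_cont zl x y.
Qed.

Lemma continuous_along_leaf_dx b x y : (forall j, C1 U (b j)) ->
  {for (x, y), continuous (fun p : R * R => along_leaf_dx b p.1 p.2)}.
Proof.
move=> hb; rewrite /along_leaf_dx; apply: continuous_csum => j.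
have := @continuous_along_leaf_term b j 1 x y (hb j).
by apply: continuous_ext => p; rewrite !scale1r.
Qed.

Lemma continuous_along_leaf_dy b x y : (forall j, C1 U (b j)) ->
  {for (x, y), continuous (fun p : R * R => along_leaf_dy b p.1 p.2)}.
Proof.
move=> hb; rewrite /along_leaf_dy; apply: continuous_csum => j.
exact: continuous_along_leaf_term.
Qed.

Variables (g : C2 -> 'M[C]_2) (lambda : R).
Hypothesis gU : smooth_metric U g.
Hypothesis g_static : static_on g lambda U.

Let delta := along_leaf (del_adj g).
Let eps := along_leaf (dlogdet g).

(* Up to a factor, the imaginary part of the static equation on the leaf is the
   formula for the divergence of (P, Q). *)
Definition leafP x y : R := - 2 * cIm (delta x y) - 2^-1 * cRe (eps x y).
Definition leafQ x y : R := 2 * cRe (delta x y) - 2^-1 * cIm (eps x y).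
Definition leafPx x y : R := - 2 * cIm (along_leaf_dx (del_adj g) x y) -
  2^-1 * cRe (along_leaf_dx (dlogdet g) x y).
Definition leafQy x y : R := 2 * cRe (along_leaf_dy (del_adj g) x y) -
  2^-1 * cIm (along_leaf_dy (dlogdet g) x y).

Definition leaf_area x y : R := cRe (\sum_i \sum_j g (z x y) i j * V x y 0 i * (V x y 0 j)^*).

Lemma is_derive_scale (c : R) (F : R -> R) (t d : R) : is_derive t (1 : R) F d ->
  is_derive t (1 : R) (fun s => c * F s) (c * d).
Proof. exact: is_deriveZ. Qed.

Lemma is_derive_leafP x y : is_derive x (1 : R) (leafP^~ y) (leafPx x y).
Proof.
have h1 := @cderiv_along_leaf_x (del_adj g) x y (C1_del_adj gU).
have h2 := @cderiv_along_leaf_x (dlogdet g) x y (C1_dlogdet gU).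
exact: is_derive_sub (is_derive_scale (- 2) (cderiv_cIm h1)) (is_derive_scale 2^-1 (cderiv_cRe h2)).
Qed.

Lemma is_derive_leafQ x y : is_derive y (1 : R) (leafQ x) (leafQy x y).
Proof.
have h1 := @cderiv_along_leaf_y (del_adj g) x y (C1_del_adj gU).
have h2 := @cderiv_along_leaf_y (dlogdet g) x y (C1_dlogdet gU).
exact: is_derive_sub (is_derive_scale 2 (cderiv_cRe h1)) (is_derive_scale 2^-1 (cderiv_cIm h2)).
Qed.

Lemma continuous_leafPx x y : {for (x, y), continuous (fun p : R * R => leafPx p.1 p.2)}.
Proof.
apply: continuous_lincomb.
  by apply: continuous_cIm_comp; exact: continuous_along_leaf_dx (C1_del_adj gU).
by apply: continuous_cRe_comp; exact: continuous_along_leaf_dx (C1_dlogdet gU).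
Qed.

Lemma continuous_leafQy x y : {for (x, y), continuous (fun p : R * R => leafQy p.1 p.2)}.
Proof.
apply: continuous_lincomb.
  by apply: continuous_cRe_comp; exact: continuous_along_leaf_dy (C1_del_adj gU).
by apply: continuous_cIm_comp; exact: continuous_along_leaf_dy (C1_dlogdet gU).
Qed.

(** The two torsion terms contract to - [A] and its conjugate, so the torsion enters through the
    imaginary part of [A] only, and the determinant through the real part of [F]. [along_leaf_dz]
    turns both into derivatives in x and y. *)
Lemma leaf_identity x y : leafPx x y + leafQy x y = lambda * leaf_area x y.
Proof.
set dx1 := along_leaf_dx (del_adj g) x y; set dy1 := along_leaf_dy (del_adj g) x y.
set dx2 := along_leaf_dx (dlogdet g) x y; set dy2 := along_leaf_dy (dlogdet g) x y.
have e1 := along_leaf_dz (del_adj g) x y; rewrite -/dx1 -/dy1 in e1.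
have e2 := along_leaf_dz (dlogdet g) x y; rewrite -/dx2 -/dy2 in e2.
set A := \sum_i _ in e1; set F := \sum_i _ in e2.
have gA : ofR (leaf_area x y) = \sum_i \sum_j g (z x y) i j * V x y 0 i * (V x y 0 j)^*.
  rewrite /leaf_area; set s := \sum_i _.
  have cs : s^* = s.
    rewrite /s cconj_sum exchange_big; apply: eq_bigr => i _; rewrite cconj_sum; apply: eq_bigr => j _.
    rewrite !cconjM -(sm_herm gU (leaf_in zl x y)) conjCK.
    by move: (g _ _ _) (V x y 0 i) (V x y 0 j)^* => *; ring.
  apply: ceqP; rewrite ?cRe_ofR // cIm_ofR.
  by have := congr1 (@cIm R) cs; rewrite cIm_conj => h; lra.
have st : - A + A^* - 'i / 2 * F = ofR lambda * ('i / 2 * ofR (leaf_area x y)).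
  rewrite gA /A /F cconj_sum mulr_sumr mulr_sumr mulr_sumr -sumrN.
  have -> : \sum_i (\sum_j dz i (del_adj g j) (z x y) * V x y 0 i * (V x y 0 j)^*)^* =
     \sum_i \sum_j (dz j (del_adj g i) (z x y))^* * V x y 0 i * (V x y 0 j)^*.
    rewrite [RHS]exchange_big; apply: eq_bigr => i _; rewrite cconj_sum; apply: eq_bigr => j _.
    by rewrite !cconjM conjCK mulrAC.
  rewrite -big_split -sumrB; apply: eq_bigr => i _ /=.
  rewrite !mulr_sumr -sumrN -big_split -sumrB; apply: eq_bigr => j _ /=.
  have := static_dlogdet gU i j g_static (leaf_in zl x y).
  move: (dz i _ _) (dz j _ _)^* (dz i _ _) (g _ _ _) (V x y 0 i) (V x y 0 j)^* ('i / 2) => c b a d v w I h.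
  transitivity ((- a + b - I * c) * v * w); first by ring.
  by rewrite h; ring.
have st' := congr1 (@cIm R) st; have {}e1 := congr1 (@cIm R) e1; have {}e2 := congr1 (@cRe R) e2.
have two : 2 = ofR 2 :> C by rewrite ofRn.
have half : 'i / 2 = 'i * ofR 2^-1 :> C by rewrite ofRV -two.
move: st' e1 e2; rewrite half two.
rewrite !(cReD, cImD, cReN, cImN, cReM, cImM, cRe_conj, cIm_conj, cRe_ofR, cIm_ofR, cRei, cImi).
rewrite /leafPx /leafQy -/dx1 -/dy1 -/dx2 -/dy2; move: (leaf_area x y) => ar.
clear gA st; clearbody A F dx1 dy1 dx2 dy2.
by move: (cRe A) (cIm A) (cRe F) (cIm F) (cRe dx1) (cIm dx1) (cRe dy1) (cIm dy1)
  (cRe dx2) (cIm dx2) (cRe dy2) (cIm dy2) => *; lra.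
Qed.

(** The factor [s] orients the inequality: it is the sign of lambda on the Hopf leaves, and -1 on
    the exceptional curve, where an upper bound of the boundary terms is wanted. *)
Lemma leaf_green (N c e s : R) : 0 < N -> 0 < e ->
  (forall x y, `|x| <= N -> `|y| <= N -> c <= s * (lambda * leaf_area x y)) ->
  exists x y, [/\ `|x| <= N, `|y| <= N &
    (c - e) * (2 * N) <= s * (leafP N y - leafP (- N) y + (leafQ x N - leafQ x (- N)))].
Proof.
move=> N0 e0 hc.
have cs (F : R -> R -> R) x y : {for (x, y), continuous (fun p : R * R => F p.1 p.2)} ->
    {for (x, y), continuous (fun p : R * R => s * F p.1 p.2)}.
  move=> cF; apply: (@cvgM _ _ _ _ (fun _ => s) (fun p : R * R => F p.1 p.2)); last exact: cF.
  exact: cst_continuous.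
have hc' x y : `|x| <= N -> `|y| <= N -> c <= s * leafPx x y + s * leafQy x y.
  by move=> hx hy; rewrite -mulrDr leaf_identity; exact: hc.
have [x [y [hx hy h]]] := @green_square R (fun x y => s * leafP x y) (fun x y => s * leafQ x y)
  (fun x y => s * leafPx x y) (fun x y => s * leafQy x y) N c e N0 e0
  (fun x y => is_derive_scale s (is_derive_leafP x y))
  (fun x y => is_derive_scale s (is_derive_leafQ x y))
  (fun x y => cs _ x y (@continuous_leafPx x y)) (fun x y => cs _ x y (@continuous_leafQy x y))
  hc'.
exists x, y; split=> //; apply: le_trans h _.
by rewrite -!mulrBr -mulrDr.
Qed.

End Leaf.

(** * Holomorphic changes of coordinates *)

Section Covariance.
Variable R : realType.
Local Notation C := (Cplx R).
Local Notation C2 := (C2 R).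
Implicit Types (f : C2 -> C) (z v : C2) (i j k p q : 'I_2).

(** The Cauchy-Riemann equations in terms of directional derivatives; [d] is the vector of complex
    partial derivatives. *)
Definition holo_at f z (d : 'I_2 -> C) := forall q,
  has_dir f (dx R q) z (d q) /\ has_dir f (dy R q) z ('i * d q).

Lemma holo_pd f z d : holo_at f z d -> pd f z.
Proof.
move=> h v [q [->|->]]; first by rewrite (has_dirE (h q).1); exact: (h q).1.
by rewrite (has_dirE (h q).2); exact: (h q).2.
Qed.

Lemma holo_dzb f z d q : holo_at f z d -> dzb q f z = 0.
Proof.
by move=> h; rewrite (dzbE (h q).1 (h q).2) mulrA ii mulN1r subrr mulr0.
Qed.

Lemma holo_dz f z d q : holo_at f z d -> dz q f z = d q.
Proof.
move=> h; rewrite (dzE (h q).1 (h q).2) mulrA ii mulN1r opprK.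
by move: (d q) => w; field.
Qed.

Lemma holo_near f g z d : (\forall w \near z, f w = g w) -> holo_at f z d -> holo_at g z d.
Proof. by move=> e h q; split; apply: has_dir_near e _; [exact: (h q).1|exact: (h q).2]. Qed.

Lemma holo_cst a z : holo_at (fun=> a) z (fun=> 0).
Proof. by move=> q; rewrite mulr0; split; exact: has_dir_cst. Qed.

Lemma holo_coord k z : holo_at (fun w => w 0 k) z (fun q => (k == q)%:R).
Proof.
move=> q; split; first by have := @has_dir_coord R k (dx R q) z; rewrite dxE.
by have := @has_dir_coord R k (dy R q) z; rewrite dyE.
Qed.

Lemma holoM f g z d e : holo_at f z d -> holo_at g z e ->
  holo_at (fun w => f w * g w) z (fun q => d q * g z + f z * e q).
Proof.
move=> hf hg q; split; first exact: has_dirM (hf q).1 (hg q).1.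
have := has_dirM (hf q).2 (hg q).2; congr (has_dir _ _ _ _).
by move: (d q) (e q) (f z) (g z) => *; ring.
Qed.

Lemma holoD f g z d e : holo_at f z d -> holo_at g z e ->
  holo_at (fun w => f w + g w) z (fun q => d q + e q).
Proof.
move=> hf hg q; rewrite mulrDr; split; first exact: has_dirD (hf q).1 (hg q).1.
exact: has_dirD (hf q).2 (hg q).2.
Qed.

Lemma holoV f z d : f z != 0 -> holo_at f z d ->
  holo_at (fun w => (f w)^-1) z (fun q => - d q / f z ^+ 2).
Proof.
move=> f0 hf q; split; first exact: has_dirV f0 (hf q).1.
by rewrite mulrA mulrN; exact: has_dirV f0 (hf q).2.
Qed.

Lemma half_diff (a b : C) : 2^-1 * (a + b - (a - b)) = b.
Proof. by field. Qed.

(** Second derivatives of a coordinate change are symmetric, so they drop out of the skew part of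
    the derivative of the metric: this is why torsion is a tensor. [J], [Jc] and [H] stand for the
    Jacobian, its conjugate and the conjugated second derivatives. *)
Lemma torsion_pullback (J Jc G : 'I_2 -> 'I_2 -> C) (H D : 'I_2 -> 'I_2 -> 'I_2 -> C) p q k :
  (forall c, H q k c = H k q c) ->
  \sum_a \sum_c (J p a * H q k c * G a c + J p a * Jc k c * \sum_e Jc q e * D e a c) -
  \sum_a \sum_c (J p a * H k q c * G a c + J p a * Jc q c * \sum_e Jc k e * D e a c) =
  \sum_c \sum_a \sum_e Jc k c * (J p a * Jc q e) * (D e a c - D c a e).
Proof.
move=> hs; rewrite !sum2 !hs.
move: (J p 0) (J p 1) (H k q 0) (H k q 1) (Jc k 0) (Jc k 1) (Jc q 0) (Jc q 1) => *.
move: (G 0 0) (G 0 1) (G 1 0) (G 1 1) => *.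
by move: (D 0 0 0) (D 0 0 1) (D 0 1 0) (D 0 1 1) (D 1 0 0) (D 1 0 1) (D 1 1 0) (D 1 1 1) => *; ring.
Qed.

(** Collects the factor that [ginv_pullback] identifies with the inverse of the transformed
    metric. *)
Lemma trace_regroup (gi J Jc : 'I_2 -> 'I_2 -> C) (B : 'I_2 -> 'I_2 -> 'I_2 -> C) k :
  \sum_p \sum_q gi p q * \sum_c \sum_a \sum_e Jc k c * (J p a * Jc q e) * B c a e =
  \sum_c \sum_a \sum_e Jc k c * (\sum_p \sum_q gi p q * J p a * Jc q e) * B c a e.
Proof.
rewrite !sum2.
move: (J 0 0) (J 0 1) (J 1 0) (J 1 1) (gi 0 0) (gi 0 1) (gi 1 0) (gi 1 1) => *.
move: (Jc k 0) (Jc k 1) (Jc 0 0) (Jc 0 1) (Jc 1 0) (Jc 1 1) => *.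
by move: (B 0 0 0) (B 0 0 1) (B 0 1 0) (B 0 1 1) (B 1 0 0) (B 1 0 1) (B 1 1 0) (B 1 1 1) => *; ring.
Qed.

Section Change.
Variables (U' V : set C2) (g g' : C2 -> 'M[C]_2) (T : C2 -> C2) (J : C2 -> 'M[C]_2) (z : C2).
Variables (H : 'I_2 -> 'I_2 -> 'I_2 -> C).
Hypothesis g'U : smooth_metric U' g'.
Hypotheses (oV : open V) (Vz : V z).
Hypothesis TV : forall w, V w -> U' (T w).
Hypothesis gT : forall w, V w -> forall i j, g w i j = \sum_k \sum_l
  J w i k * (J w j l)^* * g' (T w) k l.
Hypothesis g0 : \det (g z) != 0.
Hypothesis TJ : forall k, holo_at (fun w => T w 0 k) z (fun q => J z q k).
Hypothesis JH : forall i k, holo_at (fun w => J w i k) z (fun q => H q i k).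
Hypothesis H_sym : forall q i k, H q i k = H i q k.

Lemma has_dir_pullback f (v u : C2) : C1 U' f -> (forall k, has_dir (fun w => T w 0 k) v z (u 0 k)) ->
  has_dir (fun w => f (T w)) v z (grad f (T z) u).
Proof.
move=> hf hu.
have h := @chain_rule _ f U' (fun t => T (line z v t)) 0 u (sm_open g'U) hf.
rewrite line0 in h; exact: h (TV Vz) hu.
Qed.

Let Jrow q : C2 := \row_k J z q k.

Lemma grad_i f w (u : C2) : grad f w ('i *: u) = 'i * \sum_k (dz k f w * u 0 k - dzb k f w * (u 0 k)^*).
Proof.
rewrite /grad mulr_sumr; apply: eq_bigr => k _; rewrite mxE cconjM conji.
by move: (dz k f w) (dzb k f w) (u 0 k)^* (u 0 k) 'i => *; ring.
Qed.

Lemma pullback_dx f q : C1 U' f -> has_dir (fun w => f (T w)) (dx R q) z (grad f (T z) (Jrow q)).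
Proof. by move=> hf; apply: has_dir_pullback hf _ => k; rewrite mxE; exact: (TJ k q).1. Qed.

Lemma pullback_dy f q : C1 U' f -> has_dir (fun w => f (T w)) (dy R q) z (grad f (T z) ('i *: Jrow q)).
Proof. by move=> hf; apply: has_dir_pullback hf _ => k; rewrite !mxE; exact: (TJ k q).2. Qed.

Lemma pd_pullback f : C1 U' f -> pd (fun w => f (T w)) z.
Proof.
move=> hf v [q [->|->]]; first by rewrite (has_dirE (pullback_dx q hf)); exact: pullback_dx.
by rewrite (has_dirE (pullback_dy q hf)); exact: pullback_dy.
Qed.

Lemma dzb_pullback f q : C1 U' f ->
  dzb q (fun w => f (T w)) z = \sum_c (J z q c)^* * dzb c f (T z).
Proof.
move=> hf; rewrite (dzbE (pullback_dx q hf) (pullback_dy q hf)) grad_i /grad mulrA ii mulN1r.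
rewrite -sumrB mulr_sumr; apply: eq_bigr => k _; rewrite mxE.
exact: etrans (half_diff _ _) (mulrC _ _).
Qed.

Let g'C1 i j : C1 U' (fun w => g' w i j) := C1_g g'U i j.

Lemma dzb_metric_pullback q i j : dzb q (fun w => g w i j) z =
  \sum_k \sum_l (J z i k * (H q j l)^* * g' (T z) k l +
    J z i k * (J z j l)^* * \sum_c (J z q c)^* * dzb c (fun w => g' w k l) (T z)).
Proof.
have pJ i' k : pd (fun w => J w i' k) z := holo_pd (JH i' k).
have pg k l : pd (fun w => g' (T w) k l) z by exact: pd_pullback (g'C1 k l).
have pJJ k l : pd (fun w => J w i k * (J w j l)^*) z by apply: pdM; [|apply: pd_conj].
have pt k l : pd (fun w => J w i k * (J w j l)^* * g' (T w) k l) z by exact: pdM.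
rewrite (dzb_near _ (near_open oV Vz (fun w Vw => gT Vw i j))).
rewrite dzb_sum => [|k]; last by apply: pd_sum.
apply: eq_bigr => k _; rewrite (dzb_sum _ (pt k)); apply: eq_bigr => l _.
rewrite (dzbM _ (pJJ k l) (pg k l)) (dzbM _ (pJ i k) (pd_conj (pJ j l))).
rewrite (dzb_conj _ (pJ j l)) (holo_dz _ (JH j l)) (holo_dzb _ (JH i k)) mul0r add0r.
by rewrite (dzb_pullback _ (g'C1 k l)).
Qed.

Let Js : 'M[C]_2 := (map_mx Num.conj (J z))^T.

Lemma metric_pullback_mx w : V w -> g w = J w *m g' (T w) *m (map_mx Num.conj (J w))^T.
Proof.
move=> Vw; apply/matrixP => i j; rewrite gT // mxE exchange_big; apply: eq_bigr => l _.
rewrite !mxE mulr_suml; apply: eq_bigr => k _.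
by rewrite mulrAC.
Qed.

Lemma det_pullback w : V w -> \det (g w) = \det (J w) * (\det (J w))^* * \det (g' (T w)).
Proof.
move=> Vw; rewrite metric_pullback_mx // !det_mulmx det_tr det_map_mx.
by rewrite mulrAC.
Qed.

Lemma detJ_neq0 : \det (J z) != 0.
Proof. by move: g0; rewrite det_pullback // !mulf_eq0 !negb_or => /andP[/andP[]]. Qed.

Lemma ginv_pullback a e : \sum_p \sum_q ginv g z p q * J z p a * (J z q e)^* = ginv g' (T z) a e.
Proof.
have uJ : J z \in unitmx by rewrite unitmxE unitfE detJ_neq0.
have uJs : Js \in unitmx by rewrite unitmxE unitfE /Js det_tr det_map_mx fmorph_eq0 detJ_neq0.
have ug' : g' (T z) \in unitmx by rewrite unitmxE unitfE (det_neq0 g'U) //; exact: TV.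
have -> : ginv g' (T z) a e = (Js *m (invmx (g z) *m J z)) e a.
  rewrite /ginv metric_pullback_mx // -/Js; congr (fun_of_matrix _ e a).
  have ug : J z *m g' (T z) *m Js \in unitmx by rewrite !unitmx_mul uJ ug' uJs.
  have e1 : g' (T z) *m (Js *m (invmx (J z *m g' (T z) *m Js) *m J z)) = 1%:M.
    rewrite -[LHS](mulKmx uJ).
    set I := invmx (_ *m _ *m _).
    have -> : J z *m (g' (T z) *m (Js *m (I *m J z))) = J z by rewrite !mulmxA mulmxV // mul1mx.
    by rewrite mulVmx.
  by rewrite -[LHS]mulmx1 -e1 mulKmx.
rewrite mxE exchange_big; apply: eq_bigr => q _; rewrite !mxE mulr_sumr; apply: eq_bigr => p _.
by rewrite /ginv mulrC.
Qed.

(** A trace of the torsion tensor: two of its three Jacobian factors are absorbed by the inverse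
    metric, and one conjugate factor is left, as for a (0,1)-form. *)
Lemma del_adj_pullback k : del_adj g k z = \sum_c (J z k c)^* * del_adj g' c (T z).
Proof.
pose B c a e := dzb e (fun w => g' w a c) (T z) - dzb c (fun w => g' w a e) (T z).
have hB p q : dzb q (fun w => g w p k) z - dzb k (fun w => g w p q) z =
    \sum_c \sum_a \sum_e (J z k c)^* * (J z p a * (J z q e)^*) * B c a e.
  rewrite !dzb_metric_pullback.
  have hs c : (H q k c)^* = (H k q c)^* by rewrite H_sym.
  exact: (@torsion_pullback (fun i c => J z i c) (fun i c => (J z i c)^*) (fun i c => g' (T z) i c)
    (fun i j c => (H i j c)^*) (fun e a c => dzb e (fun w => g' w a c) (T z)) p q k hs).
rewrite /del_adj; under eq_bigr do under eq_bigr do rewrite hB.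
have -> : \sum_c (J z k c)^* * ('i / 2 * \sum_p \sum_q ginv g' (T z) p q *
    (dzb q (fun w => g' w p c) (T z) - dzb c (fun w => g' w p q) (T z))) =
    'i / 2 * \sum_c \sum_a \sum_e (J z k c)^* * ginv g' (T z) a e * B c a e.
  rewrite mulr_sumr; apply: eq_bigr => c _; rewrite mulrCA; congr (_ * _).
  rewrite mulr_sumr; apply: eq_bigr => a _; rewrite mulr_sumr; apply: eq_bigr => e _.
  by rewrite mulrA.
congr (_ * _); rewrite (trace_regroup (ginv g z) (J z) (fun i c => (J z i c)^*)).
apply: eq_bigr => c _; apply: eq_bigr => a _; apply: eq_bigr => e _.
by rewrite ginv_pullback.
Qed.

(** The logarithm of det g changes by that of det J plus its conjugate. The operator dbar kills the
    holomorphic part; the conjugate part gives the extra term, which expresses that det g is a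
    metric on a line bundle and not a function. *)
Lemma dlogdet_pullback (j : 'I_2 -> C) k : holo_at (fun w => \det (J w)) z j ->
  dlogdet g k z = \sum_c (J z k c)^* * dlogdet g' c (T z) + (j k)^* / (\det (J z))^*.
Proof.
move=> hj; have pj := holo_pd hj; have g'0 := det_neq0 g'U (TV Vz).
have pd' : pd (fun w => \det (g' (T w))) z by exact: pd_pullback (C1_det g'U).
rewrite /dlogdet (dzb_near _ (near_open oV Vz det_pullback)).
rewrite (dzbM _ (pdM pj (pd_conj pj)) pd') (dzbM _ pj (pd_conj pj)) (dzb_conj _ pj) (holo_dz _ hj) (holo_dzb _ hj) mul0r add0r.
rewrite (dzb_pullback _ (C1_det g'U)).
have dJ := detJ_neq0; have dJ' : (\det (J z))^* != 0 by rewrite fmorph_eq0.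
have -> : \sum_c (J z k c)^* * (dzb c (fun w => \det (g' w)) (T z) / \det (g' (T z))) =
   (\sum_c (J z k c)^* * dzb c (fun w => \det (g' w)) (T z)) / \det (g' (T z)).
  by rewrite mulr_suml; apply: eq_bigr => c _; rewrite mulrA.
rewrite det_pullback //; move: (\sum_c _) => s.
move: (\det (J z)) (\det (J z))^* (\det (g' (T z))) (j k)^* dJ dJ' g'0 => a b c d a0 b0 c0.
by field; rewrite ?a0 ?b0 ?c0.
Qed.

End Change.

End Covariance.

(** * The lifted quotient map *)

Section Developing.
Variable R : realType.
Local Notation C := (Cplx R).
Local Notation C2 := (C2 R).
Variables (a1 a2 : C).
Hypotheses (ha1 : 0 < cabs a1) (ha2 : 0 < cabs a2) (ha2' : cabs a2 < 1).
Implicit Types (z w : C2) (K : seq R) (V : set C2).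

Definition act (n : int) z : C2 := vec2 (a1 ^ n * z 0 0) (a2 ^ n * z 0 1).

(* Constant on the orbits of the group and on the leaves
   zeta |-> (c e^{ln|a1| zeta}, e^{ln|a2| zeta}). *)
Definition kappa z : R := ln (cabs a2) * ln (cabs (z 0 0)) - ln (cabs a1) * ln (cabs (z 0 1)).

(** Whole level sets of [kappa] are removed instead of orbits, so that the set is invariant under
    the group and remains a union of leaves. *)
Definition Omega K : set C2 := [set z : C2 | [/\ z 0 0 != 0, z 0 1 != 0 & kappa z \notin K]].

Lemma cabsX (a : C) (n : nat) : cabs (a ^+ n) = cabs a ^+ n.
Proof.
elim: n => [|n IH]; last by rewrite !exprS cabsM IH.
by rewrite !expr0 -ofR1 cabs_ofR normr1.
Qed.

Lemma cabsXz (a : C) (n : int) : cabs (a ^ n) = cabs a ^ n.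
Proof. by case: n => n; rewrite ?NegzE -?exprnN ?cabsV cabsX. Qed.

Lemma ln_cabsXz (a : C) (n : int) : 0 < cabs a -> ln (cabs a ^ n) = n%:~R * ln (cabs a).
Proof.
move=> a0; case: n => n; first by rewrite lnXn // mulr_natl.
rewrite NegzE -exprnN lnV ?posrE ?exprn_gt0 // lnXn // -mulr_natl.
by rewrite mulrNz mulNr.
Qed.

Lemma a1_neq0 : a1 != 0. Proof. by rewrite -cabs_gt0. Qed.
Lemma a2_neq0 : a2 != 0. Proof. by rewrite -cabs_gt0. Qed.

Lemma kappa_act n z : z 0 0 != 0 -> z 0 1 != 0 -> kappa (act n z) = kappa z.
Proof.
rewrite -!cabs_gt0 => z0 z1; rewrite /kappa /act vec2_0 vec2_1 !cabsM !cabsXz.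
rewrite !lnM ?posrE ?exprz_gt0 // !ln_cabsXz //.
by move: (n%:~R : R) => m; ring.
Qed.

Lemma Omega_act K n z : Omega K z -> Omega K (act n z).
Proof.
move=> [z0 z1 zK]; split; rewrite ?kappa_act // /act ?vec2_0 ?vec2_1 mulf_neq0 //.
  by rewrite expfz_neq0 // a1_neq0.
by rewrite expfz_neq0 // a2_neq0.
Qed.

Lemma kappa_cont z : z 0 0 != 0 -> z 0 1 != 0 -> {for z, continuous kappa}.
Proof.
have h k : z 0 k != 0 -> {for z, continuous (fun w : C2 => ln (cabs (w 0 k)))}.
  rewrite -cabs_gt0 => zk.
  apply: (@continuous_comp _ _ _ (fun w : C2 => cabs (w 0 k)) (@ln R)).
    by apply: continuous_cabs_comp; exact: continuous_coord.
  exact: continuous_ln.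
by move=> z0 z1; apply: continuous_lincomb; [exact: h z0|exact: h z1].
Qed.

Lemma open_Omega K : open (Omega K).
Proof.
rewrite openE => z [z0 z1 zK].
have n0 : \forall w \near z, (w : C2) 0 0 != 0 := @nonzero_near _ _ (fun w : C2 => w 0 0) z (@continuous_coord _ 0 z) z0.
have n1 : \forall w \near z, (w : C2) 0 1 != 0 := @nonzero_near _ _ (fun w : C2 => w 0 1) z (@continuous_coord _ 1 z) z1.
have nK : \forall w \near z, kappa w \notin K.
  elim: K zK => [|r K IH] zK; first by apply: filterE.
  move: zK; rewrite in_cons negb_or => /andP[zr zK].
  have nr : \forall w \near z, kappa w != r.
    apply: (@kappa_cont z z0 z1 [set t | t != r]); apply/nbhs_ballP; exists `|kappa z - r|; first by rewrite /= normr_gt0 subr_eq0.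
    by move=> t; rewrite /ball /= => h; apply: contraTneq h => ->; rewrite -leNgt.
  by apply: filterS (filterI nr (IH zK)) => w [wr wK]; rewrite in_cons negb_or wr.
by apply: filterS (filterI n0 (filterI n1 nK)) => w [? []].
Qed.

Definition act_free V := forall z w (n : int), V z -> V w -> w = act n z -> z = w.

(* [Phi] is the quotient map C^2 \ {0} -> H lifted through the blow-ups; [K]
   contains the values of [kappa] at the blown-up points. *)
Record developing (X : complex_surface R) K (Phi : C2 -> X) : Prop := Developing {
  dev_act : forall z, Omega K z -> Phi (act 1 z) = Phi z;
  dev_kappa : forall z w, Omega K z -> Omega K w -> Phi z = Phi w -> kappa z = kappa w;
  dev_chart : forall V, open V -> V `<=` Omega K -> act_free V ->
    exists c : chart R X, [/\ atlas c, cod c = V & forall z, V z -> param c z = Phi z] }.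

Lemma Omega_neq0 K z : Omega K z -> z != 0.
Proof. by case=> z0 _ _; apply: contraNneq z0 => ->; rewrite mxE. Qed.

Lemma developing_hopf (H : complex_surface R) (pi : C2 -> H) :
  is_hopf_quotient a1 a2 pi -> developing [::] pi.
Proof.
move=> [_ hpi hch]; split.
- move=> z Oz; have Oz' := Omega_act 1 Oz.
  by apply/esym/hpi; rewrite ?(Omega_neq0 Oz) ?(Omega_neq0 Oz') //; exists 1.
- move=> z w Oz Ow /hpi; rewrite (Omega_neq0 Oz) (Omega_neq0 Ow) => /(_ isT isT)[n ->].
  by case: Oz => z0 z1 _; rewrite -/(act n z) kappa_act.
- move=> V oV VO fV; have [|z w Vz Vw e|c [h1 h2 _ h4]] := hch V oV.
  + by move=> /VO/Omega_neq0; rewrite eqxx.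
  + have /hpi := e; rewrite (Omega_neq0 (VO _ Vz)) (Omega_neq0 (VO _ Vw)) => /(_ isT isT)[n en].
    exact: (fV z w n).
  + by exists c.
Qed.

(** By [dev_kappa] all preimages of the blown-up point lie on one level of [kappa], so removing at
    most one more value makes [Phi] avoid that point; the inverse of the blow-down then lifts it. If
    the point has no preimage, nothing is removed. *)
Lemma developing_blowup (Y Z : complex_surface R) K (Phi : C2 -> Y) :
  developing K Phi -> is_blowup Y Z -> exists K' (Phi' : C2 -> Z), developing K' Phi'.
Proof.
move=> dY [x [pi [[oA oB hpi [h [hh hA hB]]] _]]].
have [K' [KK' hK']] : exists K', Omega K' `<=` Omega K /\ forall z, Omega K' z -> Phi z <> x.
  have [[z0 [Oz0 e]]|no] := pselect (exists z0, Omega K z0 /\ Phi z0 = x).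
    exists (kappa z0 :: K); split.
      by move=> z [? ?]; rewrite in_cons negb_or => /andP[_ ?].
    move=> z [h0 h1]; rewrite in_cons negb_or => /andP[/eqP ne zK] ez; apply: ne.
    by apply: (dev_kappa dY) => //; rewrite ez.
  by exists K; split=> // z Oz e; apply: no; exists z.
exists K', (fun z => h (Phi z)); split.
- by move=> z Oz; rewrite (dev_act dY) //; exact: KK'.
- move=> z w Oz Ow e; apply: (dev_kappa dY); try exact: KK'.
  by rewrite -(hB _ (hK' z Oz)).2 e (hB _ (hK' w Ow)).2.
move=> V oV VO fV.
have [c [ac cV pc]] := dev_chart dY oV (subset_trans VO KK') fV.
have [odc _ c3 c4] := atlas_chart ac.
have pne z : V z -> param c z <> x by move=> Vz; rewrite pc //; exact: hK' (VO _ Vz).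
(* The chart [c] transported through the biholomorphism; it belongs to the atlas of [Z] because that
   atlas is maximal. *)
pose c' : chart R Z := Chart [set t | pi t <> x /\ dom c (pi t)] V
  (fun t => coord c (pi t)) (fun z => h (param c z)).
exists c'; split=> //; last by move=> z Vz; rewrite /= pc.
apply: atlas_maximal.
  split=> /=.
  - rewrite openE => t [tA tc].
    have n1 : \forall s \near t, pi s <> x by apply: open_nbhs_nbhs; split.
    have n2 : \forall s \near t, dom c (pi s).
      by apply: (hpi.1 t tA); apply: open_nbhs_nbhs; split.
    exact: filterI n1 n2.
  - exact: oV.
  - move=> t [tA tc]; have [h1 h2 h3] := c3 _ tc; split.
    + by rewrite -cV.
    + by rewrite h2 (hA _ tA).2.
    + apply: (@continuous_comp _ _ _ pi (coord c)); [exact: hpi.1 t tA|exact: h3].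
  - move=> z Vz; have Vz' := Vz; rewrite -cV in Vz'; have [h1 h2 h3] := c4 _ Vz'.
    have [e1 e2] := hB _ (pne z Vz); split.
    + by split; rewrite e2 //; exact: pne.
    + by rewrite e2.
    + apply: (@continuous_comp _ _ _ (param c) h); [exact: h3|exact: hh.1 _ (pne z Vz)].
move=> d ad; split.
  have := hh.2 c d ac ad; rewrite /transition /=; congr (holomorphic _ _).
  apply/seteqP; split=> z /=; first by case; rewrite cV => Vz _ dz; split.
  by case=> Vz dz; split=> //; [rewrite cV|exact: pne].
have := hpi.2 d c ad ac; rewrite /transition /=; congr (holomorphic _ _).
by apply/seteqP; split=> z /=; [case=> ? ? ?; split|case=> ? [? ?]; split].
Qed.

Lemma developing_blown_up (H M : complex_surface R) p : is_hopf_surface a1 a2 H ->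
  blown_up H p M -> exists K (Phi : C2 -> M), developing K Phi.
Proof.
move=> [pi hpi]; elim=> [|q Y Z _ [K [Phi dY]] hb]; last exact: developing_blowup dY hb.
by exists [::], pi; exact: developing_hopf.
Qed.

Lemma developing_local (X : complex_surface R) K (Phi : C2 -> X) z : developing K Phi -> Omega K z ->
  exists c : chart R X, [/\ atlas c, cod c z, cod c `<=` Omega K &
    forall w, cod c w -> param c w = Phi w].
Proof.
move=> dX Oz; set r := cabs a2; set m := cabs (z 0 1).
have m0 : 0 < m by case: Oz => _ h _; rewrite cabs_gt0.
(* The annulus of radii m sqrt(r) and m / sqrt(r) in the second coordinate, written with squares.
   The radii have ratio 1/r, so no nontrivial power of [a2] maps a point of the open annulus into
   it. *)
pose V : set C2 := [set w | Omega K w /\ (r * (m * m) < cabs (w 0 1) * cabs (w 0 1) /\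
   r * (cabs (w 0 1) * cabs (w 0 1)) < m * m)].
have c1 w : {for w, continuous (fun w : C2 => cabs (w 0 1))}.
  by apply: continuous_cabs_comp; exact: continuous_coord.
have c2 w : {for w, continuous (fun w : C2 => cabs (w 0 1) * cabs (w 0 1))}.
  exact: continuous_rM (c1 w) (c1 w).
have oV : open V.
  rewrite openE => w [Ow [h1 h2]].
  have n0 : \forall w' \near w, Omega K w' by apply: open_nbhs_nbhs; split => //; exact: open_Omega.
  pose q (w' : C2) := cabs (w' 0 1) * cabs (w' 0 1).
  have n1 : \forall w' \near w, r * (m * m) < q w'.
    apply: (c2 w [set t | r * (m * m) < t]); apply: open_nbhs_nbhs; split => //; exact: open_gt.
  have n2 : \forall w' \near w, q w' < (m * m) / r.
    apply: (c2 w [set t | t < (m * m) / r]); apply: open_nbhs_nbhs; split; first exact: open_lt.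
    by rewrite /= /q ltr_pdivlMr // mulrC.
  apply: filterS (filterI n0 (filterI n1 n2)) => w' [? [? h]]; split=> //; split=> //.
  by rewrite mulrC -ltr_pdivlMr.
have VO : V `<=` Omega K by move=> w [].
(* Positive exponents suffice: a negative one exchanges the roles of the two points. *)
have free_nat (n : nat) w w' : V w -> V w' -> w' 0 1 = a2 ^+ n.+1 * w 0 1 -> False.
  move=> [_ [w1 w2]] [_ [w1' w2']] e.
  move: w1'; rewrite e cabsM cabsX -/r; set t := cabs (w 0 1) in w1 w2 *.
  apply/negP; rewrite -leNgt; apply: le_trans (_ : r * (r * (t * t)) <= _); last first.
    by rewrite ler_pM2l // ltW.
  have rn : r ^+ n.+1 <= r by rewrite exprS ger_pMr // exprn_ile1 // ltW.
  have rn0 : 0 <= r ^+ n.+1 by rewrite exprn_ge0 // ltW.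
  have t0 : 0 <= t * t by rewrite mulr_ge0 ?cabs_ge0.
  rewrite (_ : _ * _ = (r ^+ n.+1 * r ^+ n.+1) * (t * t)); last by ring.
  rewrite (_ : r * (r * (t * t)) = (r * r) * (t * t)); last by ring.
  by rewrite ler_wpM2r // ler_pM.
have fV : act_free V.
  move=> w w' [n|n] Vw Vw' e.
    case: n e => [|n] e; first by rewrite e /act !expr0z !mul1r vec2E.
    by exfalso; apply: (free_nat n w w') => //; rewrite e vec2_1.
  exfalso; apply: (free_nat n w' w) => //; rewrite e vec2_1 NegzE -exprnN mulrA mulfV ?mul1r //.
  by rewrite expf_neq0 // a2_neq0.
have [c [ac cV pc]] := dev_chart dX oV VO fV.
exists c; split=> //; rewrite cV //.
have mm : 0 < m * m by rewrite mulr_gt0.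
by split=> //; split; rewrite -/m gtr_pMl.
Qed.

End Developing.

(** * Locality of smoothness and of the static equation *)

Section Locality.
Variable R : realType.
Local Notation C := (Cplx R).
Local Notation C2 := (C2 R).
Implicit Types (f : C2 -> C) (U V : set C2) (z w : C2).

Lemma Cn_local n U f :
  (forall z, U z -> exists V f', [/\ open V, V z, Cn n V f' & forall w, V w -> f' w = f w]) ->
  Cn n U f.
Proof.
elim: n U f => [|n IH] U f h.
  split; last by [].
  move=> z Uz; have [V [f' [oV Vz [cf' _] e]]] := h z Uz.
  exact: near_continuous (near_open oV Vz e) (cf' z Vz).
split.
  move=> z Uz; have [V [f' [oV Vz [cf' _] e]]] := h z Uz.
  exact: near_continuous (near_open oV Vz e) (cf' z Vz).
move=> i v hv; split.
  move=> z Uz; have [V [f' [oV Vz [_ df'] e]]] := h z Uz.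
  have h' := dir_derivableP ((df' i v hv).1 z Vz).
  exact: has_dir_derivable (has_dir_near (near_open oV Vz e) h').
apply: IH => z Uz; have [V [f' [oV Vz [_ df'] e]]] := h z Uz.
exists V, (dirD f' v); split=> //; first exact: (df' i v hv).2.
by move=> w Vw; apply: dirD_near; exact: near_open oV Vw e.
Qed.

Lemma static_local (g g' : C2 -> 'M[C]_2) lambda V z : open V -> V z ->
  (forall w, V w -> g w = g' w) -> static_on g lambda V -> forall i j,
  - del01 (del_adj g') i j z - dbar10 (dbar_adj g') i j z - 'i / 2 * deldbar0 (logdet g') i j z =
  ofR lambda * kahler g' i j z.
Proof.
move=> oV Vz e st i j.
have ne w : V w -> \forall w' \near w, g w' = g' w' by move=> Vw; exact: near_open oV Vw e.
have ez w i' j' k : V w -> dz k (fun w => g w i' j') w = dz k (fun w => g' w i' j') w.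
  by move=> Vw; apply: dz_near; apply: filterS (ne w Vw) => w' ->.
have ezb w i' j' k : V w -> dzb k (fun w => g w i' j') w = dzb k (fun w => g' w i' j') w.
  by move=> Vw; apply: dzb_near; apply: filterS (ne w Vw) => w' ->.
have edel k w : V w -> del_adj g k w = del_adj g' k w.
  move=> Vw; rewrite /del_adj; congr (_ * _); apply: eq_bigr => p _; apply: eq_bigr => q _.
  by rewrite /ginv (e w Vw) (ezb w p k q Vw) (ezb w p q k Vw).
have edbar k w : V w -> dbar_adj g k w = dbar_adj g' k w.
  move=> Vw; rewrite /dbar_adj; congr (_ * _); apply: eq_bigr => p _; apply: eq_bigr => q _.
  by rewrite /ginv (e w Vw) (ez w p q k Vw) (ez w k q p Vw).
have elog w : V w -> dzb j (logdet g) w = dzb j (logdet g') w.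
  by move=> Vw; apply: dzb_near; apply: filterS (ne w Vw) => w' h; rewrite /logdet h.
have := st z Vz i j.
rewrite /del01 /dbar10 /deldbar0 /kahler (e z Vz) => <-.
have e1 : dz i (del_adj g j) z = dz i (del_adj g' j) z.
  by apply: dz_near; exact: near_open oV Vz (edel j).
have e2 : dzb j (dbar_adj g i) z = dzb j (dbar_adj g' i) z.
  by apply: dzb_near; exact: near_open oV Vz (edbar i).
have e3 : dz i (dzb j (logdet g)) z = dz i (dzb j (logdet g')) z.
  by apply: dz_near; exact: near_open oV Vz elog.
have eq3 (a b c a' b' c' k : C) : a = a' -> b = b' -> c = c' ->
  - a' - - b' - k * c' = - a - - b - k * c by move=> -> -> ->.
exact: eq3 e1 e2 e3.
Qed.

End Locality.

(** * The metric lifted to an open subset of C^2 *)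

Section DevelopedMetric.
Variable R : realType.
Local Notation C := (Cplx R).
Local Notation C2 := (C2 R).
Variables (a1 a2 : C).
Hypotheses (ha1 : 0 < cabs a1) (ha2 : 0 < cabs a2) (ha2' : cabs a2 < 1).
Variables (X : complex_surface R) (K : seq R) (Phi : C2 -> X).
Hypothesis dX : developing a1 a2 K Phi.
Variable g : metric X.
Hypothesis hg : hermitian_metric g.
Implicit Types (z w : C2) (c : chart R X).

Local Notation Om := (Omega a1 a2 K).

Definition dev_chart_on c := [/\ atlas c, cod c `<=` Om & forall w, cod c w -> param c w = Phi w].

Lemma smooth_metric_chart c : atlas c -> smooth_metric (cod c) (g c).
Proof.
move=> ac; case: hg => h1 h2 h3 _; case: (atlas_chart ac) => _ oc _ _; split.
- exact: oc.
- by move=> i j; exact: h1 c ac i j 2.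
- exact: h2 c ac.
- exact: h3 c ac.
Qed.

Definition scale2 (mu : 'I_2 -> C) z : C2 := \row_k (mu k * z 0 k).

Lemma continuous_scale2 mu : continuous (scale2 mu).
Proof.
move=> z; apply: continuous_C2 => k.
apply: (@continuous_ext _ _ (fun w : C2 => mu k * w 0 k)) => [w|]; first by rewrite mxE.
by apply: continuous_cM; [exact: continuous_at_cst|exact: continuous_coord].
Qed.

(** Used twice: with [mu] equal to 1 it shows that the lifted metric does not depend on the chart,
    and with the multipliers of the group it gives equivariance. *)
Lemma metric_scale2 c c' mu z : dev_chart_on c -> dev_chart_on c' -> cod c z -> cod c' (scale2 mu z) ->
  (forall w, Om w -> Phi (scale2 mu w) = Phi w) ->
  forall i j, g c z i j = mu i * (mu j)^* * g c' (scale2 mu z) i j.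
Proof.
move=> [ac cO pc] [ac' cO' pc'] cz cz' hmu i j.
have [_ oc _ _] := atlas_chart ac; have [_ oc' _ h4] := atlas_chart ac'.
have e w : cod c w -> cod c' (scale2 mu w) -> param c w = param c' (scale2 mu w).
  by move=> cw cw'; rewrite pc // pc' // hmu //; exact: cO.
have et w : cod c w -> cod c' (scale2 mu w) -> transition c c' w = scale2 mu w.
  by move=> cw cw'; rewrite /transition e //; have [_ ->] := h4 _ cw'.
have nt : \forall w \near z, transition c c' w = scale2 mu w.
  have n1 : \forall w \near z, cod c w by apply: open_nbhs_nbhs.
  have n2 : \forall w \near z, cod c' (scale2 mu w).
    by apply: (@continuous_scale2 mu z); apply: open_nbhs_nbhs.
  by apply: filterS (filterI n1 n2) => w [? ?]; exact: et.
have ov : overlap c c' z.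
  by split=> //; rewrite e //; have [] := h4 _ cz'.
case: hg => _ _ _ /(_ c c' ac ac' z ov i j) ->; rewrite et //.
have dT p k : dz p (fun w => transition c c' w 0 k) z = mu k * (k == p)%:R.
  have -> : dz p (fun w => transition c c' w 0 k) z = dz p (fun w : C2 => mu k * w 0 k) z.
    by apply: dz_near; apply: filterS nt => w ->; rewrite mxE.
  by rewrite (holo_dz _ (holoM (holo_cst _ _) (holo_coord _ _))) mul0r add0r.
rewrite (bigD1 i) //= [X in _ + X]big1 ?addr0; last first.
  by move=> k ki; rewrite big1 // => l _; rewrite !dT (negbTE ki) mulr0 !mul0r.
rewrite (bigD1 j) //= [X in _ + X]big1 ?addr0; last first.
  by move=> l lj; rewrite !dT (negbTE lj) mulr0 conjC0 mulr0 mul0r.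
by rewrite !dT !eqxx !mulr1.
Qed.

Lemma scale2_1 z : scale2 (fun=> 1) z = z.
Proof. by apply/rowP => k; rewrite mxE mul1r. Qed.

Lemma dev_chart_at z : Om z -> exists c, dev_chart_on c /\ cod c z.
Proof.
move=> Oz; have [c [h1 h2 h3 h4]] := developing_local ha2 ha2' dX Oz.
by exists c.
Qed.

(** The pull-back of [g] by [Phi], read in a chosen chart at each point; [dev_metricE] removes the
    choice. *)
Definition dev_metric z : 'M[C]_2 :=
  if pselect (Om z) is left h then g (projT1 (cid (dev_chart_at h))) z else 0.

Lemma dev_metricE c z : dev_chart_on c -> cod c z -> dev_metric z = g c z.
Proof.
move=> hc cz; have Oz : Om z by case: hc => _ + _; apply.
rewrite /dev_metric; case: pselect => // h; case: cid => c' [hc' cz'] /=.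
have hid w : Om w -> Phi (scale2 (fun=> 1) w) = Phi w by rewrite scale2_1.
apply/matrixP => i j; rewrite (metric_scale2 hc' hc cz' _ hid) ?scale2_1 //.
by rewrite conjC1 !mul1r.
Qed.

Lemma smooth_dev_metric : smooth_metric Om dev_metric.
Proof.
split; first exact: open_Omega.
- move=> i j; apply: Cn_local => z Oz; have [c [hc cz]] := dev_chart_at Oz.
  have sc := smooth_metric_chart (let: And3 a _ _ := hc in a).
  exists (cod c), (fun w => g c w i j); split; [exact: sm_open sc|exact: cz|exact: sm_C2 sc i j|].
  by move=> w cw; rewrite (dev_metricE hc cw).
- move=> z Oz i j; have [c [hc cz]] := dev_chart_at Oz.
  have sc := smooth_metric_chart (let: And3 a _ _ := hc in a).
  by rewrite (dev_metricE hc cz); exact: sm_herm sc z cz i j.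
- move=> z Oz v v0; have [c [hc cz]] := dev_chart_at Oz.
  have sc := smooth_metric_chart (let: And3 a _ _ := hc in a).
  by rewrite (dev_metricE hc cz); exact: sm_pos sc z cz v v0.
Qed.

Lemma static_dev_metric lambda : (forall c, atlas c -> static_on (g c) lambda (cod c)) ->
  static_on dev_metric lambda Om.
Proof.
move=> st z Oz i j; have [c [hc cz]] := dev_chart_at Oz.
have ac : atlas c by case: hc.
have sc := smooth_metric_chart ac.
apply: (static_local (sm_open sc) cz _ (st c ac)) => w cw.
by rewrite (dev_metricE hc cw).
Qed.

Definition multipliers : 'I_2 -> C := fun k => if k == 0 then a1 else a2.

Lemma act_scale2 z : act a1 a2 1 z = scale2 multipliers z.
Proof.
apply/rowP => k; rewrite /act !mxE /multipliers.
by have [->|->] := ord2 k.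
Qed.

Lemma dev_metric_act z i j : Om z ->
  dev_metric z i j = multipliers i * (multipliers j)^* * dev_metric (scale2 multipliers z) i j.
Proof.
move=> Oz; have Oz' : Om (scale2 multipliers z) by rewrite -act_scale2; exact: Omega_act.
have [c [hc cz]] := dev_chart_at Oz; have [c' [hc' cz']] := dev_chart_at Oz'.
rewrite (dev_metricE hc cz) (dev_metricE hc' cz'); apply: (metric_scale2 hc hc' cz cz') => w Ow.
by rewrite -act_scale2 (dev_act dX).
Qed.

Let J (w : C2) : 'M[C]_2 := diag_mx (\row_k multipliers k).

Lemma dev_metric_J w : Om w -> forall i j, dev_metric w i j = \sum_k \sum_l
  J w i k * (J w j l)^* * dev_metric (scale2 multipliers w) k l.
Proof.
move=> Ow i j; rewrite dev_metric_act // (bigD1 i) //= [X in _ + X]big1 ?addr0; last first.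
  by move=> k ki; rewrite big1 // => l _; rewrite !mxE eq_sym (negbTE ki) mulr0n !mul0r.
rewrite (bigD1 j) //= [X in _ + X]big1 ?addr0; last first.
  by move=> l lj; rewrite !mxE (eq_sym j) (negbTE lj) mulr0n conjC0 mulr0 mul0r.
by rewrite !mxE !eqxx !mulr1n.
Qed.

Lemma dev_act_Om w : Om w -> Om (scale2 multipliers w).
Proof. by move=> Ow; rewrite -act_scale2; exact: Omega_act. Qed.

Lemma holo_scale2 z k : holo_at (fun w => scale2 multipliers w 0 k) z (fun q => J z q k).
Proof.
have e : \forall w \near z, multipliers k * (w : C2) 0 k = scale2 multipliers w 0 k.
  by apply: filterE => w; rewrite mxE.
have := holo_near e (holoM (holo_cst (multipliers k) z) (holo_coord k z)).
congr (holo_at _ _ _); apply/funext => q; rewrite mul0r add0r !mxE (eq_sym q).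
by case: eqP => [->|_]; rewrite ?mulr1 ?mulr1n // mulr0 mulr0n.
Qed.

Let sm := smooth_dev_metric.

Lemma sum_J (F : 'I_2 -> C) (z : C2) k : \sum_c (J z k c)^* * F c = (multipliers k)^* * F k.
Proof.
rewrite (bigD1 k) //= big1 ?addr0; first by rewrite !mxE eqxx mulr1n.
by move=> c ck; rewrite !mxE eq_sym (negbTE ck) mulr0n conjC0 mul0r.
Qed.

Lemma del_adj_act z k : Om z ->
  del_adj dev_metric k z = (multipliers k)^* * del_adj dev_metric k (scale2 multipliers z).
Proof.
move=> Oz.
rewrite (@del_adj_pullback _ Om Om dev_metric dev_metric (scale2 multipliers) J z
  (fun _ _ _ => 0) sm (sm_open sm) Oz dev_act_Om dev_metric_J (det_neq0 sm Oz)
  (holo_scale2 z) (fun i k => holo_cst _ z) (fun _ _ _ => erefl)).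
exact: sum_J.
Qed.

(** The Jacobian of the group action is constant, so the extra term of [dlogdet_pullback]
    vanishes. *)
Lemma dlogdet_act z k : Om z ->
  dlogdet dev_metric k z = (multipliers k)^* * dlogdet dev_metric k (scale2 multipliers z).
Proof.
move=> Oz.
rewrite (@dlogdet_pullback _ Om Om dev_metric dev_metric (scale2 multipliers) J z
  sm (sm_open sm) Oz dev_act_Om dev_metric_J (det_neq0 sm Oz)
  (holo_scale2 z) (fun=> 0) k (holo_cst (\det (J z)) z)).
by rewrite conjC0 mul0r addr0; exact: sum_J.
Qed.

End DevelopedMetric.

(** * The leaves *)

Section Compactness.
Variable R : realType.
Local Notation C := (Cplx R).
Local Notation C2 := (C2 R).

Definition circle : set (R * R) := [set p | p.1 * p.1 + p.2 * p.2 = 1].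

Lemma compact_circle : compact circle.
Proof.
apply: (@subclosed_compact _ _ (`[-1, 1]%classic `*` `[-1, 1]%classic : set (R * R))).
- have -> : circle = (fun p : R * R => p.1 * p.1 + p.2 * p.2) @^-1` [set 1] by [].
  apply: closed_comp; last exact: closed_eq.
  move=> p _; have h : {for p, continuous (fun p : R * R => p.1 * p.1 + p.2 * p.2)}.
    by apply: continuous_rD; apply: continuous_rM; (exact: continuous_fst_at || exact: continuous_snd_at).
  exact: h.
- by apply: compact_setX; exact: segment_compact.
- move=> p e; have h : p.1 * p.1 + p.2 * p.2 = 1 := e.
  have := sqr_ge0 p.1; have := sqr_ge0 p.2; rewrite !expr2 => h1 h2.
  by split; rewrite /= in_itv /=; apply/andP; split; nra.
Qed.

Definition unitC (p : R * R) : C := ofR p.1 + 'i * ofR p.2.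

Lemma continuous_unitC (T : topologicalType) (f : T -> R * R) x : {for x, continuous f} ->
  {for x, continuous (fun y => unitC (f y))}.
Proof.
move=> cf; apply: continuous_cD.
  apply: continuous_ofR_comp; apply: (@continuous_comp _ _ _ f fst); first exact: cf.
  exact: continuous_fst_at.
apply: continuous_cM; first exact: continuous_at_cst.
apply: continuous_ofR_comp; apply: (@continuous_comp _ _ _ f snd); first exact: cf.
exact: continuous_snd_at.
Qed.

Lemma polar (w : C) : w != 0 -> exists2 p, circle p & w = ofR (cabs w) * unitC p.
Proof.
rewrite -cabs_gt0 => w0; exists (cRe w / cabs w, cIm w / cabs w).
  rewrite /circle /=; have := cabs_sq w; move: w0; move: (cabs w) (cRe w) (cIm w) => r x y r0 e.
  have r1 : r != 0 by rewrite gt_eqF.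
  transitivity ((x ^+ 2 + y ^+ 2) / r ^+ 2); first by field.
  by rewrite -e divff // expf_neq0.
rewrite /unitC /= !ofRM ofRV {1}(cE w).
have : ofR (cabs w) != 0 :> C by rewrite -cabsE normr_eq0 -cabs_gt0.
by move: (ofR (cabs w)) (ofR (cRe w)) (ofR (cIm w)) => r x y r0; field.
Qed.

Lemma cabs_unitC p : circle p -> cabs (unitC p) = 1.
Proof.
move=> e; rewrite cabs_sqrt /unitC !(cReD, cImD, cReM, cImM, cRe_ofR, cIm_ofR, cRei, cImi).
by rewrite !(mul0r, mulr0, subr0, addr0, add0r, mul1r) !expr2 (e : _ = 1) sqrtr1.
Qed.

Lemma notin_seq (K : seq R) : exists r, r \notin K.
Proof.
exists (1 + \sum_(s <- K) `|s|); apply/negP => h.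
have : forall r, r \in K -> r <= \sum_(s <- K) `|s|.
  elim: K {h} => // s K IH r; rewrite in_cons big_cons => /orP[/eqP ->|/IH h].
    by rewrite (le_trans (ler_norm s)) // lerDl sumr_ge0.
  by rewrite (le_trans h) // lerDr.
by move=> /(_ _ h); rewrite gerDr leNgt ltr01.
Qed.

End Compactness.

Section Leaves.
Variable R : realType.
Local Notation C := (Cplx R).
Local Notation C2 := (C2 R).
Variables (a1 a2 : C).
Hypotheses (ha1 : 0 < cabs a1) (ha2 : 0 < cabs a2) (ha2' : cabs a2 < 1).
Implicit Types (z w : C2) (i j k : 'I_2) (x y : R).

Let b := ln (cabs a1).
Let a := ln (cabs a2).

Lemma a_lt0 : a < 0. Proof. by rewrite /a ln_lt0 // ha2. Qed.
Section Bounded.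
Variables (K : seq R) (k0 : R).
Hypothesis k0K : a * k0 \notin K.
Local Notation Om := (Omega a1 a2 K).

(** Parametrizes the level [kappa = a * k0] by a time and two arguments. The generator of the group
    adds 1 to the time, so the compact set of times in [0, 1] meets every orbit. *)
Definition torus_point (t : R * ((R * R) * (R * R))) : C2 :=
  vec2 (ofR (expR (k0 + b * t.1)) * unitC t.2.1) (ofR (expR (a * t.1)) * unitC t.2.2).

Lemma continuous_torus_point : continuous torus_point.
Proof.
move=> t; have c1 : {for t, continuous (fun t : R * ((R * R) * (R * R)) => t.1)} by exact: continuous_fst_at.
have c2 : {for t, continuous (fun t : R * ((R * R) * (R * R)) => t.2)} by exact: continuous_snd_at.
have cl (c d : R) : {for t, continuous (fun t : R * ((R * R) * (R * R)) => d + c * t.1)}.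
  apply: continuous_rD; first exact: continuous_at_cst.
  by apply: continuous_rM; [exact: continuous_at_cst|exact: c1].
suff h : {for t, continuous (fun t : R * ((R * R) * (R * R)) =>
    vec2 (ofR (expR (k0 + b * t.1)) * unitC t.2.1) (ofR (expR (a * t.1)) * unitC t.2.2) : C2)} by exact: h.
apply: continuous_vec2; apply: continuous_cM.
- by apply: continuous_ofR_comp; apply: continuous_expR_comp; exact: cl.
- apply: continuous_unitC; apply: (@continuous_comp _ _ _ (fun t : R * ((R * R) * (R * R)) => t.2) fst).
    exact: c2.
  exact: continuous_fst_at.
- apply: continuous_ofR_comp; apply: continuous_expR_comp.
  by apply: continuous_ext (cl a 0) => s; rewrite add0r.
- apply: continuous_unitC; apply: (@continuous_comp _ _ _ (fun t : R * ((R * R) * (R * R)) => t.2) snd).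
    exact: c2.
  exact: continuous_snd_at.
Qed.

Lemma ofR_neq0 (r : R) : r != 0 -> ofR r != 0 :> C.
Proof. by rewrite -cabs_gt0 cabs_ofR normr_gt0. Qed.

Lemma unitC_neq0 (p : R * R) : circle p -> unitC p != 0.
Proof. by move=> hp; rewrite -cabs_gt0 cabs_unitC. Qed.

Lemma Omega_torus_point t : circle t.2.1 -> circle t.2.2 -> Om (torus_point t).
Proof.
move=> h1 h2; have e0 (r : R) : expR r != 0 by rewrite gt_eqF // expR_gt0.
split; rewrite ?vec2_0 ?vec2_1 ?mulf_neq0 ?ofR_neq0 ?unitC_neq0 //.
rewrite /kappa /torus_point vec2_0 vec2_1 !cabsM !cabs_ofR !cabs_unitC // !mulr1.
rewrite !ger0_norm ?expR_ge0 // !expRK -/a -/b.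
by have -> : a * (k0 + b * t.1) - b * (a * t.1) = a * k0 by ring.
Qed.

Lemma act_invariant (F : C2 -> R) : (forall z, Om z -> F (act a1 a2 1 z) = F z) ->
  forall n z, Om z -> F (act a1 a2 n z) = F z.
Proof.
move=> hF.
have a1n : a1 != 0 by rewrite -cabs_gt0. have a2n : a2 != 0 by rewrite -cabs_gt0.
have actS (m n : int) z : act a1 a2 m (act a1 a2 n z) = act a1 a2 (m + n) z.
  have e (c u : C) : c != 0 -> c ^ m * (c ^ n * u) = c ^ (m + n) * u.
    by move=> c0; rewrite expfzDr // mulrA.
  by rewrite /act vec2_0 vec2_1 (e a1 _ a1n) (e a2 _ a2n).
have act0 z : act a1 a2 0 z = z by rewrite /act !expr0z !mul1r vec2E.
have nat_case (n : nat) z : Om z -> F (act a1 a2 n z) = F z.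
  elim: n z => [|n IH] z Oz; first by rewrite act0.
  by rewrite -addn1 PoszD addrC -actS hF ?IH //; exact: Omega_act.
move=> [n|n] z Oz; first exact: nat_case.
rewrite NegzE -[in RHS](act0 z) -(subrr (n.+1 : int)) -actS nat_case //.
exact: Omega_act.
Qed.

Lemma bounded_on_leaves (F : C2 -> R) : (forall z, Om z -> {for z, continuous F}) ->
  (forall z, Om z -> F (act a1 a2 1 z) = F z) ->
  exists B, forall z, z 0 0 != 0 -> z 0 1 != 0 -> kappa a1 a2 z = a * k0 -> F z <= B.
Proof.
move=> cF hF.
pose A : set (R * ((R * R) * (R * R))) := `[0, 1]%classic `*` (@circle R `*` @circle R).
have cA : compact A.
  by apply: compact_setX; [exact: segment_compact|apply: compact_setX; exact: compact_circle].
have A0 : A !=set0.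
  by exists (0, ((1, 0), (1, 0))); split; rewrite /= /circle /= ?in_itv /= ?lexx ?ler01 // mulr0 addr0 mulr1.
have cFA : {within A, continuous (F \o torus_point)}.
  apply: continuous_in_subspaceT => t; rewrite inE => -[_ [h1 h2]].
  apply: (@continuous_comp _ _ _ torus_point F); first exact: continuous_torus_point.
  by apply: cF; exact: Omega_torus_point.
have [c _ hc] := compact_EVT_max A0 cA cFA.
exists (F (torus_point c)) => z z0 z1 kz.
have Oz : Om z by split=> //; rewrite kz.
(* The time of [torus_point], read off from the second coordinate; acting with [n] brings it into
   [0, 1). *)
pose x := ln (cabs (z 0 1)) / a.
pose n : int := - Num.floor x.
have a0 : a != 0 by rewrite lt_eqF // a_lt0.
rewrite -(act_invariant hF n Oz).
set z' := act a1 a2 n z; have Oz' : Om z' by exact: Omega_act.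
have [z0' z1' _] := Oz'.
have c0 : 0 < cabs (z 0 0) by rewrite cabs_gt0.
have c1 : 0 < cabs (z 0 1) by rewrite cabs_gt0.
have c0' : 0 < cabs (z' 0 0) by rewrite cabs_gt0.
have c1' : 0 < cabs (z' 0 1) by rewrite cabs_gt0.
pose x' := x - (Num.floor x)%:~R.
have l1 : ln (cabs (z' 0 1)) = a * x'.
  rewrite /z' /act vec2_1 cabsM cabsXz lnM ?posrE ?exprz_gt0 // ln_cabsXz // -/a.
  have nE : n%:~R = - (Num.floor x)%:~R :> R by rewrite /n mulrNz.
  have xE : ln (cabs (z 0 1)) = a * x by rewrite /x mulrC divfK.
  by rewrite nE xE mulNr mulrC addrC /x' mulrBr.
(* On the level set, the time determines the modulus of the first coordinate as well. *)
have l0 : ln (cabs (z' 0 0)) = k0 + b * x'.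
  have : kappa a1 a2 z' = a * k0 by rewrite kappa_act.
  rewrite /kappa -/a -/b l1 => e; apply: (mulfI a0); rewrite mulrDr -e; ring.
have [p0 hp0 e0] := polar z0'; have [p1 hp1 e1] := polar z1'.
have -> : z' = torus_point (x', (p0, p1)).
  rewrite /torus_point /= -l0 -l1 !lnK ?posrE //.
  by rewrite -e0 -e1 vec2E.
apply: hc; rewrite inE; split; last by split.
rewrite /= in_itv /= /x' subr_ge0 lerBlDr.
have /andP[h1 h2] := floor_itv (x : R); rewrite h1 /= addrC.
by move: h2; rewrite intrD => /ltW.
Qed.

End Bounded.

Definition leaf_rate : 'I_2 -> R := fun k => if k == 0 then b else a.
(** The holomorphic vector field tangent to the leaves. Being diagonal and linear it is invariant
    under the group, and applied twice it gives the second derivative along a leaf. *)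
Definition velocity z : C2 := \row_k (ofR (leaf_rate k) * z 0 k).

(** The complex exponential of t + i th. *)
Definition cexp (t th : R) : C := ofR (expR t) * unitC (cos th, sin th).

Lemma is_derive_affine (c d t : R) : is_derive t (1 : R) (fun s => d + c * s) c.
Proof.
apply: is_derive_eq (is_derive_add (is_derive_cst _ _ _) (is_derive_scale c (is_derive_id _ _))) _.
by rewrite mulr1 add0r.
Qed.

Lemma cderiv_cexp_x (c d th t : R) :
  cderiv (fun s => cexp (d + c * s) th) t (ofR c * cexp (d + c * t) th).
Proof.
have h : is_derive t (1 : R) (fun s => expR (d + c * s)) (expR (d + c * t) * c).
  exact: (@is_derive1_comp _ (@expR R) (fun s => d + c * s) t _ _ (is_derive_expR _) (is_derive_affine _ _ _)).
apply: cderiv_eq (cderivM (cderiv_ofR h) (cderiv_cst _ _)) _.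
by rewrite mulr0 addr0 ofRM /cexp mulrAC mulrC.
Qed.

Lemma cderiv_cexp_y (c d r t : R) :
  cderiv (fun s => cexp r (d + c * s)) t ('i * (ofR c * cexp r (d + c * t))).
Proof.
have h1 : is_derive t (1 : R) (fun s => cos (d + c * s)) (- sin (d + c * t) * c).
  exact: (@is_derive1_comp _ (@cos R) (fun s => d + c * s) t _ _ (is_derive_cos _) (is_derive_affine _ _ _)).
have h2 : is_derive t (1 : R) (fun s => sin (d + c * s)) (cos (d + c * t) * c).
  exact: (@is_derive1_comp _ (@sin R) (fun s => d + c * s) t _ _ (is_derive_sin _) (is_derive_affine _ _ _)).
apply: cderiv_eq (cderivM (cderiv_cst _ _) (cderivD (cderiv_ofR h1) (cderivM (cderiv_cst _ _) (cderiv_ofR h2)))) _.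
rewrite !mul0r !add0r /cexp /unitC /= !ofRM ofRN.
move: (ofR (expR r)) (ofR (cos _)) (ofR (sin _)) (ofR c) => e co si cc.
transitivity (e * ('i * (cc * co) + ('i * 'i) * (si * cc))); last by ring.
by rewrite ii; ring.
Qed.

Lemma continuous_cexp (T : topologicalType) (f h : T -> R) (x : T) : {for x, continuous f} ->
  {for x, continuous h} -> {for x, continuous (fun q => cexp (f q) (h q))}.
Proof.
move=> cf ch; apply: continuous_cM.
  by apply: continuous_ofR_comp; exact: continuous_expR_comp.
apply: continuous_cD.
  apply: continuous_ofR_comp; apply: (@continuous_comp _ _ _ h (@cos R)); first exact: ch.
  exact: continuous_cos.
apply: continuous_cM; first exact: continuous_at_cst.
apply: continuous_ofR_comp; apply: (@continuous_comp _ _ _ h (@sin R)); first exact: ch.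
exact: continuous_sin.
Qed.

Lemma circle_cos_sin (th : R) : circle (cos th, sin th).
Proof. by rewrite /circle /= -!expr2 cos2Dsin2. Qed.

Variables (K : seq R) (k0 : R).
Hypothesis k0K : a * k0 \notin K.
Local Notation Om := (Omega a1 a2 K).

Definition leaf_base : 'I_2 -> R := fun k => if k == 0 then k0 else 0.
(** The leaf with c = e^k0. The phase has the summand 0 so as to match the affine form in
    [cderiv_cexp_y]. *)
Definition leaf_curve x y : C2 :=
  \row_k cexp (leaf_base k + leaf_rate k * x) (0 + leaf_rate k * y).

Lemma leaf_curve_kappa x y : [/\ leaf_curve x y 0 0 != 0, leaf_curve x y 0 1 != 0 &
  kappa a1 a2 (leaf_curve x y) = a * k0].
Proof.
have n0 t th : cexp t th != 0.
  by apply: mulf_neq0; [apply: ofR_neq0; rewrite gt_eqF // expR_gt0|exact: unitC_neq0 (circle_cos_sin th)].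
have lc t th : ln (cabs (cexp t th)) = t.
  rewrite /cexp cabsM cabs_ofR cabs_unitC ?mulr1; last exact: circle_cos_sin.
  by rewrite ger0_norm ?expR_ge0 // expRK.
rewrite /kappa !mxE !n0 !lc; split=> //; rewrite /leaf_base /leaf_rate /= -/a -/b; ring.
Qed.

Lemma Omega_leaf_curve x y : Om (leaf_curve x y).
Proof. by have [h0 h1 hk] := leaf_curve_kappa x y; split=> //; rewrite hk. Qed.

Lemma leaf_leaf_curve : leaf Om leaf_curve (fun x y => velocity (leaf_curve x y))
  (fun x y => velocity (velocity (leaf_curve x y))).
Proof.
have cz x y : {for (x, y), continuous (fun p : R * R => leaf_curve p.1 p.2)}.
  apply: continuous_C2 => k.
  apply: (@continuous_ext _ _ (fun p : R * R => cexp (leaf_base k + leaf_rate k * p.1) (0 + leaf_rate k * p.2))).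
    by move=> p; rewrite mxE.
  apply: continuous_cexp; apply: continuous_rD; try exact: continuous_at_cst;
    apply: continuous_rM; try exact: continuous_at_cst; (exact: continuous_fst_at || exact: continuous_snd_at).
have cv (f : R -> R -> C2) x y : {for (x, y), continuous (fun p : R * R => f p.1 p.2)} ->
    {for (x, y), continuous (fun p : R * R => velocity (f p.1 p.2))}.
  move=> cf; apply: continuous_C2 => k.
  apply: (@continuous_ext _ _ (fun p : R * R => ofR (leaf_rate k) * f p.1 p.2 0 k)); first by move=> p; rewrite mxE.
  apply: continuous_cM; first exact: continuous_at_cst.
  exact: (@continuous_coord_at _ f k x y cf).
have dzx x y k : cderiv (fun s => leaf_curve s y 0 k) x (velocity (leaf_curve x y) 0 k).
  rewrite !mxE; apply: cderiv_ext (cderiv_cexp_x _ _ _ _) => s; by rewrite mxE.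
have dzy x y k : cderiv (fun s => leaf_curve x s 0 k) y ('i * velocity (leaf_curve x y) 0 k).
  rewrite !mxE; apply: cderiv_ext (cderiv_cexp_y _ _ _ _) => s; by rewrite mxE.
split.
- exact: Omega_leaf_curve.
- exact: dzx.
- by move=> x y k; rewrite mxE; exact: dzy.
- move=> x y k; rewrite [X in cderiv _ _ X]mxE.
  have := cderivM (cderiv_cst (ofR (leaf_rate k)) x) (dzx x y k); rewrite mul0r add0r.
  by apply: cderiv_ext => s; rewrite [RHS]mxE.
- move=> x y k; rewrite mxE [X in 'i * X]mxE mulrCA.
  have := cderivM (cderiv_cst (ofR (leaf_rate k)) y) (dzy x y k); rewrite mul0r add0r.
  by apply: cderiv_ext => s; rewrite [RHS]mxE.
- exact: cz.
- by move=> x y; apply: cv; exact: cz.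
- by move=> x y; apply: (cv (fun x y => velocity (leaf_curve x y))); apply: cv; exact: cz.
Qed.

End Leaves.

(** * Vanishing of the static constant *)

Section Vanishing.
Variable R : realType.
Local Notation C := (Cplx R).
Local Notation C2 := (C2 R).
Variables (a1 a2 : C).
Hypotheses (ha1 : 0 < cabs a1) (ha2 : 0 < cabs a2) (ha2' : cabs a2 < 1).
Variables (K : seq R) (G : C2 -> 'M[C]_2) (lambda : R).
Local Notation Om := (Omega a1 a2 K).
Local Notation mu := (multipliers a1 a2).
Hypothesis sG : smooth_metric Om G.
Hypothesis stG : static_on G lambda Om.
Hypothesis G_act : forall z i j, Om z -> G z i j = mu i * (mu j)^* * G (scale2 mu z) i j.
Hypothesis D_act : forall z k, Om z -> del_adj G k z = (mu k)^* * del_adj G k (scale2 mu z).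
Hypothesis E_act : forall z k, Om z -> dlogdet G k z = (mu k)^* * dlogdet G k (scale2 mu z).
Implicit Types (z : C2) (i j k : 'I_2) (D : 'I_2 -> C2 -> C).

Local Notation vel := (velocity a1 a2).

Lemma velocity_scale2 z k : vel (scale2 mu z) 0 k = mu k * vel z 0 k.
Proof. by rewrite !mxE mulrCA. Qed.

Lemma continuous_velocity z k : {for z, continuous (fun w => vel w 0 k)}.
Proof.
apply: (@continuous_ext _ _ (fun w : C2 => ofR (leaf_rate a1 a2 k) * w 0 k)) => [w|]; first by rewrite mxE.
by apply: continuous_cM; [exact: continuous_at_cst|exact: continuous_coord].
Qed.

(** [along_leaf] as a function of the point of C^2, a form to which [bounded_on_leaves] applies. *)
Definition contract D z : C := \sum_j D j z * (vel z 0 j)^*.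

Lemma contract_act D z : (forall k, D k z = (mu k)^* * D k (scale2 mu z)) ->
  contract D (scale2 mu z) = contract D z.
Proof.
move=> h; apply: eq_bigr => j _; rewrite h velocity_scale2 cconjM.
by rewrite mulrCA mulrA.
Qed.

Lemma continuous_contract D z : (forall k, C1 Om (D k)) -> Om z -> {for z, continuous (contract D)}.
Proof.
move=> hD Oz; apply: continuous_csum => j; apply: continuous_cM; first exact: C1_cont (hD j) Oz.
by apply: continuous_cconj; exact: continuous_velocity.
Qed.

Lemma contract_bounded D (k0 : R) : ln (cabs a2) * k0 \notin K -> (forall k, C1 Om (D k)) ->
  (forall z k, Om z -> D k z = (mu k)^* * D k (scale2 mu z)) ->
  exists B, forall x y, cabs (contract D (leaf_curve a1 a2 k0 x y)) <= B.
Proof.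
move=> k0K hD hact.
have c z : Om z -> {for z, continuous (fun z => cabs (contract D z))}.
  by move=> Oz; apply: continuous_cabs_comp; exact: continuous_contract.
have e z : Om z -> cabs (contract D (act a1 a2 1 z)) = cabs (contract D z).
  by move=> Oz; rewrite act_scale2 contract_act // => k; exact: hact.
have [B hB] := bounded_on_leaves ha1 ha2 ha2' k0K c e.
exists B => x y; have [h0 h1 hk] := leaf_curve_kappa a1 a2 k0 x y; exact: hB.
Qed.

Definition area z : R := cRe (\sum_i \sum_j G z i j * vel z 0 i * (vel z 0 j)^*).

Lemma area_gt0 z : Om z -> 0 < area z.
Proof.
move=> Oz; have v0 : vel z != 0.
  apply/eqP => /rowP/(_ 1); rewrite !mxE => /eqP; rewrite mulf_eq0.
  have [_ /negbTE -> _] := Oz; rewrite orbF; apply/negP/ofR_neq0.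
  by rewrite /leaf_rate /= lt_eqF // ln_lt0 // ha2.
have h := sm_pos sG Oz v0; have [r hr] := gt0_ofR h.
by rewrite /area -ofR_gt0; move: h; rewrite hr cRe_ofR.
Qed.

Lemma area_act z : Om z -> area (scale2 mu z) = area z.
Proof.
move=> Oz; congr (cRe _); apply: eq_bigr => i _; apply: eq_bigr => j _.
rewrite !velocity_scale2 (G_act i j Oz) cconjM.
by move: (G _ _ _) (vel z 0 i) (vel z 0 j)^* (mu i) (mu j)^* => *; ring.
Qed.

Lemma continuous_area z : Om z -> {for z, continuous area}.
Proof.
move=> Oz; apply: continuous_cRe_comp; apply: continuous_csum => i; apply: continuous_csum => j.
apply: continuous_cM; last by apply: continuous_cconj; exact: continuous_velocity.
by apply: continuous_cM; [exact: C1_cont (C1_g sG i j) Oz|exact: continuous_velocity].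
Qed.

Lemma static_constant_eq0 : lambda = 0.
Proof.
apply/eqP; apply: contrapT => /negP l0.
have a0 : ln (cabs a2) != 0 by rewrite lt_eqF // ln_lt0 // ha2.
have [r rK] := notin_seq K.
pose k0 := r / ln (cabs a2).
have k0K : ln (cabs a2) * k0 \notin K by rewrite /k0 mulrC divfK.
pose zc := leaf_curve a1 a2 k0.
have Oz x y : Om (zc x y) := Omega_leaf_curve a1 k0K x y.
have [B1 hB1] := contract_bounded k0K (C1_del_adj sG) D_act.
have [B2 hB2] := contract_bounded k0K (C1_dlogdet sG) E_act.
(* [bounded_on_leaves] yields upper bounds only, so the lower bound for the area density comes from
   its inverse. *)
have [B3 hB3] : exists B, forall x y, (area (zc x y))^-1 <= B.
  have c z : Om z -> {for z, continuous (fun z => (area z)^-1)}.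
    move=> Oz'; have h : {for z, continuous area} by exact: continuous_area.
    have n0 : area z != 0 by rewrite gt_eqF // area_gt0.
    exact: (cvgV n0 h).
  have e z : Om z -> (area (act a1 a2 1 z))^-1 = (area z)^-1.
    by move=> Oz'; rewrite act_scale2 area_act.
  have [B hB] := bounded_on_leaves ha1 ha2 ha2' k0K c e.
  by exists B => x y; have [h0 h1 hk] := leaf_curve_kappa a1 a2 k0 x y; exact: hB.
have B30 : 0 < B3 by apply: lt_le_trans (hB3 0 0); rewrite invr_gt0 area_gt0.
have area_ge x y : B3^-1 <= area (zc x y).
  by rewrite -[leRHS]invrK lef_pV2 ?posrE ?invr_gt0 ?area_gt0.
pose c : R := `|lambda| * B3^-1.
have c0 : 0 < c by rewrite mulr_gt0 ?invr_gt0 // normr_gt0.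
(* Bound for the sum of the four boundary terms, each of them a value of [leafP] or [leafQ]. *)
pose T : R := 4 * (2 * B1 + 2^-1 * B2).
have B10 : 0 <= B1 by apply: le_trans (hB1 0 0); exact: cabs_ge0.
have B20 : 0 <= B2 by apply: le_trans (hB2 0 0); exact: cabs_ge0.
have T0 : 0 <= T by rewrite /T mulr_ge0 // addr_ge0 // mulr_ge0.
(* With error c / 2, the lower bound of [leaf_green] becomes exactly [T + 1], which exceeds [T]. *)
pose N : R := (T + 1) / c.
have N0 : 0 < N by rewrite divr_gt0 // ltr_wpDl.
have n2 (t B : R) : `|t| <= B -> `|2 * t| <= 2 * B.
  by move=> h; rewrite normrM ger0_norm // ler_pM2l.
have nh (t B : R) : `|t| <= B -> `|2^-1 * t| <= 2^-1 * B.
  by move=> h; rewrite normrM ger0_norm ?invr_ge0 // ler_pM2l // invr_gt0.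
have hP x y : `|leafP zc (fun x y => vel (zc x y)) G x y| <= 2 * B1 + 2^-1 * B2.
  rewrite /leafP; apply: le_trans (ler_normB _ _) _; apply: lerD.
    by rewrite mulNr normrN; apply: n2; apply: le_trans (le_Im_cabs _) _; exact: hB1.
  by apply: nh; apply: le_trans (le_Re_cabs _) _; exact: hB2.
have hQ x y : `|leafQ zc (fun x y => vel (zc x y)) G x y| <= 2 * B1 + 2^-1 * B2.
  rewrite /leafQ; apply: le_trans (ler_normB _ _) _; apply: lerD.
    by apply: n2; apply: le_trans (le_Re_cabs _) _; exact: hB1.
  by apply: nh; apply: le_trans (le_Im_cabs _) _; exact: hB2.
have hc x y : `|x| <= N -> `|y| <= N ->
    c <= Num.sg lambda * (lambda * leaf_area zc (fun x y => vel (zc x y)) G x y).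
  by move=> _ _; rewrite mulrA -normrEsg ler_pM2l ?normr_gt0 //; exact: area_ge.
have c2 : 0 < c / 2 by rewrite divr_gt0.
have [x [y [_ _]]] := leaf_green (@open_Omega _ a1 a2 K) (leaf_leaf_curve a1 k0K) sG stG N0 c2 hc.
have -> : (c - c / 2) * (2 * N) = T + 1.
  by rewrite /N; field; rewrite gt_eqF.
apply/negP; rewrite -ltNge; apply: le_lt_trans (ler_norm _) _.
rewrite normrM normr_sg (negbTE (introN eqP _)) ?mul1r; last by move/eqP: l0.
apply: le_lt_trans (_ : T < _); last by rewrite ltrDl.
rewrite (le_trans (ler_normD _ _)) //.
have := ler_normB (leafP zc (fun x y => vel (zc x y)) G N y) (leafP zc (fun x y => vel (zc x y)) G (- N) y).
have := ler_normB (leafQ zc (fun x y => vel (zc x y)) G x N) (leafQ zc (fun x y => vel (zc x y)) G x (- N)).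
have := hP N y; have := hP (- N) y; have := hQ x N; have := hQ x (- N).
rewrite -/zc /T.
move: (leafP _ _ _ _ _) (leafP _ _ _ _ _) (leafQ _ _ _ _ _) (leafQ _ _ _ _ _) => p1 p2 q1 q2.
move: `|p1 - p2| `|q1 - q2| => u1 u2; lra.
Qed.

End Vanishing.

(** * The exceptional curve *)

Section Exceptional.
Variable R : realType.
Local Notation C := (Cplx R).
Local Notation C2 := (C2 R).
Implicit Types (z w : C2) (i j k q : 'I_2) (x y : R).

(* The gluing (u, v) |-> (s, t) = (1 / v, u v) of the two charts of a blow-up. *)
Definition glue z : C2 := vec2 (z 0 1)^-1 (z 0 0 * z 0 1).

(** The row is the variable of differentiation and the column is the component of [glue], the
    convention of the pull-back formulas. *)
Definition glueJ z : 'M[C]_2 := \matrix_(i, k)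
  if k == 0 then - (1 == i)%:R / z 0 1 ^+ 2 else (0 == i)%:R * z 0 1 + z 0 0 * (1 == i)%:R.

Definition glueH z q i k : C :=
  if k == 0 then (1 == q)%:R * (1 == i)%:R * (2 / z 0 1 ^+ 3)
  else (0 == i)%:R * (1 == q)%:R + (0 == q)%:R * (1 == i)%:R.

Lemma holo_glue z k : z 0 1 != 0 -> holo_at (fun w => glue w 0 k) z (fun q => glueJ z q k).
Proof.
move=> z1; have [->|->] := ord2 k.
  have h := holoV z1 (holo_coord 1 z).
  have e : \forall w \near z, ((w : C2) 0 1)^-1 = glue w 0 0 by apply: filterE => w; rewrite vec2_0.
  by have := holo_near e h; congr (holo_at _ _ _); apply/funext => q; rewrite mxE.
have h := holoM (holo_coord 0 z) (holo_coord 1 z).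
have e : \forall w \near z, (w : C2) 0 0 * w 0 1 = glue w 0 1 by apply: filterE => w; rewrite vec2_1.
by have := holo_near e h; congr (holo_at _ _ _); apply/funext => q; rewrite mxE.
Qed.

Lemma holo_glueJ z i k : z 0 1 != 0 -> holo_at (fun w => glueJ w i k) z (fun q => glueH z q i k).
Proof.
move=> z1; have [->|->] := ord2 k; rewrite /glueH /=.
  have e : \forall w \near z, - (1 == i)%:R * ((w : C2) 0 1 * w 0 1)^-1 = glueJ w i 0.
    by apply: filterE => w; rewrite mxE /= expr2.
  have n0 : z 0 1 * z 0 1 != 0 by rewrite mulf_neq0.
  have := holo_near e (holoM (holo_cst (- (1 == i)%:R) z) (holoV n0 (holoM (holo_coord 1 z) (holo_coord 1 z)))).
  congr (holo_at _ _ _); apply/funext => q.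
  move: ((1 == q)%:R : C) ((1 == i)%:R : C) (z 0 1) z1 => a b v v0.
  by field.
have e : \forall w \near z, (0 == i)%:R * (w : C2) 0 1 + w 0 0 * (1 == i)%:R = glueJ w i 1.
  by apply: filterE => w; rewrite mxE.
have := holo_near e (holoD (holoM (holo_cst (0 == i)%:R z) (holo_coord 1 z))
  (holoM (holo_coord 0 z) (holo_cst (1 == i)%:R z))).
congr (holo_at _ _ _); apply/funext => q.
by rewrite mul0r add0r mulr0 addr0.
Qed.

Lemma glueH_sym z q i k : glueH z q i k = glueH z i q k.
Proof.
rewrite /glueH; case: (k == 0); first by rewrite [(1 == q)%:R * _]mulrC.
by rewrite addrC; congr (_ + _); rewrite mulrC.
Qed.

(** The transition function of the canonical bundle; its simple pole in v is the source of the
    degree -1 on the exceptional curve. *)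
Lemma det_glueJ z : z 0 1 != 0 -> \det (glueJ z) = (z 0 1)^-1.
Proof.
move=> z1; rewrite det2 !mxE /=.
by move: (z 0 0) (z 0 1) z1 => u v v0; field.
Qed.

Lemma holo_det_glueJ z : z 0 1 != 0 ->
  holo_at (fun w => \det (glueJ w)) z (fun q => - (1 == q)%:R / z 0 1 ^+ 2).
Proof.
move=> z1; apply: holo_near (holoV z1 (holo_coord 1 z)).
have n1 : \forall w \near z, (w : C2) 0 1 != 0 := @nonzero_near _ _ (fun w : C2 => w 0 1) z (@continuous_coord _ 1 z) z1.
by apply: filterS n1 => w w1; rewrite det_glueJ.
Qed.

Definition axis_pt x y : C2 := vec2 0 (ofR x + 'i * ofR y).

Lemma leaf_axis (U : set C2) : (forall v : C, U (vec2 0 v)) ->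
  leaf U axis_pt (fun _ _ => vec2 0 1) (fun _ _ => 0).
Proof.
move=> hU; have hx (x : R) : cderiv (fun s => ofR s : C) x 1.
  by apply: cderiv_eq (cderiv_ofR (is_derive_id _ _)) _.
split.
- by move=> x y; exact: hU.
- move=> x y k; have [->|->] := ord2 k.
    rewrite vec2_0; apply: cderiv_ext (cderiv_cst 0 x) => s; by rewrite vec2_0.
  rewrite vec2_1; apply: (@cderiv_ext _ (fun s => ofR s + 'i * ofR y)) => [s|]; first by rewrite vec2_1.
  by apply: cderiv_eq (cderivD (hx x) (cderiv_cst _ _)) _; rewrite addr0.
- move=> x y k; rewrite mxE; have [->|->] := ord2 k.
    rewrite vec2_0 mulr0; apply: cderiv_ext (cderiv_cst 0 y) => s; by rewrite vec2_0.
  rewrite vec2_1 mulr1; apply: (@cderiv_ext _ (fun s => ofR x + 'i * ofR s)) => [s|]; first by rewrite vec2_1.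
  apply: cderiv_eq (cderivD (cderiv_cst _ _) (cderivM (cderiv_cst 'i _) (hx y))) _.
  by rewrite mul0r !add0r mulr1.
- by move=> x y k; rewrite [X in cderiv _ _ X]mxE; exact: cderiv_cst.
- by move=> x y k; rewrite scaler0 [X in cderiv _ _ X]mxE; exact: cderiv_cst.
- move=> x y; apply: continuous_vec2; first exact: continuous_at_cst.
  apply: continuous_cD; first by apply: continuous_ofR_comp; exact: continuous_fst_at.
  apply: continuous_cM; first exact: continuous_at_cst.
  by apply: continuous_ofR_comp; exact: continuous_snd_at.
- by move=> x y; exact: continuous_at_cst.
- by move=> x y; exact: continuous_at_cst.
Qed.

Lemma along_leaf_axis (b : 'I_2 -> C2 -> C) x y :
  along_leaf axis_pt (fun _ _ => vec2 0 1) b x y = b 1 (axis_pt x y).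
Proof. by rewrite /along_leaf sum2 vec2_0 vec2_1 conjC0 conjC1 mulr0 add0r mulr1. Qed.

Variables (U1 U2 : set C2) (g1 g2 : C2 -> 'M[C]_2).
Hypotheses (sm1 : smooth_metric U1 g1) (sm2 : smooth_metric U2 g2).
Hypothesis U1_axis : forall v, U1 (vec2 0 v).
Hypothesis U2_0 : U2 0.
Hypothesis U12 : forall z, U1 z -> z 0 1 != 0 -> U2 (glue z).
Hypothesis g12 : forall z, U1 z -> z 0 1 != 0 -> forall i j, g1 z i j = \sum_k \sum_l
  glueJ z i k * (glueJ z j l)^* * g2 (glue z) k l.

Let V1 : set C2 := [set z | U1 z /\ z 0 1 != 0].

Let oV1 : open V1.
Proof.
rewrite openE => z [Uz z1].
have n1 : \forall w \near z, (w : C2) 0 1 != 0 := @nonzero_near _ _ (fun w : C2 => w 0 1) z (@continuous_coord _ 1 z) z1.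
have n0 : \forall w \near z, U1 w by apply: open_nbhs_nbhs; split; [exact: sm_open sm1|].
exact: filterI n0 n1.
Qed.

Let V1_axis v : v != 0 -> V1 (vec2 0 v).
Proof. by move=> v0; split; [exact: U1_axis|rewrite vec2_1]. Qed.

Lemma glue_axis (v : C) : glue (vec2 0 v) = vec2 v^-1 0.
Proof. by rewrite /glue vec2_0 vec2_1 mul0r. Qed.

Lemma glueJ_axis (v : C) : glueJ (vec2 0 v) 1 0 = - (v ^- 2) /\ glueJ (vec2 0 v) 1 1 = 0.
Proof.
by split; rewrite [LHS]mxE /= ?vec2_0 ?vec2_1 ?mulN1r ?mul0r ?addr0.
Qed.

Lemma conj_inv_sq (v : C) : (- (v ^- 2))^* = - (v^* ^- 2).
Proof. by rewrite cconjN cconjV; congr (- _^-1); exact: rmorphXn. Qed.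

(** On the curve s = 1/v, and the factor is the conjugate of ds/dv; the other factor is the torsion
    near s = 0, which is bounded for large v. *)
Lemma del_adj_axis (v : C) : v != 0 ->
  del_adj g1 1 (vec2 0 v) = - (v^* ^- 2) * del_adj g2 0 (vec2 v^-1 0).
Proof.
move=> v0; have Vv := V1_axis v0; have v1 : (vec2 0 v : C2) 0 1 != 0 by rewrite vec2_1.
rewrite (@del_adj_pullback _ U2 V1 g1 g2 glue glueJ (vec2 0 v) (glueH (vec2 0 v)) sm2 oV1 Vv
  (fun w h => U12 h.1 h.2) (fun w h => g12 h.1 h.2) (det_neq0 sm1 Vv.1)
  (fun k => holo_glue k v1) (fun i k => holo_glueJ i k v1) (glueH_sym (vec2 0 v))).
have [j0 j1] := glueJ_axis v.
by rewrite sum2 j0 j1 conj_inv_sq conjC0 mul0r addr0 glue_axis.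
Qed.

(** The second term is the conjugate of the logarithmic derivative of 1/v, contributed by
    [det_glueJ]. *)
Lemma dlogdet_axis (v : C) : v != 0 ->
  dlogdet g1 1 (vec2 0 v) = - (v^* ^- 2) * dlogdet g2 0 (vec2 v^-1 0) - (v^*)^-1.
Proof.
move=> v0; have Vv := V1_axis v0; have v1 : (vec2 0 v : C2) 0 1 != 0 by rewrite vec2_1.
rewrite (@dlogdet_pullback _ U2 V1 g1 g2 glue glueJ (vec2 0 v) sm2 oV1 Vv
  (fun w h => U12 h.1 h.2) (fun w h => g12 h.1 h.2) (det_neq0 sm1 Vv.1)
  (fun k => holo_glue k v1) _ 1 (holo_det_glueJ v1)).
have [j0 j1] := glueJ_axis v.
have ej : - ((1 : 'I_2) == 1)%:R / (vec2 0 v : C2) 0 1 ^+ 2 = - v ^- 2 by rewrite eqxx vec2_1 mulN1r.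
have ed : \det (glueJ (vec2 0 v)) = v^-1 by rewrite (det_glueJ v1) vec2_1.
rewrite sum2 j0 j1 ej ed conj_inv_sq conjC0 mul0r [X in X + _]addr0 glue_axis cconjV invrK; congr (_ + _).
have : v^* != 0 by rewrite fmorph_eq0.
by move: (v^*) => u u0; field.
Qed.

Lemma bounded_near0 (f : C2 -> C) : {for 0, continuous f} ->
  exists r B, [/\ 0 < r, 0 <= B & forall s, cabs s < r -> cabs (f (vec2 s 0)) <= B].
Proof.
move=> cf; have h : {for 0, continuous (fun w => cabs (f w))} by exact: continuous_cabs_comp.
have : \forall w \near (0 : C2), cabs (f w) < cabs (f 0) + 1.
  apply: (h [set t | t < cabs (f 0) + 1]); apply: open_nbhs_nbhs; split; first exact: open_lt.
  by rewrite /= ltrDl.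
move=> /nbhs_C2[r r0 hr]; exists r, (cabs (f 0) + 1); split=> //.
  by rewrite addr_ge0 // cabs_ge0.
move=> s sr; apply/ltW/hr => k; rewrite [X in _ - X]mxE subr0.
by have [->|->] := ord2 k; rewrite ?vec2_0 ?vec2_1 ?cabs0.
Qed.

(** For lambda = 0 the field (P, Q) has divergence zero, but for large v it is within Bd / |v|^2 of
    v / (2 |v|^2), a field with strictly positive outward flux through every large square. *)
Lemma static_constant_neq0 : ~ static_on g1 0 U1.
Proof.
move=> st.
have [r1 [B1 [r10 B10 h1]]] := bounded_near0 (C1_cont (C1_del_adj sm2 0) U2_0).
have [r2 [B2 [r20 B20 h2]]] := bounded_near0 (C1_cont (C1_dlogdet sm2 0) U2_0).
pose Bd : R := 2 * B1 + 2^-1 * B2.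
have Bd0 : 0 <= Bd by rewrite /Bd addr_ge0 // mulr_ge0 // invr_ge0.
(* The first two terms keep 1/v in the neighbourhoods where the bounds at infinity hold; the third
   makes the main boundary term exceed the errors. *)
pose N : R := r1^-1 + r2^-1 + 2 * Bd + 1.
have i1 : 0 < r1^-1 by rewrite invr_gt0.
have i2 : 0 < r2^-1 by rewrite invr_gt0.
have N1 : r1^-1 < N by rewrite /N; lra.
have N2 : r2^-1 < N by rewrite /N; lra.
have NB : 2 * Bd < N by rewrite /N; lra.
have N0 : 0 < N by apply: lt_trans N1; rewrite invr_gt0.
pose P := leafP axis_pt (fun _ _ => vec2 0 1) g1.
pose Q := leafQ axis_pt (fun _ _ => vec2 0 1) g1.
(* The term - 1 / conj v = - v / |v|^2 of [dlogdet], multiplied by -1/2, is the part subtracted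
   here; all the rest decays like 1 / |v|^2. *)
have main x y : N <= `|x| \/ N <= `|y| ->
    `|P x y - 2^-1 * x / (x * x + y * y)| <= Bd / (x * x + y * y) /\
    `|Q x y - 2^-1 * y / (x * x + y * y)| <= Bd / (x * x + y * y).
  move=> far; pose v : C := ofR x + 'i * ofR y; pose n := x * x + y * y.
  have rv : cRe v = x by rewrite /v !(cReD, cReM, cRei, cImi, cRe_ofR, cIm_ofR); ring.
  have iv : cIm v = y by rewrite /v !(cImD, cImM, cRei, cImi, cRe_ofR, cIm_ofR); ring.
  have vn : cabs v ^+ 2 = n by rewrite cabs_sq rv iv !expr2.
  have Nv : N <= cabs v.
    case: far => h; apply: le_trans h _; first by rewrite -rv le_Re_cabs.
    by rewrite -iv le_Im_cabs.
  have v0 : 0 < cabs v by exact: lt_le_trans Nv.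
  have vn0 : v != 0 by rewrite -cabs_gt0.
  have n0 : 0 < n by rewrite -vn exprn_gt0.
  have s1 : cabs v^-1 < r1 by rewrite cabsV -[ltRHS]invrK ltf_pV2 ?posrE ?invr_gt0 // (lt_le_trans N1).
  have s2 : cabs v^-1 < r2 by rewrite cabsV -[ltRHS]invrK ltf_pV2 ?posrE ?invr_gt0 // (lt_le_trans N2).
  have inv2 : cabs (- (v^* ^- 2)) = n^-1 by rewrite cabsN cabsV cabsX cabs_conj vn.
  have bD : cabs (del_adj g1 1 (axis_pt x y)) <= B1 / n.
    rewrite /axis_pt -/v del_adj_axis // cabsM inv2 mulrC ler_pM2r ?invr_gt0 //; exact: h1.
  have bE : cabs (dlogdet g1 1 (axis_pt x y) + (v^*)^-1) <= B2 / n.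
    rewrite /axis_pt -/v dlogdet_axis // subrK cabsM inv2 mulrC ler_pM2r ?invr_gt0 //; exact: h2.
  have vi : (v^*)^-1 = ofR n^-1 * v.
    by rewrite cinvE conjCK cRe_conj cIm_conj rv iv mulrNN mulrC.
  have rvi : cRe (v^*)^-1 = n^-1 * x by rewrite vi cReM cRe_ofR cIm_ofR mul0r subr0 rv.
  have ivi : cIm (v^*)^-1 = n^-1 * y by rewrite vi cImM cRe_ofR cIm_ofR mul0r addr0 iv.
  have := le_trans (le_Re_cabs _) bE; have := le_trans (le_Im_cabs _) bE.
  rewrite cReD cImD rvi ivi.
  have := le_trans (le_Re_cabs _) bD; have := le_trans (le_Im_cabs _) bD.
  rewrite /P /Q /leafP /leafQ !along_leaf_axis -/n /Bd mulrDl.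
  rewrite -!mulrA [B1 / n]mulrC [B2 / n]mulrC [x / n]mulrC [y / n]mulrC.
  move: (cRe _) (cIm _) (cRe _) (cIm _) => d1 d2 e1 e2.
  rewrite !ler_norml => /andP[? ?] /andP[? ?] /andP[? ?] /andP[? ?].
  by split; apply/andP; split; lra.
(* Two opposite sides contribute at least (N - 2 Bd) / (N^2 + t^2) with |t| <= N, hence at least kap
   / 2. Both pairs give [kap], while the error kap / (4 N) in Green's theorem allows only kap /
   2. *)
pose kap : R := (N - 2 * Bd) / (N * N).
have kap0 : 0 < kap by rewrite divr_gt0 ?mulr_gt0 // subr_gt0.
have e0 : 0 < kap / (4 * N) by rewrite divr_gt0 // mulr_gt0.
have hc x y : `|x| <= N -> `|y| <= N ->
    0 <= (-1) * (0 * leaf_area axis_pt (fun _ _ => vec2 0 1) g1 x y) :> R.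
  by move=> _ _; rewrite mul0r mulr0.
have [x [y [hx hy]]] := leaf_green (sm_open sm1) (leaf_axis U1_axis) sm1 st N0 e0 hc.
rewrite -/P -/Q.
have -> : (0 - kap / (4 * N)) * (2 * N) = - (kap / 2) by field; rewrite gt_eqF.
have nN : `|N| = N by rewrite ger0_norm // ltW.
have nN' : `|- N| = N by rewrite normrN.
have frac t : `|t| <= N -> (N - 2 * Bd) / (N * N + t * t) >= kap / 2.
  move=> ht; have tt : t * t <= N * N by move: ht; rewrite ler_norml => /andP[? ?]; nra.
  have t0 : 0 <= t * t by rewrite -expr2 sqr_ge0.
  have NN : 0 < N * N by rewrite mulr_gt0.
  rewrite /kap -mulrA -invfM ler_pM2l ?subr_gt0 //.
  by move: (t * t) (N * N) tt t0 NN => u w *; rewrite lef_pV2 ?posrE; lra.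
have leN (t : R) : `|t| = N -> N <= `|t| by move=> ->.
have [pP _] := main N y (or_introl (leN N nN)).
have [pN _] := main (- N) y (or_introl (leN _ nN')).
have [_ qP] := main x N (or_intror (leN _ nN)).
have [_ qN] := main x (- N) (or_intror (leN _ nN')).
have fy := frac y hy; have fx := frac x hx.
rewrite mulrNN in pN; rewrite mulrNN [x * x + _]addrC in qN; rewrite [x * x + _]addrC in qP.
have ey : (N - 2 * Bd) / (N * N + y * y) = N / (N * N + y * y) - 2 * (Bd / (N * N + y * y)).
  by rewrite mulrBl mulrA.
have ex : (N - 2 * Bd) / (N * N + x * x) = N / (N * N + x * x) - 2 * (Bd / (N * N + x * x)).
  by rewrite mulrBl mulrA.
rewrite ey in fy; rewrite ex in fx.
rewrite -!mulrA in pP pN qP qN.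
rewrite mulNr mulrN in pN; rewrite mulNr mulrN in qN.
move: pP pN qP qN; rewrite !ler_norml => /andP[p1 _] /andP[_ p2] /andP[q1 _] /andP[_ q2].
move: (P _ _) (P _ _) (Q _ _) (Q _ _) p1 p2 q1 q2 fx fy => pa pb qa qb.
move: (N / _) (Bd / _) (N / _) (Bd / _) => *; lra.
Qed.

End Exceptional.

(** * The two standard charts of a blow-up *)

Section Blowup.
Variable R : realType.
Local Notation C := (Cplx R).
Local Notation C2 := (C2 R).

(** The blow-up charts contain the whole v-axis and the point s = 0, and the gluing relation s v =
    1, u = s t makes their transition map equal to [glue]; this is the setting of
    [static_constant_neq0]. *)
Lemma blowup_static_neq0 (Y Z : complex_surface R) (g : metric Z) :
  is_blowup Y Z -> hermitian_metric g ->
  ~ (forall c, atlas c -> static_on (g c) 0 (cod c)).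
Proof.
move=> [x [pi [_ [c [c1 [c2 [[ac cx c0] [ac1 cod1 hp1] [ac2 cod2 hp2] _ hglue]]]]]]] hg st.
have [_ _ h3 _] := atlas_chart ac.
have cc0 : cod c 0 by have [h _ _] := h3 _ cx; rewrite -c0.
have [_ oc1 _ _] := atlas_chart ac1; have [_ _ _ k4] := atlas_chart ac2.
have U1_axis v : cod c1 (vec2 0 v).
  by rewrite cod1 /= vec2_0 mul0r (_ : vec2 0 0 = 0) //; apply/rowP => k; rewrite !mxE if_same.
have U2_0 : cod c2 0.
  by rewrite cod2 /= !mxE mulr0 (_ : vec2 0 0 = 0) //; apply/rowP => k; rewrite !mxE if_same.
have U12 z : cod c1 z -> z 0 1 != 0 -> cod c2 (glue z).
  rewrite cod1 cod2 /= => cz z1; rewrite /glue vec2_0 vec2_1.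
  by rewrite mulrCA mulVf ?mulr1.
have glued z : cod c1 z -> z 0 1 != 0 -> param c1 z = param c2 (glue z).
  move=> cz z1; apply/(hglue _ _ cz (U12 z cz z1)); rewrite /glue vec2_0 vec2_1.
  by rewrite mulrCA !mulVf // mulr1.
have g12 z : cod c1 z -> z 0 1 != 0 -> forall i j, g c1 z i j = \sum_k \sum_l
    glueJ z i k * (glueJ z j l)^* * g c2 (glue z) k l.
  move=> cz z1 i j; have et w : cod c1 w -> w 0 1 != 0 -> transition c1 c2 w = glue w.
    by move=> cw w1; rewrite /transition glued //; have [_ ->] := k4 _ (U12 w cw w1).
  have ov : overlap c1 c2 z.
    by split=> //; rewrite glued //; have [] := k4 _ (U12 z cz z1).
  have nt : \forall w \near z, glue w = transition c1 c2 w.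
    have n0 : \forall w \near z, cod c1 w by apply: open_nbhs_nbhs.
    have n1 : \forall w \near z, (w : C2) 0 1 != 0 :=
      @nonzero_near _ _ (fun w : C2 => w 0 1) z (@continuous_coord _ 1 z) z1.
    by apply: filterS (filterI n0 n1) => w [? ?]; rewrite et.
  have dT p k : dz p (fun w => transition c1 c2 w 0 k) z = glueJ z p k.
    have e : \forall w \near z, glue w 0 k = transition c1 c2 w 0 k by apply: filterS nt => w ->.
    by rewrite (holo_dz _ (holo_near e (holo_glue k z1))).
  case: hg => _ _ _ /(_ c1 c2 ac1 ac2 z ov i j) ->; rewrite et //.
  by apply: eq_bigr => k _; apply: eq_bigr => l _; rewrite !dT.
exact: (@static_constant_neq0 _ (cod c1) (cod c2) (g c1) (g c2) (smooth_metric_chart hg ac1)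
  (smooth_metric_chart hg ac2) U1_axis U2_0 U12 g12 (st c1 ac1)).
Qed.

End Blowup.

(** * Nonexistence of static metrics *)

Theorem proposition5p9 (R : realType) (a1 a2 : Cplx R) (p : nat)
  (H M : complex_surface R)
  (ha1 : 0 < `|a1|) (ha12 : `|a1| <= `|a2|) (ha2 : `|a2| < 1)
  (hH : is_hopf_surface a1 a2 H)
  (hp : (0 < p)%N)
  (hM : blown_up H p M) :
  ~ exists g : metric M, static_metric g.
Proof.
move=> [g [hg _ [lambda st] _]].
have a10 : 0 < cabs a1 by rewrite -ofR_gt0 -cabsE.
have a20 : 0 < cabs a2 by rewrite -ofR_gt0 -cabsE; exact: lt_le_trans ha12.
have a21 : cabs a2 < 1 by rewrite -ofR_lt -cabsE.
have [K [Phi dM]] := developing_blown_up a10 a20 hH hM.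
have l0 : lambda = 0.
  apply: (static_constant_eq0 a10 a20 a21 (smooth_dev_metric a20 a21 dM hg)
    (static_dev_metric a20 a21 dM hg st)).
  - by move=> z i j; exact: dev_metric_act.
  - by move=> z k; exact: del_adj_act.
  - by move=> z k; exact: dlogdet_act.
(* As [p] is positive, [M] is itself a blow-up. The last one is taken because no point of its
   exceptional curve has been blown up again, so the two standard charts are charts of [M]. *)
case: hM hp g hg st {dM Phi} => // q Y Z _ hb _ g hg st.
by apply: (blowup_static_neq0 hb hg); rewrite -l0.
Qed.
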